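(* Let $(w(t))_{t\ge0}$ be a Brownian motion on $\mathbb{H}H^n$ started at $0$ and let $\mathfrak a(t)$ be its quaternionic stochastic area process. When $t\to+\infty$, the following convergence in distribution takes place: $$\frac{\mathfrak a(t)}{\sqrt t}\to\mathcal N(0,\mathrm{Id}_3),$$ where $\mathcal N(0,\mathrm{Id}_3)$ is the $3$-dimensional normal distribution with mean $0$ and covariance matrix $\mathrm{Id}_3$.
   Context: $n\ge1$. $\mathbb{H}$ is the field of quaternions with units $I,J,K$; imaginary quaternions $xI+yJ+zK$ are identified with $(x,y,z)\in\mathbb{R}^3$. The quaternionic hyperbolic space $\mathbb{H}H^n$ is identified with $\{w\in\mathbb{H}^n:|w|<1\}$ (inhomogeneous coordinates) with the Riemannian metric $\frac{\sum_j|dw_j|^2}{1-|w|^2}+\frac{|\sum_j dw_j\overline{w_j}|^2}{(1-|w|^2)^2}$. Brownian motion on it has generator $\frac12\Delta_{\mathbb{H}H^n}$ (half the Laplace–Beltrami operator). Its quaternionic stochastic area process is $$\mathfrak a(t)=\frac12\sum_{j=1}^n\int_0^t\frac{dw_j(s)\overline{w_j}(s)-w_j(s)d\overline{w_j}(s)}{1-|w(s)|^2}\in\mathbb{R}^3$$ (Stratonovich, equivalently Itô, integrals). *)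

(* Defs.v *)
From HB Require Import structures.
From mathcomp Require Import all_boot all_order all_algebra.
From mathcomp Require Import all_classical all_reals all_analysis.

Set Implicit Arguments.
Unset Strict Implicit.
Unset Printing Implicit Defensive.

Import Order.TTheory GRing.Theory Num.Theory.
Import numFieldNormedType.Exports.

Local Open Scope classical_set_scope.
Local Open Scope ring_scope.

(* The quaternion a + b I + c J + d K is the row vector (a, b, c, d), and a
   point of H^n is the n x 4 matrix whose rows are its quaternionic coordinates.
   The library norm on matrices is the sup norm, so the Euclidean norms of
   quaternions and of H^n are defined separately; the topology, the notion of
   differentiability and convergence in probability are the usual ones. *)
Notation quat R := 'rV[R]_4.

Section Quaternions.
Variable R : realType.
Implicit Types p q : quat R.

Definition qmk (a b c d : R) : quat R := \row_(i < 4) [:: a; b; c; d]`_i.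

Definition qmul p q : quat R :=
  let a := p 0 0 in let b := p 0 1 in let c := p 0 2 in let d := p 0 3 in
  let a' := q 0 0 in let b' := q 0 1 in let c' := q 0 2 in let d' := q 0 3 in
  qmk (a * a' - b * b' - c * c' - d * d')
      (a * b' + b * a' + c * d' - d * c')
      (a * c' - b * d' + c * a' + d * b')
      (a * d' + b * c' - c * b' + d * a').

Definition qconj q : quat R := qmk (q 0 0) (- q 0 1) (- q 0 2) (- q 0 3).

Definition qnorm2 q : R := \sum_i q 0 i ^+ 2.

Definition qim (v : R * R * R) : quat R := qmk 0 v.1.1 v.1.2 v.2.

End Quaternions.

Section QuaternionicHyperbolicSpace.
Variables (R : realType) (n : nat).
Implicit Types (w u v : 'M[R]_(n, 4)) (f : 'M[R]_(n, 4) -> R).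

Definition hnorm2 w : R := \sum_j qnorm2 (row j w).

Definition HHn : set 'M[R]_(n, 4) := [set w | hnorm2 w < 1].

Definition metric_quad w u : R :=
  hnorm2 u / (1 - hnorm2 w) +
  qnorm2 (\sum_j qmul (row j u) (qconj (row j w))) / (1 - hnorm2 w) ^+ 2.

Definition metric w u v : R :=
  (metric_quad w (u + v) - metric_quad w u - metric_quad w v) / 2.

(* The coordinate vector fields of the global chart of H^n = R^(4 n). *)
Definition coord_vec (a : 'I_(n * 4)) : 'M[R]_(n, 4) := vec_mx (delta_mx 0 a).

Definition gram w : 'M[R]_(n * 4) :=
  \matrix_(a, b) metric w (coord_vec a) (coord_vec b).

(* (det g)^(-1/2) sum_(a, b) d_a ((det g)^(1/2) g^(ab) d_b f) *)
Definition laplace_beltrami f w : R :=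
  (Num.sqrt (\det (gram w)))^-1 *
  \sum_a \sum_b 'D_(coord_vec a)
    (fun z => Num.sqrt (\det (gram z)) * invmx (gram z) a b *
              'D_(coord_vec b) f z) w.

Definition smooth f : Prop :=
  forall (vs : seq 'M[R]_(n, 4)) w,
    differentiable (foldr (fun v g => (fun z => 'D_v g z)) f vs) w.

Definition test_function f : Prop :=
  smooth f /\
  exists K, [/\ compact K, K `<=` HHn & forall z, ~ K z -> f z = 0].

End QuaternionicHyperbolicSpace.

Section Processes.
Variables (R : realType) (d : measure_display) (T : measurableType d).
Variable P : probability T R.

Definition natural_filtration (n : nat) (w : R -> T -> 'M[R]_(n, 4)) (t : R) :
    set (set T) :=
  <<s [set A | exists s (i : 'I_n) (k : 'I_4) (B : set R),
    [/\ 0 <= s <= t, measurable B & A = (fun x => w s x i k) @^-1` B] ] >>.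

Definition martingale (F : R -> set (set T)) (M : R -> T -> R) : Prop :=
  [/\ forall t, 0 <= t -> forall B : set R, measurable B -> F t (M t @^-1` B),
      forall t, 0 <= t -> P.-integrable setT (EFin \o M t)
    & forall s t, 0 <= s <= t -> forall A, F s A ->
        (\int[P]_(x in A) (M t x)%:E = \int[P]_(x in A) (M s x)%:E)%E].

(* Only times t >= 0 are relevant.  That the generator is half the
   Laplace-Beltrami operator is expressed by the martingale problem. *)
Definition brownian_motion_HHn (n : nat) (w : R -> T -> 'M[R]_(n, 4))
    (w0 : 'M[R]_(n, 4)) : Prop :=
  [/\ forall t, 0 <= t -> forall i k,
        measurable_fun setT (fun x => w t x i k),
      forall t x, 0 <= t -> HHn (w t x),
      forall x, {within `[0, +oo[, continuous (fun t => w t x)},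
      forall x, w 0 x = w0
    & forall f, test_function f ->
        martingale (natural_filtration w)
          (fun t x => f (w t x) - f (w 0 x) -
             \int[lebesgue_measure]_(s in `[0, t])
               (2^-1 * laplace_beltrami f (w s x)))].

(* [s] lists the points t_1 < ... < t_m = t of a subdivision of [0, t]. *)
Definition partition_point (s : seq R) (i : nat) : R := nth 0 (0 :: s) i.

Definition mesh_lt (s : seq R) (e : R) : Prop :=
  forall i, (i < size s)%N ->
    partition_point s i.+1 - partition_point s i < e.

Definition stratonovich_sum (L : quat R -> quat R -> quat R)
    (X Y : R -> T -> quat R) (s : seq R) (x : T) : quat R :=
  \sum_(i < size s)
    let t0 := partition_point s i in let t1 := partition_point s i.+1 in
    L (X t1 x - X t0 x) (2^-1 *: (Y t0 x + Y t1 x)).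

(* [Z] is the Stratonovich integral int_0^t L(dX, Y), L being bilinear (here a
   quaternion product, in one order or the other): the limit in probability of
   the trapezoidal sums as the mesh of the subdivision tends to 0. *)
Definition stratonovich_integral (L : quat R -> quat R -> quat R)
    (X Y : R -> T -> quat R) (t : R) (Z : T -> quat R) : Prop :=
  (forall k, measurable_fun setT (fun x => Z x 0 k)) /\
  forall e eta : R, 0 < e -> 0 < eta -> exists2 del : R, 0 < del &
    forall s, itv_partition 0 t s -> mesh_lt s del ->
      (P [set x | (e < `|stratonovich_sum L X Y s x - Z x|)%R] <= eta%:E)%E.

Definition stochastic_area (n : nat) (w : R -> T -> 'M[R]_(n, 4))
    (a : R -> T -> R * R * R) : Prop :=
  forall t, 0 <= t ->
  measurable_fun setT (a t) /\
  exists A B : 'I_n -> T -> quat R,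
  [/\ forall j, stratonovich_integral (@qmul R)
        (fun s x => row j (w s x))
        (fun s x => (1 - hnorm2 (w s x))^-1 *: qconj (row j (w s x)))
        t (A j),
      forall j, stratonovich_integral (fun dx y => qmul y dx)
        (fun s x => qconj (row j (w s x)))
        (fun s x => (1 - hnorm2 (w s x))^-1 *: row j (w s x))
        t (B j)
    & {ae P, forall x, qim (a t x) = 2^-1 *: \sum_j (A j x - B j x)}].

Definition converges_in_distribution (X : R -> T -> R * R * R)
    (mu : set (R * R * R) -> \bar R) : Prop :=
  forall f : R * R * R -> R, continuous f ->
    (exists M, forall y, `|f y| <= M) ->
    (\int[P]_x (f (X t x))%:E)%E @[t --> +oo] --> (\int[mu]_y (f y)%:E)%E.

End Processes.

Definition normal3 (R : realType) : set (R * R * R) -> \bar R :=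
  (normal_prob (0 : R) 1 \x normal_prob (0 : R) 1 \x normal_prob (0 : R) 1)%E.

(* Main.v *)
Require Import Defs.
From HB Require Import structures.
From mathcomp Require Import all_boot all_order all_algebra.
From mathcomp Require Import all_classical all_reals all_analysis.
From mathcomp Require Import measurable_realfun ring lra.
Set Implicit Arguments.
Unset Strict Implicit.
Unset Printing Implicit Defensive.
Import Order.TTheory GRing.Theory Num.Theory.
Import numFieldNormedType.Exports.
Local Open Scope classical_set_scope.
Local Open Scope ring_scope.


(* The trapezoidal sum defining [l . a(t)] is a sum of increments [psi z y], where [z]
   and [y] are consecutive positions of the path.  Since [z] and [l z] are orthogonal,
   the generator L satisfies L (psi z) (z) = 0 and L (psi z ^ 2) (z) = |l|^2 |z|^2, while
   L (psi z ^ m) (z) = 0 for m > 2.  The martingale problem turns this into conditional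
   moments of the increments; a Taylor expansion of the cosine then shows that a step of
   length h multiplies the expectation of cos (ph + l . a) by 1 - |l|^2 h / 2, up to an
   error of order |l|^2 (1 - |w|^2) h.  As L |w|^2 = 4 n (1 - |w|^2), the integral of
   E (1 - |w|^2) over all times is at most 1 / (4 n), so that the characteristic function
   of a(t) / sqrt t is within O(1 / t) of the Gaussian one.  Products of sines approximate
   bounded continuous functions through Bernstein polynomials, which gives convergence in
   distribution.  As test functions have compact support, all this is done up to the exit
   from a ball of radius < 1, whose probability vanishes as the radius tends to 1. *)

(** * Test functions on the ball *)

(** The characteristic function is treated through the real quantity E cos (ph + l . a) for every
    phase [ph]; phases 0 and -pi/2 give its real and imaginary parts, and a phase also lets
    coordinates of a product law be integrated out one at a time. The martingale problem concerns a
    fixed test function of the current position, whereas an increment [psi z y] also depends on the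
    random position z at the start of the step. Since [psi] and its powers are finite sums of
    products g(z) f(y), the factor g(z) is moved into the weight already known at that time, and
    only f(y) is submitted to the martingale problem. Sine and cosine are expanded to order three,
    so moments up to order four suffice: the first and third are negligible, the second carries the
    variance, the fourth bounds the remainder. Limits are taken in a fixed order: at fixed t the
    mesh of the uniform subdivisions tends to 0, then the radius of the ball tends to 1, and only
    then does t tend to infinity. *)

Section Flat.
Variable R : realType.
Implicit Types x : R.

(** The index [k] makes the family of functions x^-k exp (-1/x) stable under differentiation, so
    that cutoffs built from [flat 0] have all their derivatives in one explicit class. *)
Definition flat (k : nat) x : R :=
  if 0 < x then x^-1 ^+ k * expR (- x^-1) else 0.

Lemma flat_ge0 k x : 0 <= flat k x.
Proof.
rewrite /flat; case: ifPn => // x0.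
by rewrite mulr_ge0 ?expR_ge0// exprn_ge0// invr_ge0 ltW.
Qed.

Lemma flat_gt0 k x : 0 < x -> 0 < flat k x.
Proof. by move=> x0; rewrite /flat x0 mulr_gt0 ?expR_gt0// exprn_gt0// invr_gt0. Qed.

Lemma flat_le0 k x : x <= 0 -> flat k x = 0.
Proof. by move=> x0; rewrite /flat ltNge x0. Qed.

(** From exp y >= y^(k+2) / (k+2)! with y = 1/x. A quadratic bound is what forces the derivative at
    0 to vanish. *)
Lemma flat_le_sqr k x : flat k x <= k.+2`!%:R * x ^+ 2.
Proof.
have [x0|x0] := ltP 0 x; last by rewrite flat_le0// mulr_ge0// sqr_ge0.
rewrite /flat x0; set y := x^-1.
have y0 : 0 < y by rewrite invr_gt0.
have xE : x = y^-1 by rewrite /y invrK.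
have F0 : (0 : R) < k.+2`!%:R by rewrite ltr0n fact_gt0.
have H : y ^+ k.+2 / k.+2`!%:R <= expR y.
  by apply: le_trans (expR_ge1Dxn k.+1 (ltW y0)); rewrite lerDr.
rewrite expRN xE ler_pdivrMr ?expR_gt0//.
apply: le_trans (_ : _ <= k.+2`!%:R * y^-1 ^+ 2 * (y ^+ k.+2 / k.+2`!%:R)) _.
  rewrite le_eqVlt; apply/orP; left; apply/eqP.
  rewrite exprVn -addn2 exprD; field.
  by rewrite !gt_eqF.
by apply: ler_wpM2l => //; rewrite mulr_ge0 ?sqr_ge0.
Qed.

Lemma is_derive_flat k x :
  is_derive x 1 (flat k) (flat k.+2 x - k%:R * flat k.+1 x).
Proof.
have [x0|x0|->] := ltgtP x 0.
- rewrite !flat_le0 ?(ltW x0)// mulr0 subr0.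
  apply: (@near_eq_is_derive _ _ _ (cst 0)) => //.
  near=> y; rewrite flat_le0//; near: y.
  by apply: filterS (lt_nbhsl x0) => y /ltW.
- have D : is_derive x 1 (fun y : R => y^-1 ^+ k * expR (- y^-1))
      (flat k.+2 x - k%:R * flat k.+1 x).
    have xn0 : x != 0 by rewrite gt_eqF.
    have iV : is_derive x 1 (fun y : R => y^-1) (- x ^- 2).
      have := is_deriveV xn0 (is_derive_id x 1).
      by move=> h; apply: is_derive_eq h _; rewrite scaler1.
    have iX : is_derive x 1 (fun y : R => y^-1 ^+ k)
       (k%:R * x^-1 ^+ k.-1 * - x ^- 2).
      have := @is_deriveX _ _ (fun y : R => y^-1) k x 1 _ iV.
      move=> h; have -> : (fun y : R => y^-1 ^+ k) = (fun y => y^-1) ^+ k.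
        by apply/funext => y; rewrite fctE.
      by apply: is_derive_eq h _; rewrite -mulr_natl.
    have iE : is_derive x 1 (fun y : R => expR (- y^-1)) (expR (- x^-1) * x ^- 2).
      have iN := @is_deriveN _ _ _ _ _ _ _ iV.
      have := @is_derive1_comp _ (@expR R) (fun y => - y^-1) x _ _ (is_derive_expR _) iN.
      by move=> h; apply: is_derive_eq h _; rewrite opprK.
    have D0 := is_deriveM iX iE.
    apply: is_derive_eq D0 _.
    rewrite /flat x0 /GRing.scale/=.
    case: k {iX} => [|k] /=; first by rewrite !mul0r mulr0 subr0 expr0 addr0 mul1r -exprVn mulrC.
    by rewrite -exprVn !exprS; ring.
  apply: near_eq_is_derive D; near=> y; rewrite /flat ifT//; near: y.
  exact: lt_nbhsr.
(* At 0 the difference quotient is at most (k+2)! |h| in absolute value. *)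
- rewrite !flat_le0 ?lexx// mulr0 subr0.
  have C : h^-1 *: (flat k (h *: 1 + 0) - flat k 0) @[h --> 0^'] --> (0 : R).
    rewrite (flat_le0 k (lexx 0)).
    apply/cvgr0Pnorm_le => e e0.
    have F0 : (0 : R) < k.+2`!%:R by rewrite ltr0n fact_gt0.
    near=> h.
    rewrite subr0 addr0 /GRing.scale/= mulr1 normrM (ger0_norm (flat_ge0 _ _)).
    have hn0 : h != 0 by near: h; exact: nbhs_dnbhs_neq.
    apply: (@le_trans _ _ (`|h^-1| * (k.+2`!%:R * h ^+ 2))).
      by rewrite ler_wpM2l ?flat_le_sqr.
    have -> : `|h^-1| * (k.+2`!%:R * h ^+ 2) = k.+2`!%:R * `|h|.
      rewrite -(normr_id h) -[h ^+ 2]ger0_norm ?sqr_ge0// normrX normrV ?unitfE//.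
      by rewrite normr_id; field; rewrite normr_eq0.
    rewrite mulrC -ler_pdivlMr//.
    near: h; apply: dnbhs0_le; by rewrite divr_gt0.
  by apply: DeriveDef; [apply/cvg_ex; exists 0; exact: C | apply/cvg_lim => //; exact: C].
Unshelve. all: by end_near. Qed.

End Flat.

Section Nice.
Variables (R : realType) (n : nat).
Local Notation V := 'M[R]_(n, 4).

(* A concrete algebra of smooth functions, stable under directional derivatives,
   that contains the rational functions without poles and smooth cutoffs. *)
Inductive nice : (V -> R) -> Prop :=
| nice_cst a : nice (fun _ => a)
| nice_coord i k : nice (fun y => y i k)
| nice_add f g : nice f -> nice g -> nice (fun y => f y + g y)
| nice_mul f g : nice f -> nice g -> nice (fun y => f y * g y)
| nice_inv f : nice f -> (forall y, f y != 0) -> nice (fun y => (f y)^-1)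
| nice_flat k f : nice f -> nice (fun y => flat k (f y)).

Lemma nice_eq f g : nice f -> f =1 g -> nice g.
Proof. by move=> nf /funext <-. Qed.

Lemma nice_opp f : nice f -> nice (fun y => - f y).
Proof.
move=> nf; apply: nice_eq (nice_mul (nice_cst (-1)) nf) _ => y.
by rewrite mulN1r.
Qed.

Lemma nice_sub f g : nice f -> nice g -> nice (fun y => f y - g y).
Proof. by move=> nf ng; exact: nice_add nf (nice_opp ng). Qed.

Lemma nice_exp f m : nice f -> nice (fun y => f y ^+ m).
Proof.
move=> nf; elim: m => [|m ih]; first exact: nice_cst.
by apply: nice_eq (nice_mul nf ih) _ => y; rewrite exprS.
Qed.

Lemma nice_sum (I : Type) (r : seq I) (F : I -> V -> R) :
  (forall i, nice (F i)) -> nice (fun y => \sum_(i <- r) F i y).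
Proof.
move=> nF; elim: r => [|i r ih].
  by apply: nice_eq (nice_cst 0) _ => y; rewrite big_nil.
by apply: nice_eq (nice_add (nF i) ih) _ => y; rewrite big_cons.
Qed.

Lemma derive_coord (i : 'I_n) (k : 'I_4) (v y : V) :
  'D_v (fun z : V => z i k : R) y = v i k.
Proof.
have @f : {linear V -> R}.
  by exists (fun N : V => N i k); do 2![eexists]; do ?[constructor];
     rewrite ?mxE// => ? *; rewrite ?mxE//; move=> ?; rewrite !mxE.
rewrite deriveE; last exact: differentiable_coord.
rewrite (_ : (fun z : V => z i k) = f)// diff_lin//.
exact: coord_continuous.
Qed.

Lemma derive_comp1 (g : R -> R) (f : V -> R) (dg : R) (v y : V) :
  differentiable f y -> is_derive (f y) 1 g dg ->
  differentiable (g \o f) y /\ 'D_v (g \o f) y = dg * 'D_v f y.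
Proof.
move=> df ig.
have dfg : differentiable g (f y) by apply/derivable1_diffP; case: ig.
have dc : differentiable (g \o f) y by exact: differentiable_comp.
split=> //; rewrite deriveE// diff_comp//= deriveE// diff1E//=.
by rewrite derive1E derive_val mulrC.
Qed.

(** Both halves go through a single induction: the derivative formula of each constructor needs the
    differentiability of its arguments. *)
Lemma nice_derive f : nice f ->
  (forall y, differentiable f y) /\ (forall v, nice (fun y => 'D_v f y)).
Proof.
elim=> [a|i k|{}f g nf [df Df] ng [dg Dg]|{}f g nf [df Df] ng [dg Dg]
       |{}f nf [df Df] f0|k {}f nf [df Df]].
- split=> [y|v]; first exact: differentiable_cst.
  by apply: nice_eq (nice_cst 0) _ => y; rewrite derive_cst.
- split=> [y|v]; first exact: differentiable_coord.
  by apply: nice_eq (nice_cst (v i k)) _ => y; rewrite derive_coord.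
- split=> [y|v]; first exact: differentiableD.
  apply: nice_eq (nice_add (Df v) (Dg v)) _ => y.
  by rewrite deriveD//; exact: diff_derivable.
- split=> [y|v]; first exact: differentiableM.
  apply: nice_eq (nice_add (nice_mul nf (Dg v)) (nice_mul ng (Df v))) _ => y.
  by rewrite deriveM//; exact: diff_derivable.
- split=> [y|v]; first exact: differentiableV.
  apply: nice_eq (nice_opp (nice_mul (nice_exp 2 (nice_inv nf f0)) (Df v))) _ => y.
  rewrite deriveV//; last exact: diff_derivable.
  by rewrite exprVn scaleNr.
- have C v y := @derive_comp1 (flat k) f _ v y (df y) (is_derive_flat k (f y)).
  split=> [y|v]; first by have [] := C 0 y.
  apply: nice_eq (nice_mul (nice_sub (nice_flat k.+2 nf)
     (nice_mul (nice_cst k%:R) (nice_flat k.+1 nf))) (Df v)) _ => y.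
  by have [_ <-] := C v y.
Qed.

Lemma nice_differentiable f y : nice f -> differentiable f y.
Proof. by case/nice_derive. Qed.

Lemma nice_D f v : nice f -> nice (fun y => 'D_v f y).
Proof. by case/nice_derive. Qed.

Lemma nice_derivable f v y : nice f -> derivable f y v.
Proof. by move=> nf; apply: diff_derivable; exact: nice_differentiable. Qed.

Lemma nice_smooth f : nice f -> smooth f.
Proof.
move=> nf vs w; apply: nice_differentiable.
by elim: vs => //= v vs ih; exact: nice_D.
Qed.

Lemma nice_continuous f : nice f -> continuous f.
Proof. by move=> nf y; apply: differentiable_continuous; exact: nice_differentiable. Qed.

End Nice.

Arguments nice_cst {R n} a.
Arguments nice_coord {R n} i k.
Section Ball.
Variables (R : realType) (n : nat).
Local Notation V := 'M[R]_(n, 4).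
Implicit Types (w y z : V) (f g : V -> R).

Lemma mx_entry_le_norm (m p : nat) (v : 'M[R]_(m, p)) i j : `|v i j| <= `|v|.
Proof.
by rewrite [leRHS]/Num.Def.normr/= mx_normrE; apply: (le_bigmax _ (fun ij => `|v ij.1 ij.2|) (i, j)).
Qed.

Lemma mx_norm_le_entry (m p : nat) (v : 'M[R]_(m, p)) (M : R) :
  0 <= M -> (forall i j, `|v i j| <= M) -> `|v| <= M.
Proof.
move=> M0 vM; rewrite [leLHS]/Num.Def.normr/= mx_normrE; apply/bigmax_leP; split=> // -[i j] _; exact: vM.
Qed.

Lemma hnorm2E w : hnorm2 w = \sum_j \sum_k w j k ^+ 2.
Proof.
by apply: eq_bigr => j _; apply: eq_bigr => k _; rewrite mxE.
Qed.

Lemma hnorm2_ge0 w : 0 <= hnorm2 w.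
Proof. by rewrite hnorm2E; do 2 (apply: sumr_ge0 => ? _); exact: sqr_ge0. Qed.

Lemma sqr_entry_le_hnorm2 w j k : w j k ^+ 2 <= hnorm2 w.
Proof.
rewrite hnorm2E (bigD1 j)//= (bigD1 k)//= -addrA lerDl addr_ge0//.
  by apply: sumr_ge0 => ? _; exact: sqr_ge0.
by do 2 (apply: sumr_ge0 => ? _); exact: sqr_ge0.
Qed.

Lemma nice_hnorm2 : nice (@hnorm2 R n).
Proof.
apply: (@nice_eq _ _ (fun w : V => \sum_j \sum_k w j k ^+ 2)).
  by do 2 apply: nice_sum => ?; apply: nice_exp; exact: nice_coord.
by move=> w; rewrite hnorm2E.
Qed.

Lemma vec_mx_continuous (m p : nat) :
  continuous (vec_mx : 'rV[R]_(m * p) -> 'M[R]_(m, p)).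
Proof.
move=> v; apply/(@cvgrPdist_le _ _ _ (nbhs v)) => e e0.
near=> u; rewrite -linearB/=; apply: mx_norm_le_entry; first exact: ltW.
move=> i j; rewrite mxE; apply: le_trans (mx_entry_le_norm _ _ _) _.
near: u; exact: cvgr_dist_le.
Unshelve. all: by end_near. Qed.

(** Heine-Borel is applied to row vectors of length 4n, and the ball is the image of the resulting
    compact set under the continuous map [vec_mx]. *)
Lemma hball_compact (b : R) : compact [set w : V | hnorm2 w <= b].
Proof.
have cl : closed [set w : V | hnorm2 w <= b].
  have /continuous_closedP := nice_continuous nice_hnorm2.
  exact: (fun H => H _ (@closed_le R b)).
have -> : [set w : V | hnorm2 w <= b] =
    vec_mx @` [set v : 'rV[R]_(n * 4) | hnorm2 (vec_mx v : V) <= b].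
  apply/seteqP; split=> [w wb|_ [v vb <-]//].
  by exists (mxvec w); rewrite /= mxvecK.
apply: continuous_compact.
  by apply: continuous_subspaceT; exact: vec_mx_continuous.
apply: bounded_closed_compact; last first.
  by have /continuous_closedP := @vec_mx_continuous n 4; exact: (fun H => H _ cl).
exists (b + 1); split; first exact: num_real.
move=> M bM v /= vb; have b0 : 0 <= b by exact: le_trans (hnorm2_ge0 _) vb.
apply: mx_norm_le_entry => [|i j]; first by rewrite (le_trans _ (ltW bM))// addr_ge0.
rewrite ord1; case/mxvec_indexP: j => j k.
have -> : v 0 (mxvec_index j k) = vec_mx v j k by rewrite mxE.
have H := le_trans (sqr_entry_le_hnorm2 (vec_mx v) j k) vb.
rewrite (le_trans _ (ltW bM))// -(@ler_pXn2r _ 2)// ?nnegrE ?addr_ge0//.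
by rewrite real_normK ?num_real//; apply: le_trans H _; nra.
Qed.

(** Used with [b = 1]: a nice function is continuous on the whole space, hence bounded along any
    path that stays in the open unit ball. *)
Lemma nice_bounded f (b : R) : nice f ->
  exists2 M, 0 <= M & forall y, hnorm2 y <= b -> `|f y| <= M.
Proof.
move=> nf.
have /compact_bounded[M [_ HM]] : compact (f @` [set w | hnorm2 w <= b]).
  apply: continuous_compact; last exact: hball_compact.
  by apply: continuous_subspaceT; exact: nice_continuous.
exists (`|M| + 1); first by rewrite addr_ge0.
move=> y yb; apply: (HM (`|M| + 1)); last by exists y.
by rewrite (le_lt_trans (ler_norm _))// ltrDl.
Qed.

(** The standard smooth step from 1 on |y|^2 <= a to 0 on |y|^2 >= b; for a < b the two terms of the
    denominator never vanish together. *)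
Definition cutoff (a b : R) y : R :=
  flat 0 (b - hnorm2 y) * (flat 0 (b - hnorm2 y) + flat 0 (hnorm2 y - a))^-1.

Section Cutoff.
Variables (a b : R).
Hypothesis ab : a < b.

Lemma cutoff_den_gt0 y : 0 < flat 0 (b - hnorm2 y) + flat 0 (hnorm2 y - a).
Proof.
have [yb|yb] := ltP (hnorm2 y) b.
  by apply: ltr_pwDl; [apply: flat_gt0; rewrite subr_gt0|exact: flat_ge0].
apply: ltr_wpDl; first exact: flat_ge0.
by apply: flat_gt0; rewrite subr_gt0 (lt_le_trans ab).
Qed.

Lemma nice_cutoff : nice (cutoff a b).
Proof.
have n1 : nice (fun y : V => flat 0 (b - hnorm2 y)).
  by apply: nice_flat; exact: nice_sub (nice_cst _) nice_hnorm2.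
have n2 : nice (fun y : V => flat 0 (hnorm2 y - a)).
  by apply: nice_flat; exact: nice_sub nice_hnorm2 (nice_cst _).
apply: nice_mul => //; apply: nice_inv; first exact: nice_add.
by move=> y; rewrite gt_eqF// cutoff_den_gt0.
Qed.

Lemma cutoff1 y : hnorm2 y <= a -> cutoff a b y = 1.
Proof.
move=> ya; rewrite /cutoff (@flat_le0 _ _ (hnorm2 y - a)) ?subr_le0// addr0 divff//.
by rewrite gt_eqF// flat_gt0// subr_gt0 (le_lt_trans ya).
Qed.

Lemma cutoff0 y : b <= hnorm2 y -> cutoff a b y = 0.
Proof. by move=> yb; rewrite /cutoff flat_le0 ?mul0r// subr_le0. Qed.

Lemma cutoff_ge0 y : 0 <= cutoff a b y.
Proof. by rewrite mulr_ge0 ?flat_ge0// invr_ge0 ltW// cutoff_den_gt0. Qed.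

Lemma cutoff_le1 y : cutoff a b y <= 1.
Proof. by rewrite ler_pdivrMr ?cutoff_den_gt0// mul1r lerDl flat_ge0. Qed.

Hypothesis b1 : b < 1.

Lemma nice_test_function f : nice f -> test_function (fun y => f y * cutoff a b y).
Proof.
move=> nf; split; first by apply: nice_smooth; exact: nice_mul nf nice_cutoff.
exists [set y | hnorm2 y <= b]; split; first exact: hball_compact.
  by move=> y /= yb; exact: le_lt_trans yb b1.
by move=> y /= /negP; rewrite -ltNge => /ltW/cutoff0 ->; rewrite mulr0.
Qed.

(** A globally defined version of the factor 1 / (1 - |y|^2), with which it agrees on |y|^2 <= a. *)
Definition conf y : R := (1 - hnorm2 y * cutoff a b y)^-1.

Lemma conf_den_gt0 y : 0 < 1 - hnorm2 y * cutoff a b y.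
Proof.
rewrite subr_gt0; have [yb|yb] := ltP (hnorm2 y) b; last by rewrite cutoff0// mulr0.
apply: le_lt_trans (lt_trans yb b1).
by rewrite ler_piMr ?hnorm2_ge0// cutoff_le1.
Qed.

Lemma nice_conf : nice conf.
Proof.
apply: nice_inv; last by move=> y; rewrite gt_eqF// conf_den_gt0.
by apply: nice_sub (nice_cst _) _; apply: nice_mul nice_hnorm2 nice_cutoff.
Qed.

Lemma confE y : hnorm2 y <= a -> conf y = (1 - hnorm2 y)^-1.
Proof. by move=> ya; rewrite /conf cutoff1// mulr1. Qed.

End Cutoff.
End Ball.

Arguments nice_hnorm2 {R n}.

(** * The Laplace-Beltrami operator in coordinates *)

Section DetSylvester.
Variable F : comPzRingType.

(** Sylvester's identity: multiplying the block matrix [P] by two different unipotent matrices makes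
    it triangular in two ways. It reduces the determinant of the metric to that of a 4 x 4
    matrix. *)
Lemma det_1mulmx_comm (m p : nat) (A : 'M[F]_(m, p)) (B : 'M[F]_(p, m)) :
  \det (1%:M + A *m B) = \det (1%:M + B *m A).
Proof.
pose P := block_mx 1%:M (- A) B 1%:M : 'M[F]_(m + p).
have e1 : block_mx 1%:M 0 (- B) 1%:M *m P = block_mx 1%:M (- A) 0 (1%:M + B *m A).
  by rewrite mulmx_block !mul1mx !mul0mx !mulmx1 !addr0 mulNmx mulmxN opprK addNr addrC.
have e2 : block_mx 1%:M A 0 1%:M *m P = block_mx (1%:M + A *m B) 0 B 1%:M.
  by rewrite mulmx_block !mul1mx !mul0mx !mulmx1 !add0r addNr.
have <- : \det P = \det (1%:M + A *m B).
  by have := congr1 (fun M => \det M) e2; rewrite det_mulmx det_ublock det_lblock !det1 !mul1r !mulr1.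
have := congr1 (fun M => \det M) e1.
by rewrite det_mulmx det_ublock det_lblock !det1 !mul1r.
Qed.

End DetSylvester.

Section LeftMul.
Variables (R : realType) (n : nat).
Local Notation V := 'M[R]_(n, 4).
Implicit Types (u v w y z : V) (f g : V -> R).

(* [lm k u] is e_k u, with (e_0, e_1, e_2, e_3) = (1, I, J, K). *)
Definition lm (k : 'I_4) u : V := \matrix_(j < n, c < 4)
  nth 0 (nth [::]
    [:: [:: u j 0; u j 1; u j 2; u j 3];
        [:: - u j 1; u j 0; - u j 3; u j 2];
        [:: - u j 2; u j 3; u j 0; - u j 1];
        [:: - u j 3; - u j 2; u j 1; u j 0]] k) c.

Definition ip u v : R := \sum_j \sum_c u j c * v j c.

Definition co u (a : 'I_(n * 4)) : R := mxvec u 0 a.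

Lemma ordE4 (k : 'I_4) : [\/ k = 0, k = 1, k = 2 | k = 3].
Proof.
case: k => [[|[|[|[|//]]]] i]; [constructor 1|constructor 2|constructor 3|constructor 4];
  exact: val_inj.
Qed.

Lemma big4 (F : 'I_4 -> R) : \sum_k F k = F 0 + F 1 + F 2 + F 3.
Proof.
rewrite !big_ord_recr big_ord0 /= add0r.
by congr (F _ + F _ + F _ + F _); exact: val_inj.
Qed.

Lemma lmE k u j c : lm k u j c = nth 0 (nth [::]
    [:: [:: u j 0; u j 1; u j 2; u j 3];
        [:: - u j 1; u j 0; - u j 3; u j 2];
        [:: - u j 2; u j 3; u j 0; - u j 1];
        [:: - u j 3; - u j 2; u j 1; u j 0]] k) c.
Proof. by rewrite mxE. Qed.

Lemma lm_linear k : linear (lm k).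
Proof.
move=> a u v; apply/matrixP => j c; rewrite !mxE.
by case: (ordE4 k) => ->; case: (ordE4 c) => -> /=; rewrite ?mxE; ring.
Qed.

HB.instance Definition _ k := GRing.isLinear.Build R V V *:%R (lm k) (lm_linear k).

Lemma coD u v a : co (u + v) a = co u a + co v a.
Proof. by rewrite /co linearD mxE. Qed.

Lemma coZ x u a : co (x *: u) a = x * co u a.
Proof. by rewrite /co linearZ mxE. Qed.

Lemma co_mxvec_index u j k : co u (mxvec_index j k) = u j k.
Proof. by rewrite /co mxvecE. Qed.

Lemma sum_mxvec_index (F : 'I_(n * 4) -> R) :
  \sum_a F a = \sum_j \sum_k F (mxvec_index j k).
Proof.
rewrite pair_big (reindex (uncurry (@mxvec_index n 4)))/=; last first.
  exact: curry_mxvec_bij.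
by apply: eq_bigr => -[].
Qed.

Lemma ipE u v : ip u v = \sum_a co u a * co v a.
Proof.
rewrite sum_mxvec_index; apply: eq_bigr => j _; apply: eq_bigr => k _.
by rewrite !co_mxvec_index.
Qed.

Lemma hnorm2_ip u : hnorm2 u = ip u u.
Proof. by rewrite hnorm2E; do 2 apply: eq_bigr => ? _; rewrite expr2. Qed.

Lemma ipC u v : ip u v = ip v u.
Proof. by do 2 apply: eq_bigr => ? _; rewrite mulrC. Qed.

Lemma ipDl u v w : ip (u + v) w = ip u w + ip v w.
Proof.
by rewrite !ipE -big_split/=; apply: eq_bigr => a _; rewrite coD mulrDl.
Qed.

Lemma ipDr u v w : ip w (u + v) = ip w u + ip w v.
Proof. by rewrite ipC ipDl !(ipC w). Qed.

Lemma ipZl x u v : ip (x *: u) v = x * ip u v.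
Proof.
by rewrite !ipE mulr_sumr; apply: eq_bigr => a _; rewrite coZ mulrA.
Qed.

Lemma ipZr x u v : ip u (x *: v) = x * ip u v.
Proof. by rewrite ipC ipZl ipC. Qed.

(** Left multiplication by a unit is an isometry, and two distinct units differ by an imaginary
    unit, which is skew-symmetric. This orthogonality is what makes the metric explicitly
    invertible. *)
Lemma ip_lm k l u : ip (lm k u) (lm l u) = (k == l)%:R * ip u u.
Proof.
rewrite /ip mulr_sumr; apply: eq_bigr => j _.
rewrite !big4 !lmE.
by case: (ordE4 k) => ->; case: (ordE4 l) => -> /=; rewrite ?mxE; ring.
Qed.

Lemma lm0 u : lm 0 u = u.
Proof. by apply/matrixP => j c; rewrite mxE; case: (ordE4 c) => -> /=. Qed.

(** One unit squares to 1 and three square to -1. *)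
Lemma sum_lm_lm u : \sum_k lm k (lm k u) = - (2 *: u).
Proof.
apply/matrixP => j c; rewrite summxE big4 !mxE.
by case: (ordE4 c) => -> /=; rewrite ?mxE/=; ring.
Qed.

Lemma ip_lm_self k u : ip u (lm k u) = (k == 0)%:R * ip u u.
Proof. by rewrite -[in LHS](lm0 u) lm0 -{1}(lm0 u) ip_lm eq_sym. Qed.

(** The component of a quaternion q along e_k is the real part of q times the conjugate of e_k. The
    second term of the metric thus becomes a sum of four squares of linear forms. *)
Lemma qmul_qconj_ip u w k :
  (\sum_j qmul (row j u) (qconj (row j w))) 0 k = ip u (lm k w).
Proof.
rewrite summxE; apply: eq_bigr => j _; rewrite big4 /qmul /qconj /qmk !lmE.
by case: (ordE4 k) => ->; rewrite ?mxE/= ?mxE; ring.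
Qed.

Lemma co_coord_vec a b : co (coord_vec R a) b = (a == b)%:R.
Proof. by rewrite /co /coord_vec vec_mxK mxE eqxx eq_sym. Qed.

Lemma ip_coord_vec a u : ip (coord_vec R a) u = co u a.
Proof.
rewrite ipE (bigD1 a)//= co_coord_vec eqxx mul1r big1 ?addr0// => b ba.
by rewrite co_coord_vec eq_sym (negbTE ba) mul0r.
Qed.

Lemma vec_decomp u : u = \sum_a co u a *: coord_vec R a.
Proof.
rewrite -[LHS]mxvecK [mxvec u]row_sum_delta linear_sum/=.
by apply: eq_bigr => a _; rewrite linearZ.
Qed.

Lemma metricE w u v : metric w u v = (1 - hnorm2 w)^-1 * ip u v +
  (1 - hnorm2 w)^-1 ^+ 2 * \sum_k ip u (lm k w) * ip v (lm k w).
Proof.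
have QE x : metric_quad w x = (1 - hnorm2 w)^-1 * ip x x +
    (1 - hnorm2 w)^-1 ^+ 2 * \sum_k ip x (lm k w) ^+ 2.
  rewrite /metric_quad hnorm2_ip mulrC; congr (_ + _).
  rewrite mulrC exprVn; congr (_ * _).
  by apply: eq_bigr => k _; rewrite qmul_qconj_ip.
rewrite /metric !QE; set c := (1 - _)^-1.
rewrite !big4 !ipDl !ipDr (ipC v u).
by field.
Qed.

Definition lmmx w : 'M[R]_(n * 4, 4) := \matrix_(a, k) co (lm k w) a.

Lemma lmmx_gram w : (lmmx w)^T *m lmmx w = (hnorm2 w)%:M.
Proof.
apply/matrixP => k l; rewrite !mxE hnorm2_ip -[RHS]mulr_natl -ip_lm ipE.
by apply: eq_bigr => a _; rewrite !mxE.
Qed.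

Lemma gramE w : gram w = (1 - hnorm2 w)^-1 *:
  (1%:M + lmmx w *m ((1 - hnorm2 w)^-1 *: (lmmx w)^T)).
Proof.
apply/matrixP => a b; rewrite mxE metricE !mxE mulrDr; congr (_ * _ + _).
  by rewrite ip_coord_vec co_coord_vec eq_sym.
rewrite expr2 -mulrA; congr (_ * _); rewrite mulr_sumr; apply: eq_bigr => k _.
by rewrite !ip_coord_vec !mxE mulrCA.
Qed.

(** Sylvester's identity leaves a scalar 4 x 4 matrix with entry 1 + |w|^2 / (1 - |w|^2) = 1 / (1 -
    |w|^2), whence the four extra factors. *)
Lemma det_gram w : HHn w -> \det (gram w) = (1 - hnorm2 w)^-1 ^+ (n * 4 + 4).
Proof.
move=> /= w1; have q1 : 1 - hnorm2 w != 0 by rewrite gt_eqF// subr_gt0.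
rewrite gramE detZ exprD det_1mulmx_comm; congr (_ * _).
rewrite -scalemxAl lmmx_gram scale_scalar_mx -raddfD det_scalar; congr (_ ^+ _).
by field.
Qed.

Lemma sqrt_det_gram w : HHn w ->
  Num.sqrt (\det (gram w)) = (1 - hnorm2 w)^-1 ^+ (2 * n + 2).
Proof.
move=> w1; rewrite det_gram//.
have -> : (n * 4 + 4 = (2 * n + 2) * 2)%N by rewrite mulnDl mulnAC mulnC.
by rewrite exprM sqrtr_sqr ger0_norm// exprn_ge0// invr_ge0 subr_ge0 ltW.
Qed.

(** The inverse metric divided by 1 - |w|^2. It multiplies the span of the vectors e_k w by 1 -
    |w|^2 and is the identity on the orthogonal complement. *)
Definition proj w (a b : 'I_(n * 4)) : R :=
  (a == b)%:R - \sum_k co (lm k w) a * co (lm k w) b.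

(** With M the product of [lmmx w] and its transpose, M^2 = |w|^2 M; hence (1 + c M)(1 - M) = 1 for
    c = 1 / (1 - |w|^2). *)
Lemma invmx_gram w a b : HHn w -> invmx (gram w) a b = (1 - hnorm2 w) * proj w a b.
Proof.
move=> /= w1; have q1 : 1 - hnorm2 w != 0 by rewrite gt_eqF// subr_gt0.
pose Y : 'M[R]_(n * 4) := (1 - hnorm2 w) *: (1%:M - lmmx w *m (lmmx w)^T).
have GY : gram w *m Y = 1%:M.
  rewrite gramE -scalemxAl -scalemxAr scalerA mulVf// scale1r mulmxDl mul1mx.
  rewrite -scalemxAr mulmxBr mulmx1 -scalemxAl -!mulmxA.
  rewrite (mulmxA (lmmx w)^T) lmmx_gram mul_scalar_mx -scalemxAr -scalerBr.
  set M := lmmx w *m _; set q := hnorm2 w.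
  have -> : M - q *: M = (1 - q) *: M by rewrite scalerBl scale1r.
  by rewrite scalerA mulVf// scale1r subrK.
have [GU _] := mulmx1_unit GY.
have -> : invmx (gram w) = Y by rewrite -[RHS](mulKmx GU) GY mulmx1.
rewrite !mxE /proj; congr (_ * (_ - _)).
by apply: eq_bigr => k _; rewrite !mxE.
Qed.

End LeftMul.

(* Locked: the unifier and [ring] must not look inside derivatives. *)
HB.lock Definition pd (R : realType) (n : nat) (a : 'I_(n * 4))
  (f : 'M[R]_(n, 4) -> R) (w : 'M[R]_(n, 4)) : R := 'D_(coord_vec R a) f w.

Section Laplacian.
Variables (R : realType) (n : nat).
Local Notation V := 'M[R]_(n, 4).
Implicit Types (u v w y z : V) (f g : V -> R).
Local Notation e_ := (coord_vec R).

Lemma derive_nice_linear g v y : nice g -> linear (g : V -> R^o) -> 'D_v g y = g v.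
Proof.
move=> ng lg.
pose gM := GRing.isLinear.Build R V R^o *:%R (g : V -> R^o) lg.
pose gL : {linear V -> R^o} := HB.pack (g : V -> R^o) gM.
rewrite deriveE; last exact: nice_differentiable.
rewrite (_ : g = gL)// diff_lin//.
exact: nice_continuous.
Qed.

Lemma nice_co a : nice (fun y => co y a).
Proof.
case/mxvec_indexP: a => j k.
by apply: nice_eq (nice_coord j k) _ => y; rewrite co_mxvec_index.
Qed.

Lemma nice_lm k j c : nice (fun y : V => lm k y j c).
Proof.
have C := @nice_coord R n : forall i k, nice (fun y : V => y i k); have O := fun i k => nice_opp (C i k).
under eq_fun do rewrite lmE.
by case: (ordE4 k) => ->; case: (ordE4 c) => -> /=; (apply: C || apply: O).
Qed.

Lemma nice_co_lm k a : nice (fun y => co (lm k y) a).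
Proof.
case/mxvec_indexP: a => j c.
by apply: nice_eq (nice_lm k j c) _ => y; rewrite co_mxvec_index.
Qed.

Lemma derive_co_lm k a v y : 'D_v (fun z => co (lm k z) a) y = co (lm k v) a.
Proof.
apply: (derive_nice_linear v y (nice_co_lm k a)) => x N M.
by rewrite linearP coD coZ.
Qed.

Lemma derive_ip u v y : nice (ip u) /\ 'D_v (ip u) y = ip u v.
Proof.
have nip : nice (ip u).
  do 2 apply: nice_sum => ?; apply: nice_mul; first exact: nice_cst.
  exact: nice_coord.
split=> //.
by apply: derive_nice_linear => // x N M; rewrite ipDr ipZr.
Qed.

Lemma derive_hnorm2 v y : 'D_v (@hnorm2 R n) y = 2 * ip y v.
Proof.
have -> : @hnorm2 R n = \sum_(a < n * 4) ((fun z => co (lm 0 z) a) * (fun z => co (lm 0 z) a)).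
  apply/funext => z; rewrite hnorm2_ip ipE fct_sumE; apply: eq_bigr => a _.
  by rewrite fctE lm0.
have dc a := @nice_derivable _ _ _ v y (nice_co_lm 0 a).
rewrite derive_sum => [|a]; last exact: derivableM.
rewrite ipE mulr_sumr; apply: eq_bigr => a _.
by rewrite deriveM// derive_co_lm !lm0 /GRing.scale/=; ring.
Qed.

Lemma derive_near f g v y : (\forall z \near y, f z = g z) -> 'D_v f y = 'D_v g y.
Proof. exact: near_eq_derive. Qed.

Lemma pdE a f w : pd a f w = 'D_(e_ a) f w. Proof. by rewrite unlock. Qed.

Lemma nice_pd a f : nice f -> nice (pd a f).
Proof. by move=> /(nice_D (e_ a)) h; apply: nice_eq h _ => w; rewrite pdE. Qed.

Lemma pd_near a f g w : (\forall z \near w, f z = g z) -> pd a f w = pd a g w.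
Proof. by move=> fg; rewrite !pdE; exact: derive_near. Qed.

Lemma near_pd a f g w : (\forall z \near w, f z = g z) ->
  \forall z \near w, pd a f z = pd a g z.
Proof. by move=> /nbhs_interior; apply: filterS => z fg; exact: pd_near. Qed.

(** The Laplace-Beltrami operator without determinant, square root or inverse matrix; in this form
    it maps nice functions to nice functions on the whole space. *)
Definition lap f w : R := (1 - hnorm2 w) *
  (\sum_a \sum_b proj w a b * pd a (pd b f) w + 4 * \sum_b co w b * pd b f w).

Lemma nice_proj a b : nice (fun w => proj w a b).
Proof.
apply: nice_sub; first exact: nice_cst.
by apply: nice_sum => k; apply: nice_mul; exact: nice_co_lm.
Qed.

Lemma nice_lap f : nice f -> nice (lap f).
Proof.
move=> nf; apply: nice_mul; first exact: nice_sub (nice_cst _) (nice_hnorm2).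
apply: nice_add.
  by do 2 apply: nice_sum => ?; apply: nice_mul (nice_proj _ _) _; do 2 apply: nice_pd.
apply: nice_mul; first exact: nice_cst.
by apply: nice_sum => b; apply: nice_mul (nice_co b) _; exact: nice_pd.
Qed.

(** Locality is what allows cutoffs to be dropped at points with |w|^2 < a. *)
Lemma lap_near f g w : (\forall z \near w, f z = g z) -> lap f w = lap g w.
Proof.
move=> fg; rewrite /lap; congr (_ * (_ + _ * _)).
  by apply: eq_bigr => a _; apply: eq_bigr => b _; rewrite (pd_near a (near_pd b fg)).
by apply: eq_bigr => b _; rewrite (pd_near b fg).
Qed.

(** The vector w = e_0 w lies in the span that [proj w] multiplies by 1 - |w|^2. *)
Lemma sum_co_proj w b : \sum_a co w a * proj w a b = (1 - hnorm2 w) * co w b.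
Proof.
under eq_bigr do rewrite /proj mulrBr.
rewrite sumrB (bigD1 b)//= eqxx mulr1 big1 ?addr0; last first.
  by move=> a ab; rewrite (negbTE ab) mulr0.
rewrite mulrBl mul1r; congr (_ - _).
under eq_bigr do rewrite mulr_sumr.
rewrite exchange_big/=.
transitivity (\sum_k ip w (lm k w) * co (lm k w) b).
  apply: eq_bigr => k _; rewrite ipE mulr_suml.
  by apply: eq_bigr => a _; rewrite mulrA.
rewrite (bigD1 0)//= big1 ?addr0.
  by rewrite ip_lm_self eqxx mul1r hnorm2_ip lm0.
by move=> k k0; rewrite ip_lm_self (negbTE k0) !mul0r.
Qed.

(** The divergence of [proj]. The trace of left multiplication by e_k is 4n for k = 0 and 0
    otherwise, and the remaining terms add up to the sum of the e_k e_k w, which is -2 w. *)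
Lemma sum_derive_proj w b :
  \sum_a pd a (fun z => proj z a b) w = - (n * 4)%:R * co w b + 2 * co w b.
Proof.
have dc k a v := @nice_derivable _ _ _ v w (nice_co_lm k a).
have D a : pd a (fun z => proj z a b) w =
    - \sum_k (co (lm k (e_ a)) a * co (lm k w) b
              + co (lm k w) a * co (lm k (e_ a)) b).
  have -> : (fun z => proj z a b) = cst (a == b)%:R -
     \sum_(k < 4) ((fun z => co (lm k z) a) * (fun z => co (lm k z) b)).
    by apply/funext => z; rewrite !fctE fct_sumE.
  rewrite pdE.
  rewrite deriveB; [|exact: derivable_cst|by apply: derivable_sum => k; exact: derivableM].
  rewrite derive_cst sub0r derive_sum; last by move=> k; exact: derivableM.
  congr (- _); apply: eq_bigr => k _.
  by rewrite deriveM// !derive_co_lm /GRing.scale/=; ring.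
under eq_bigr do rewrite D.
rewrite sumrN exchange_big/=.
have -> : \sum_k \sum_a (co (lm k (e_ a)) a * co (lm k w) b
              + co (lm k w) a * co (lm k (e_ a)) b) =
   \sum_(k < 4) ((k == 0)%:R * (n * 4)%:R * co w b) + \sum_k co (lm k (lm k w)) b.
  rewrite -big_split/=; apply: eq_bigr => k _; rewrite big_split/=; congr (_ + _).
    rewrite -mulr_suml.
    have -> : \sum_(a < n * 4) co (lm k (e_ a)) a = (k == 0)%:R * (n * 4)%:R.
      rewrite (eq_bigr (fun=> (k == 0)%:R)) => [|a _]; last first.
        by rewrite -ip_coord_vec ip_lm_self ip_coord_vec co_coord_vec eqxx mulr1.
      by rewrite sumr_const card_ord -[LHS]mulr_natr.
    have [->|k0] := eqVneq k 0; first by rewrite lm0.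
    by rewrite !mul0r.
  rewrite [in RHS](vec_decomp (lm k w)) linear_sum/= /co linear_sum summxE.
  by apply: eq_bigr => a _; rewrite linearZ/= linearZ/= mxE.
have -> : \sum_k co (lm k (lm k w)) b = - (2 * co w b).
  by rewrite /co -summxE -linear_sum sum_lm_lm linearN linearZ !mxE.
rewrite (bigD1 0)//= big1 => [|k /negbTE ->]; last by rewrite !mul0r.
by rewrite mul1r addr0 opprD opprK mulNr.
Qed.

Lemma near_hnorm2_lt w (r : R) : hnorm2 w < r -> \forall z \near w, hnorm2 z < r.
Proof.
move=> wr; have C : hnorm2 z @[z --> w] --> hnorm2 w by exact: nice_continuous (nice_hnorm2) w.
exact: cvgr_lt C _ wr.
Qed.

Lemma laplace_beltramiE f w : nice f -> HHn w -> laplace_beltrami f w = lap f w.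
Proof.
move=> nf; rewrite /HHn/= => w1.
(* Two levels with |w|^2 < r < s < 1, so that near w the nice function [c] is the factor 1 / (1 -
   |z|^2). *)
pose r := (1 + 2 * hnorm2 w) / 3; pose s := (2 + hnorm2 w) / 3.
have wr : hnorm2 w < r by rewrite /r; lra.
have rs : r < s by rewrite /r /s; lra.
have s1 : s < 1 by rewrite /s; lra.
pose c := conf (n := n) r s.
have nc : nice c by exact: nice_conf.
have cE : \forall z \near w, c z = (1 - hnorm2 z)^-1.
  by apply: filterS (near_hnorm2_lt wr) => z /ltW; exact: confE.
have q0 : 1 - hnorm2 w != 0 by rewrite gt_eqF// subr_gt0.
have cw : c w = (1 - hnorm2 w)^-1 by exact: nbhs_singleton cE.
have dq v : is_derive w v (@hnorm2 R n) (2 * ip w v).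
  by rewrite -derive_hnorm2; apply: derivableP; exact: nice_derivable (nice_hnorm2).
have dc v : 'D_v c w = c w ^+ 2 * (2 * ip w v).
  rewrite (derive_near v cE).
  have d1 : is_derive w v (fun z : V => 1 - hnorm2 z) (0 - 2 * ip w v).
    exact: is_deriveB.
  rewrite (@deriveV _ _ (fun z : V => 1 - hnorm2 z))// derive_val cw /GRing.scale/= exprVn; ring.
rewrite /laplace_beltrami sqrt_det_gram// /lap.
(* The exponent 2n + 1 is the exponent 2n + 2 of the volume density lowered by the factor 1 - |z|^2
   of the inverse metric. *)
have D a b : 'D_(e_ a) (fun z => Num.sqrt (\det (gram z)) * invmx (gram z) a b *
              'D_(e_ b) f z) w =
   (1 - hnorm2 w)^-1 ^+ (2 * n + 1) *
   ((2 * n + 1)%:R * 2 * (1 - hnorm2 w)^-1 * (co w a * proj w a b) * pd b f w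
    + pd a (fun z => proj z a b) w * pd b f w
    + proj w a b * pd a (pd b f) w).
  transitivity ('D_(e_ a) ((c ^+ (2 * n + 1)) *
     ((fun z => proj z a b) * pd b f)) w).
    apply: derive_near; near=> z.
    have z1 : hnorm2 z < 1 by near: z; exact: near_hnorm2_lt.
    have qz : 1 - hnorm2 z != 0 by rewrite gt_eqF// subr_gt0.
    rewrite sqrt_det_gram// invmx_gram// !fctE -pdE.
    have -> : c z = (1 - hnorm2 z)^-1 by near: z.
    rewrite mulrA; congr (_ * _); rewrite mulrA; congr (_ * _).
    rewrite (_ : 2 * n + 2 = (2 * n + 1).+1)%N ?addnS// exprSr -mulrA mulVf ?mulr1//.
  have h1 v : derivable c w v by exact: nice_derivable.
  have h2 v : derivable (fun z => proj z a b) w v by apply: nice_derivable; exact: nice_proj.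
  have h3 v : derivable (pd b f) w v by apply: nice_derivable; exact: nice_pd.
  rewrite deriveM; [|exact: derivableX|exact: derivableM].
  rewrite deriveM// deriveX// dc (ipC w) ip_coord_vec !fctE cw /GRing.scale/= -!pdE addn1 exprS /=.
  by rewrite -mulr_natl; ring.
under eq_bigr => a _ do under eq_bigr => b _ do rewrite D.
under eq_bigr do rewrite -mulr_sumr.
rewrite -mulr_sumr mulrA exprVn invrK.
have -> : (1 - hnorm2 w) ^+ (2 * n + 2) * (1 - hnorm2 w)^-1 ^+ (2 * n + 1) = 1 - hnorm2 w.
  by rewrite (_ : 2 * n + 2 = (2 * n + 1).+1)%N ?addnS// exprS exprVn mulfK// expf_neq0.
congr (_ * _).
under eq_bigr do rewrite !big_split/=.
rewrite !big_split/= [RHS]addrC; congr (_ + _).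
rewrite exchange_big/= [X in _ + X]exchange_big/= -big_split/= mulr_sumr.
apply: eq_bigr => b _.
(* The first-order coefficient is 2 (2n + 1) - 4n + 2 = 4. *)
rewrite -!mulr_suml -mulr_sumr sum_co_proj sum_derive_proj natrM natrD natrM.
by field.
Unshelve. all: by end_near. Qed.

End Laplacian.

(** * The area increment and the generator *)

Section Generator.
Variables (R : realType) (n : nat).
Local Notation V := 'M[R]_(n, 4).
Implicit Types (u v w y z : V) (f g : V -> R) (l : R * R * R).
Local Notation e_ := (coord_vec R).

(** The carre du champ of [lap], that is, the Riemannian inner product of the gradients. *)
Definition gam f g w : R := (1 - hnorm2 w) *
  \sum_a \sum_b proj w a b * (pd a f w * pd b g w).

Lemma projC w a b : proj w a b = proj w b a.
Proof.
by rewrite /proj eq_sym; congr (_ - _); apply: eq_bigr => k _; rewrite mulrC.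
Qed.

Lemma sum_proj w u v : \sum_a \sum_b proj w a b * (co u a * co v b) =
  ip u v - \sum_k ip u (lm k w) * ip v (lm k w).
Proof.
have E a b : proj w a b * (co u a * co v b) = (a == b)%:R * (co u a * co v b) -
    \sum_k (co u a * co (lm k w) a) * (co v b * co (lm k w) b).
  rewrite /proj mulrBl; congr (_ - _); rewrite mulr_suml.
  by apply: eq_bigr => k _; ring.
under eq_bigr => a _ do (under eq_bigr => b _ do rewrite E); under eq_bigr do rewrite sumrB.
rewrite sumrB; congr (_ - _).
  rewrite ipE; apply: eq_bigr => a _; rewrite (bigD1 a)//= eqxx mul1r big1 ?addr0// => b ba.
  by rewrite eq_sym (negbTE ba) mul0r.
under eq_bigr do rewrite exchange_big.
rewrite exchange_big/=; apply: eq_bigr => k _.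
rewrite !ipE mulr_suml; apply: eq_bigr => a _.
by rewrite mulr_sumr.
Qed.

Lemma pd_mul a f g y : nice f -> nice g ->
  pd a (fun z => f z * g z) y = f y * pd a g y + g y * pd a f y.
Proof. by move=> nf ng; rewrite !pdE (@deriveM _ _ f g)//; exact: nice_derivable. Qed.

Lemma pd_add a f g y : nice f -> nice g ->
  pd a (fun z => f z + g z) y = pd a f y + pd a g y.
Proof. by move=> nf ng; rewrite !pdE (@deriveD _ _ _ f g)//; exact: nice_derivable. Qed.

Lemma pd_cst a c y : pd a (fun _ : V => c) y = 0.
Proof. by rewrite pdE derive_cst. Qed.

Lemma pd_scale a c f y : nice f -> pd a (fun z => c * f z) y = c * pd a f y.
Proof.
by move=> nf; rewrite pd_mul//; [rewrite pd_cst mulr0 addr0|exact: nice_cst].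
Qed.

Lemma pd_co_lm k a b y : pd a (fun z => co (lm k z) b) y = co (lm k (e_ a)) b.
Proof. by rewrite pdE derive_co_lm. Qed.

Lemma pd_hnorm2 a y : pd a (@hnorm2 R n) y = 2 * co y a.
Proof. by rewrite pdE derive_hnorm2 ipC ip_coord_vec. Qed.

Lemma lap_mul f g w : nice f -> nice g ->
  lap (fun z => f z * g z) w = f w * lap g w + g w * lap f w + 2 * gam f g w.
Proof.
move=> nf ng.
have DD a b : pd a (pd b (fun y => f y * g y)) w =
   f w * pd a (pd b g) w + g w * pd a (pd b f) w + pd a f w * pd b g w + pd b f w * pd a g w.
  have -> : pd b (fun y => f y * g y) = (fun y => f y * pd b g y + g y * pd b f y).
    by apply/funext => y; rewrite pd_mul.
  have nfb := nice_pd b nf; have ngb := nice_pd b ng.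
  rewrite pd_add; [|exact: nice_mul..].
  by rewrite !pd_mul//; ring.
have sw : \sum_a \sum_b proj w a b * (pd b f w * pd a g w) =
          \sum_a \sum_b proj w a b * (pd a f w * pd b g w).
  rewrite exchange_big/=; apply: eq_bigr => b _; apply: eq_bigr => a _.
  by rewrite projC.
rewrite /lap /gam.
have -> : \sum_a \sum_b proj w a b * pd a (pd b (fun y => f y * g y)) w =
  f w * (\sum_a \sum_b proj w a b * pd a (pd b g) w) +
  g w * (\sum_a \sum_b proj w a b * pd a (pd b f) w) +
  2 * \sum_a \sum_b proj w a b * (pd a f w * pd b g w).
  rewrite -[2]/(1 + 1) mulrDl !mul1r -{2}sw !mulr_sumr addrA -!big_split/=.
  apply: eq_bigr => a _; rewrite !mulr_sumr -!big_split/=.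
  by apply: eq_bigr => b _; rewrite DD; ring.
have -> : \sum_b co w b * pd b (fun z => f z * g z) w =
   f w * (\sum_b co w b * pd b g w) + g w * (\sum_b co w b * pd b f w).
  rewrite !mulr_sumr -big_split/=; apply: eq_bigr => b _.
  by rewrite pd_mul//; ring.
by ring.
Qed.

(** The trace of [proj w] is 4n - 4 |w|^2; the second-order part 8n - 8 |w|^2 and the first-order
    part 8 |w|^2 add up to the constant 8n. *)
Lemma lap_hnorm2 w : lap (@hnorm2 R n) w = 8 * n%:R * (1 - hnorm2 w).
Proof.
rewrite /lap.
have -> : \sum_a \sum_b proj w a b * pd a (pd b (@hnorm2 R n)) w =
   2 * (4 * n%:R - 4 * hnorm2 w).
  have D2 a b : pd a (pd b (@hnorm2 R n)) w = 2 * (a == b)%:R.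
    have -> : pd b (@hnorm2 R n) = (fun z => 2 * co (lm 0 z) b).
      by apply/funext => z; rewrite pd_hnorm2 lm0.
    by rewrite pd_scale ?pd_co_lm ?lm0 ?co_coord_vec//; exact: nice_co_lm.
  have D3 a : \sum_b proj w a b * pd a (pd b (@hnorm2 R n)) w =
     2 * (1 - \sum_k co (lm k w) a * co (lm k w) a).
    rewrite (bigD1 a)//= big1 ?addr0 => [|b ba]; last first.
      by rewrite D2 eq_sym (negbTE ba) !mulr0.
    by rewrite D2 eqxx mulr1 mulrC /proj eqxx.
  under eq_bigr do rewrite D3.
  rewrite -mulr_sumr sumrB sumr_const card_ord natrM; congr (_ * (_ - _)).
    by rewrite mulrC.
  rewrite exchange_big/= (eq_bigr (fun=> hnorm2 w)).
    by rewrite sumr_const card_ord -[LHS]mulr_natl.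
  by move=> k _; rewrite -ipE ip_lm eqxx mul1r hnorm2_ip.
have -> : \sum_b co w b * pd b (@hnorm2 R n) w = 2 * hnorm2 w.
  rewrite hnorm2_ip ipE mulr_sumr; apply: eq_bigr => b _.
  by rewrite pd_hnorm2 mulrCA.
ring.
Qed.

Definition nsq l : R := l.1.1 ^+ 2 + l.1.2 ^+ 2 + l.2 ^+ 2.

(* Left multiplication by the imaginary quaternion [l]. *)
Definition imul l z : V := l.1.1 *: lm 1 z + l.1.2 *: lm 2 z + l.2 *: lm 3 z.

Lemma ip_imul l z k : ip (imul l z) (lm k z) = hnorm2 z *
  ((k == 1)%:R * l.1.1 + (k == 2)%:R * l.1.2 + (k == 3)%:R * l.2).
Proof.
rewrite /imul !ipDl !ipZl !ip_lm -hnorm2_ip !(eq_sym _ k); ring.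
Qed.

Lemma ip_self_imul l z : ip z (imul l z) = 0.
Proof. by rewrite ipC -[X in ip _ X]lm0 ip_imul /=; ring. Qed.

Lemma ip_imul_imul l z : ip (imul l z) (imul l z) = nsq l * hnorm2 z.
Proof.
by rewrite {2}/imul !ipDr !ipZr !ip_imul /nsq /=; ring.
Qed.

(** The vector l z is a combination of the e_k z, so [proj z] multiplies it by 1 - |z|^2. *)
Lemma sum_proj_imul l z :
  \sum_a \sum_b proj z a b * (co (imul l z) a * co (imul l z) b) =
  nsq l * hnorm2 z * (1 - hnorm2 z).
Proof.
by rewrite sum_proj ip_imul_imul big4 !ip_imul /nsq /=; ring.
Qed.

Section Psi.
Variables (a b : R) (l : R * R * R).
Hypotheses (ab : a < b) (b1 : b < 1).

(* The increment of [l . a] over one step from [z] to [y] in a trapezoidal sum,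
   with a smooth globally defined factor in place of 1 / (1 - |y|^2). *)
Definition psi z y : R := 2^-1 * ((conf a b z + conf a b y) * ip y (imul l z)).

Let nc := @nice_conf R n a b ab b1.

Lemma nice_ip u : nice (ip u). Proof. by case: (derive_ip u 0 0). Qed.

Lemma nice_ipr u : nice (fun y => ip y u).
Proof. by apply: nice_eq (nice_ip u) _ => y; rewrite ipC. Qed.

Lemma pd_ipr u c y : pd c (fun y => ip y u) y = co u c.
Proof.
have -> : (fun y => ip y u) = ip u by apply/funext => z; rewrite ipC.
by rewrite pdE; case: (derive_ip u (e_ c) y) => _ ->; rewrite ipC ip_coord_vec.
Qed.

Lemma nice_psi z : nice (psi z).
Proof.
apply: nice_mul (nice_cst _) _; apply: nice_mul; last exact: nice_ipr.
exact: nice_add (nice_cst _) nc.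
Qed.

Lemma psi_diag z : psi z z = 0.
Proof. by rewrite /psi ip_self_imul !mulr0. Qed.

Lemma pd_psi c z y : pd c (psi z) y =
  2^-1 * ((conf a b z + conf a b y) * co (imul l z) c + ip y (imul l z) * pd c (conf a b) y).
Proof.
have n1 : nice (fun y => conf a b z + conf a b y) by exact: nice_add (nice_cst _) nc.
have n2 := nice_ipr (imul l z).
rewrite pd_scale; last exact: nice_mul.
by rewrite pd_mul// pd_ipr pd_add ?pd_cst ?add0r//; exact: nice_cst.
Qed.

Lemma pd_psi_diag c z : pd c (psi z) z = conf a b z * co (imul l z) c.
Proof. by rewrite pd_psi ip_self_imul; field. Qed.

Lemma pd2_psi_diag c e z : pd c (pd e (psi z)) z =
  2^-1 * (co (imul l z) e * pd c (conf a b) z + co (imul l z) c * pd e (conf a b) z).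
Proof.
have -> : pd e (psi z) = (fun y => 2^-1 * ((conf a b z + conf a b y) * co (imul l z) e
    + ip y (imul l z) * pd e (conf a b) y)).
  by apply/funext => y; rewrite pd_psi.
have n1 : nice (fun y => conf a b z + conf a b y) by exact: nice_add (nice_cst _) nc.
have n2 := nice_ipr (imul l z).
have n3 : nice (pd e (conf a b)) by exact: nice_pd.
have n4 : nice (fun y => (conf a b z + conf a b y) * co (imul l z) e).
  by apply: nice_mul => //; exact: nice_cst.
have n5 : nice (fun y => ip y (imul l z) * pd e (conf a b) y) by exact: nice_mul.
rewrite pd_scale; last exact: nice_add.
rewrite pd_add// !pd_mul//; last exact: nice_cst.
rewrite pd_cst pd_add//; last exact: nice_cst.
by rewrite pd_cst ip_self_imul pd_ipr; ring.
Qed.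

Lemma pd_conf c z : hnorm2 z < a -> pd c (conf a b) z = conf a b z ^+ 2 * (2 * co z c).
Proof.
move=> za; have z0 : 1 - hnorm2 z != 0.
  by rewrite gt_eqF// subr_gt0 (lt_trans za)// (lt_trans ab).
have nd : nice (fun y : V => 1 - hnorm2 y) by exact: nice_sub (nice_cst _) nice_hnorm2.
(* The derivative of [conf] is found by differentiating this product, which is constantly 1 near
   z. *)
have E : pd c (fun y => conf a b y * (1 - hnorm2 y)) z = 0.
  rewrite (@pd_near _ _ _ _ (fun=> 1)) ?pd_cst//.
  apply: filterS (near_hnorm2_lt za) => y ya.
  rewrite (confE ab (ltW ya)) mulVf// gt_eqF// subr_gt0 (lt_trans ya)//.
  exact: lt_trans ab b1.
move: E; rewrite pd_mul// pd_add; [|exact: nice_cst|exact: nice_opp nice_hnorm2].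
rewrite pd_cst add0r.
have -> : pd c (fun y : V => - hnorm2 y) z = - (2 * co z c).
  have -> : (fun y : V => - hnorm2 y) = (fun y => (-1) * hnorm2 y).
    by apply/funext => y; rewrite mulN1r.
  by rewrite pd_scale ?pd_hnorm2 ?mulN1r//; exact: nice_hnorm2.
rewrite (confE ab (ltW za)) => E.
apply: (mulfI z0); apply/eqP; rewrite -subr_eq0; apply/eqP.
rewrite -[RHS]E; by field.
Qed.

(** Every term pairs z with l z, possibly through [proj z]. As z is an eigenvector of [proj z] and
    is orthogonal to l z, all of them vanish: the area has no drift. *)
Lemma lap_psi z : hnorm2 z < a -> lap (psi z) z = 0.
Proof.
move=> za; rewrite /lap.
have -> : \sum_c co z c * pd c (psi z) z = 0.
  under eq_bigr do rewrite pd_psi_diag mulrCA.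
  by rewrite -mulr_sumr -ipE ip_self_imul mulr0.
have E (u v : V) : \sum_c \sum_d proj z c d * (co u c * co v d) =
    \sum_c \sum_d proj z c d * (co u d * co v c).
  rewrite exchange_big/=; apply: eq_bigr => d _; apply: eq_bigr => c _.
  by rewrite projC.
have S0 : \sum_c \sum_d proj z c d * (co z c * co (imul l z) d) = 0.
  rewrite exchange_big/=.
  have S1 d : \sum_c proj z c d * (co z c * co (imul l z) d) =
      (1 - hnorm2 z) * (co z d * co (imul l z) d).
    rewrite mulrA -sum_co_proj mulr_suml; apply: eq_bigr => c _.
    by rewrite mulrA (mulrC (proj _ _ _)).
  under eq_bigr do rewrite S1.
  by rewrite -mulr_sumr -ipE ip_self_imul mulr0.
have -> : \sum_c \sum_d proj z c d * pd c (pd d (psi z)) z =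
   conf a b z ^+ 2 * (\sum_c \sum_d proj z c d * (co z c * co (imul l z) d) +
   \sum_c \sum_d proj z c d * (co z d * co (imul l z) c)).
  rewrite -big_split mulr_sumr/=; apply: eq_bigr => c _.
  rewrite -big_split mulr_sumr/=; apply: eq_bigr => d _.
  by rewrite pd2_psi_diag !pd_conf//; field.
by rewrite -E S0 addr0 !mulr0 addr0 mulr0.
Qed.

(** The gradient of [psi z] at z is l z / (1 - |z|^2). The two factors 1 - |z|^2, from the inverse
    metric and from [sum_proj_imul], cancel the denominator exactly. *)
Lemma gam_psi z : hnorm2 z < a -> gam (psi z) (psi z) z = nsq l * hnorm2 z.
Proof.
move=> za; have z0 : 1 - hnorm2 z != 0.
  by rewrite gt_eqF// subr_gt0 (lt_trans za)// (lt_trans ab).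
rewrite /gam.
have -> : \sum_c \sum_d proj z c d * (pd c (psi z) z * pd d (psi z) z)
  = conf a b z ^+ 2 * (nsq l * hnorm2 z * (1 - hnorm2 z)).
  rewrite -sum_proj_imul mulr_sumr; apply: eq_bigr => c _.
  rewrite mulr_sumr; apply: eq_bigr => d _.
  by rewrite !pd_psi_diag; ring.
rewrite (confE ab (ltW za)); by field.
Qed.

(** As [psi z] vanishes at z, a second-order operator sees nothing of its powers above the square,
    and for the square only the carre du champ remains. *)
Lemma lap_psi_exp m z : hnorm2 z < a -> (0 < m)%N ->
  lap (fun y => psi z y ^+ m) z = (m == 2)%:R * (2 * (nsq l * hnorm2 z)).
Proof.
move=> za; case: m => [//|[|m]] _.
  by under eq_fun do rewrite expr1; rewrite lap_psi// mul0r.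
have nX k : nice (fun y => psi z y ^+ k) by apply: nice_exp; exact: nice_psi.
under eq_fun do rewrite exprS.
rewrite lap_mul//; last exact: nice_psi.
rewrite psi_diag lap_psi// mul0r mulr0 !add0r.
case: m => [|m].
  by under eq_fun do rewrite expr1; rewrite gam_psi// mul1r.
rewrite /= mul0r /gam big1 ?mulr0 ?mulr0// => c _; apply: big1 => d _.
have -> : pd d (fun y => psi z y ^+ m.+2) z = 0; last by rewrite !mulr0.
under eq_fun do rewrite exprS.
rewrite pd_mul//; last exact: nice_psi.
by rewrite psi_diag exprS !mul0r addr0.
Qed.

Lemma lap_psi_exp_cutoff m z : hnorm2 z < a -> (0 < m)%N ->
  lap (fun y => (psi z y * cutoff a b y) ^+ m) z = (m == 2)%:R * (2 * (nsq l * hnorm2 z)).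
Proof.
move=> za m0; rewrite -lap_psi_exp//; apply: lap_near.
by apply: filterS (near_hnorm2_lt za) => y /ltW ya; rewrite cutoff1// mulr1.
Qed.

Lemma lap_hnorm2_cutoff z : hnorm2 z < a ->
  lap (fun y => hnorm2 y * cutoff a b y) z = 8 * n%:R * (1 - hnorm2 z).
Proof.
move=> za; rewrite -lap_hnorm2; apply: lap_near.
by apply: filterS (near_hnorm2_lt za) => y /ltW ya; rewrite cutoff1// mulr1.
Qed.

End Psi.
End Generator.

(** Heine-Cantor on a compact subset, where the function is only assumed continuous relative to that
    subset. *)
Lemma compact_unif_continuous (R : realType) (U V : pseudoMetricType R)
    (K : set U) (f : U -> V) : compact K -> {within K, continuous f} ->
  forall e : R, 0 < e -> exists2 del : R, 0 < del &
    forall x y, K x -> K y -> ball x del y -> ball (f x) e (f y).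
Proof.
move=> /compact_near_coveringP cK cf e e0.
pose Q (del : R) x := K x -> forall y, K y -> ball x del y -> ball (f x) e (f y).
have [del /= del0 H] : \forall del \near (0 : R)^'+, K `<=` Q del.
  apply: cK => x Kx.
  have : \forall y \near within K (nbhs x), ball (f x) (e / 2) (f y).
    rewrite (nbhs_subspace_in Kx); apply: cf; apply: nbhsx_ballx.
    by rewrite divr_gt0.
  rewrite near_withinE => /nbhs_ballP[r /= r0 xr].
  (* Half the radius, so that a point of this neighbourhood and any point at distance less than
     [del] from it both lie within [r] of [x]. *)
  exists (ball x (r / 2), [set del | 0 < del < r / 2]).
    split; first by apply: nbhsx_ballx; rewrite divr_gt0.
    near=> del => /=; apply/andP; split; near: del; first exact: nbhs_right_gt.
    by apply: nbhs_right_lt; rewrite divr_gt0.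
  move=> [x' del] /= [xx' /andP[del0 delr]] Kx' y Ky x'y.
  have h1 : ball (f x) (e / 2) (f x').
    apply: xr => //; apply: le_ball xx'.
    by rewrite ler_pdivrMr// ler_pMr// ler1n.
  have h2 : ball (f x) (e / 2) (f y).
    apply: xr => //; rewrite (splitr r); apply: ball_triangle xx' _.
    exact: le_ball (ltW delr) _ x'y.
  rewrite (splitr e); exact: ball_triangle (ball_sym h1) h2.
exists (del / 2); first by rewrite /= divr_gt0.
move=> x y Kx Ky xy; apply: (H (del / 2)) => //=.
  by rewrite sub0r normrN ger0_norm ?divr_ge0 ?ltW// gtr_pMr// invf_lt1 ?ltr1n.
by rewrite divr_gt0.
Unshelve. all: by end_near. Qed.

(** * Bounded random variables and martingales *)

Section BoundedRV.
Variables (R : realType) (d : measure_display) (T : measurableType d).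
Variable P : probability T R.
Implicit Types (X Y : T -> R).

(** Bounded random variables form an algebra of integrable functions, so integrability conditions
    reduce to closure lemmas. *)
Definition brv X := measurable_fun setT X /\ exists M, forall x, `|X x| <= M.

Definition Ex X : R := Rintegral P setT X.

Lemma brv_cst c : brv (fun=> c).
Proof. by split; [exact: measurable_cst|exists `|c|]. Qed.

Lemma brvD X Y : brv X -> brv Y -> brv (fun x => X x + Y x).
Proof.
move=> [mX [M XM]] [mY [N YN]]; split; first exact: measurable_funD.
by exists (M + N) => x; rewrite (le_trans (ler_normD _ _))// lerD.
Qed.

Lemma brvM X Y : brv X -> brv Y -> brv (fun x => X x * Y x).
Proof.
move=> [mX [M XM]] [mY [N YN]]; split; first exact: measurable_funM.
by exists (M * N) => x; rewrite normrM ler_pM.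
Qed.

Lemma brvZ c X : brv X -> brv (fun x => c * X x).
Proof. exact: brvM (brv_cst c). Qed.

Lemma brvN X : brv X -> brv (fun x => - X x).
Proof. by move=> /(brvZ (-1)); under eq_fun do rewrite mulN1r. Qed.

Lemma brvB X Y : brv X -> brv Y -> brv (fun x => X x - Y x).
Proof. by move=> bX /brvN; exact: brvD. Qed.

Lemma brvX n X : brv X -> brv (fun x => X x ^+ n).
Proof.
move=> bX; elim: n => [|n ih]; first exact: brv_cst.
by under eq_fun do rewrite exprS; exact: brvM.
Qed.

Lemma brv_norm X : brv X -> brv (fun x => `|X x|).
Proof.
move=> [mX [M XM]]; split; first exact: measurableT_comp.
by exists M => x; rewrite normr_id.
Qed.

Lemma brv_sum (I : Type) (r : seq I) (F : I -> T -> R) :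
  (forall i, brv (F i)) -> brv (fun x => \sum_(i <- r) F i x).
Proof.
move=> bF; elim: r => [|i r ih].
  by under eq_fun do rewrite big_nil; exact: brv_cst.
by under eq_fun do rewrite big_cons; exact: brvD.
Qed.

Lemma brv_cos X : measurable_fun setT X -> brv (fun x => cos (X x)).
Proof.
move=> mX; split.
  by apply: measurableT_comp => //; apply: continuous_measurable_fun; exact: continuous_cos.
by exists 1 => x; exact: cos_max.
Qed.

Lemma brv_sin X : measurable_fun setT X -> brv (fun x => sin (X x)).
Proof.
move=> mX; split.
  by apply: measurableT_comp => //; apply: continuous_measurable_fun; exact: continuous_sin.
by exists 1 => x; exact: sin_max.
Qed.

Lemma brv_indic (A : set T) : measurable A -> brv (\1_A : T -> R).
Proof.
move=> mA; split; first exact: measurable_indic.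
by exists 1 => x; rewrite indicE; case: (x \in A); rewrite ?normr0 ?normr1.
Qed.

Lemma brv_integrable X : brv X -> P.-integrable setT (EFin \o X).
Proof.
move=> [mX [M XM]]; apply: measurable_bounded_integrable => //.
  by rewrite [X in (X < _)%E]probability_setT ltry.
exists M; split; first exact: num_real.
by move=> N MN x _; exact: le_trans (XM x) (ltW MN).
Qed.

Lemma Ex_cst c : Ex (fun=> c) = c.
Proof. by rewrite /Ex Rintegral_cst// [X in fine X]probability_setT mulr1. Qed.

Lemma ExD X Y : brv X -> brv Y -> Ex (fun x => X x + Y x) = Ex X + Ex Y.
Proof. by move=> bX bY; rewrite /Ex RintegralD//; exact: brv_integrable. Qed.

Lemma ExZ c X : brv X -> Ex (fun x => c * X x) = c * Ex X.
Proof. by move=> bX; rewrite /Ex RintegralZl//; exact: brv_integrable. Qed.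

Lemma ExN X : brv X -> Ex (fun x => - X x) = - Ex X.
Proof. by move=> bX; under eq_fun do rewrite -mulN1r; rewrite ExZ// mulN1r. Qed.

Lemma ExB X Y : brv X -> brv Y -> Ex (fun x => X x - Y x) = Ex X - Ex Y.
Proof. by move=> bX bY; rewrite ExD ?ExN//; exact: brvN. Qed.

Lemma Ex_sum (I : Type) (r : seq I) (F : I -> T -> R) : (forall i, brv (F i)) ->
  Ex (fun x => \sum_(i <- r) F i x) = \sum_(i <- r) Ex (F i).
Proof.
move=> bF; elim: r => [|i r ih].
  by under eq_fun do rewrite big_nil; rewrite Ex_cst big_nil.
under eq_fun do rewrite big_cons.
by rewrite ExD ?ih ?big_cons//; exact: brv_sum.
Qed.

Lemma le_Ex X Y : brv X -> brv Y -> (forall x, X x <= Y x) -> Ex X <= Ex Y.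
Proof. by move=> bX bY XY; apply: le_Rintegral => //; exact: brv_integrable. Qed.

Lemma Ex_ge0 X : (forall x, 0 <= X x) -> 0 <= Ex X.
Proof. by move=> X0; apply: Rintegral_ge0. Qed.

Lemma le_norm_Ex X Y : brv X -> brv Y -> (forall x, `|X x| <= Y x) -> `|Ex X| <= Ex Y.
Proof.
move=> bX bY XY; apply: le_trans (le_Ex (brv_norm bX) bY XY).
by apply: le_normr_Rintegral => //; exact: brv_integrable.
Qed.

Lemma norm_Ex_le X M : brv X -> (forall x, `|X x| <= M) -> `|Ex X| <= M.
Proof. by move=> bX XM; rewrite -(Ex_cst M); apply: le_norm_Ex => //; exact: brv_cst. Qed.

Lemma Ex_indic (A : set T) : measurable A -> (Ex (\1_A : T -> R))%:E = P A.
Proof.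
move=> mA; rewrite /Ex /Rintegral.
have -> : (\int[P]_x (\1_A x)%:E)%E = P A by rewrite integral_indic// setIT.
by rewrite fineK// fin_num_measure.
Qed.

Lemma eq_Ex_indic (A : set T) X : measurable A ->
  Ex (fun x => \1_A x * X x) = fine (\int[P]_(x in A) (X x)%:E).
Proof.
move=> mA; rewrite -[RHS]/(Rintegral P A X) Rintegral_mkcond; apply: eq_Rintegral => x _.
by rewrite patchE indicE; case: ifPn => _; rewrite ?mul1r ?mul0r.
Qed.

Lemma cvg_Ex (X : nat -> T -> R) (Y : T -> R) (M : R) :
  (forall k, measurable_fun setT (X k)) -> measurable_fun setT Y ->
  (forall k x, `|X k x| <= M) -> (forall x, X ^~ x @ \oo --> Y x) ->
  Ex (X k) @[k --> \oo] --> Ex Y.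
Proof.
move=> mX mY XM XY.
have [|||||h1 _ h3] := @dominated_convergence _ T R P setT measurableT
  (fun k x => (X k x)%:E) (fun x => (Y x)%:E) (cst M%:E).
- by move=> k; exact/measurable_EFinP.
- exact/measurable_EFinP.
- by apply: aeW => x _; apply/fine_cvgP; split; [exact: nearW|exact: XY].
- by have := brv_integrable (brv_cst M).
- by apply: aeW => x k _; rewrite /= lee_fin.
by apply: fine_cvg; rewrite fineK//; exact: integrable_fin_num.
Qed.

End BoundedRV.

Section MartingaleTest.
Variables (R : realType) (d : measure_display) (T : measurableType d).
Variable P : probability T R.
Implicit Types (X Y G : T -> R).

(** The sum is the integer part of y, written with indicators of half-lines so that it becomes a
    step function when y is a random variable. *)
Lemma floor_count (N : nat) (y : R) : 0 <= y <= N%:R ->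
  `|y - \sum_(i < N) ((i.+1%:R <= y)%R : nat)%:R| <= 1.
Proof.
elim: N y => [|N ih] y /andP[y0 yN].
  by rewrite big_ord0 subr0 ger0_norm// (le_trans yN).
rewrite big_ord_recr/=; have [yN'|yN'] := leP y N%:R.
  have -> : (N.+1%:R <= y) = false.
    by apply/negP => Ny; have := le_trans Ny yN'; rewrite ler_nat ltnn.
  by rewrite addr0; apply: ih; rewrite y0.
have -> : \sum_(i < N) ((i.+1%:R <= y)%R : nat)%:R = N%:R :> R.
  rewrite (eq_bigr (fun=> 1)) ?sumr_const ?card_ord// => i _.
  by rewrite (le_trans _ (ltW yN'))// ler_nat.
rewrite -natr1 in yN *; rewrite ler_norml.
by case: (leP (N%:R + 1) y) => _; rewrite ?mulr1n ?mulr0n; apply/andP; split; lra.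
Qed.

(** [G] is uniformly approximated by a combination of indicators of events defined by [G], for which
    the expectation vanishes by hypothesis. This extends the martingale property from events to
    bounded weights. *)
Lemma Ex_mul_eq0 G Y : brv G -> brv Y ->
  (forall B : set R, measurable B -> Ex P (fun x => \1_(G @^-1` B) x * Y x) = 0) ->
  Ex P (fun x => G x * Y x) = 0.
Proof.
move=> bG bY H; have [mG [M GM]] := bG.
have EY : Ex P Y = 0.
  have := H setT measurableT; rewrite preimage_setT => <-.
  by congr (Ex P _); apply/funext => x; rewrite indicE in_setT mul1r.
have M0 : 0 <= M by exact: le_trans (normr_ge0 _) (GM point).
apply/eqP; rewrite -normr_eq0 eq_le normr_ge0 andbT; apply/ler_addgt0Pr => e e0.
rewrite add0r; have EY0 : 0 <= Ex P (fun x => `|Y x|) by apply: Ex_ge0.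
(* The height of the steps: approximating [G] within [h] costs at most h E|Y| <= e. *)
pose h := e / (Ex P (fun x => `|Y x|) + 1).
have h0 : 0 < h by rewrite divr_gt0// ltr_wpDl.
pose N := (Num.truncn (2 * M / h)).+1.
have NM : 2 * M / h <= N%:R by rewrite ltW// truncnS_gt.
pose B (i : nat) : set R := [set z | i.+1%:R * h - M <= z].
have mB i : measurable (B i).
  by rewrite (_ : B i = `[i.+1%:R * h - M, +oo[%classic)//; apply/seteqP; split=> z /=;
    rewrite in_itv/= andbT.
pose S x := h * \sum_(i < N) \1_(G @^-1` B i) x.
have mGB i : measurable (G @^-1` B i) by rewrite -[_ @^-1` _]setTI; exact: mG.
have bS : brv S by apply: brvZ; apply: brv_sum => i; exact: brv_indic.
have ES : Ex P (fun x => (S x - M) * Y x) = 0.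
  have -> : (fun x => (S x - M) * Y x) = (fun x =>
      h * (\sum_(i < N) \1_(G @^-1` B i) x * Y x) - M * Y x).
    by apply/funext => x; rewrite mulrBl /S -mulrA mulr_suml.
  have b1 (i : 'I_N) : brv (fun x => \1_(G @^-1` B i) x * Y x).
    by apply: brvM => //; exact: brv_indic.
  rewrite ExB; [|by apply: brvZ; exact: brv_sum|exact: brvZ].
  rewrite !ExZ//; last exact: brv_sum.
  by rewrite EY Ex_sum// big1 ?mulr0 ?subrr// => i _; exact: H.
have GS x : `|G x - (S x - M)| <= h.
  have Gx := GM x; rewrite ler_norml in Gx; have /andP[G1 G2] := Gx.
  have := @floor_count N ((G x + M) / h) _.
  have -> : \sum_(i < N) ((i.+1%:R <= (G x + M) / h)%R : nat)%:R =
      \sum_(i < N) \1_(G @^-1` B i) x :> R.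
    apply: eq_bigr => i _; rewrite indicE; congr (_%:R); congr (nat_of_bool _).
    rewrite ler_pdivlMr//; apply/idP/idP => [k|/set_mem/=].
      by rewrite mem_set//= /B/= lerBlDr.
    by rewrite /B/= lerBlDr.
  move=> /(_ _)/wrap[].
    apply/andP; split; first by rewrite divr_ge0 ?(ltW h0)//; lra.
    by apply: le_trans NM; rewrite ler_pM2r ?invr_gt0//; lra.
  rewrite -(ler_pM2l h0) mulr1 => /(le_trans _); apply.
  rewrite -[X in X * `|_|](gtr0_norm h0) -normrM /S mulrBr mulrCA divff ?gt_eqF// mulr1.
  by rewrite le_eqVlt; apply/orP; left; apply/eqP; congr (`|_|); ring.
have b1 : brv (fun x => S x - M) by apply: brvB => //; exact: brv_cst.
have b2 : brv (fun x => G x - (S x - M)) by exact: brvB.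
have -> : Ex P (fun x => G x * Y x) = Ex P (fun x => (G x - (S x - M)) * Y x).
  rewrite -[RHS]addr0 -[X in _ = _ + X]ES -ExD; [|exact: brvM..].
  by congr (Ex P _); apply/funext => x; ring.
apply: le_trans (_ : Ex P (fun x => h * `|Y x|) <= _).
  apply: le_norm_Ex => [||x].
  - exact: brvM.
  - by apply: brvZ; exact: brv_norm.
  - by rewrite normrM ler_wpM2r.
rewrite ExZ; last exact: brv_norm.
by rewrite /h mulrAC ler_pdivrMr ?ltr_wpDl// ler_wpM2l ?(ltW e0)// lerDl.
Qed.

Lemma martingale_mul (F : R -> set (set T)) (M : R -> T -> R) G (s t : R) :
  martingale P F M -> 0 <= s <= t -> brv (M s) -> brv (M t) -> brv G ->
  (forall B, measurable B -> F s (G @^-1` B)) ->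
  Ex P (fun x => G x * (M t x - M s x)) = 0.
Proof.
move=> [_ _ H] st bs bt bG FG.
apply: Ex_mul_eq0 => // [|B mB]; first exact: brvB.
have mA : measurable (G @^-1` B) by rewrite -[_ @^-1` _]setTI; case: bG => mG _; exact: mG.
have b1 := brv_indic R mA.
under eq_fun do rewrite mulrBr.
rewrite ExB; [|exact: brvM..].
by rewrite !eq_Ex_indic// (H s t st _ (FG _ mB)) subrr.
Qed.

End MartingaleTest.

Lemma eq_ler (R : numDomainType) (x y : R) : x = y -> x <= y.
Proof. by move=> ->. Qed.

Section NiceMeasurable.
Variables (R : realType) (n : nat).
Local Notation V := 'M[R]_(n, 4).

Lemma measurable_inv : measurable_fun setT (fun x : R => x^-1).
Proof.
have -> : [set: R] = [set x | x != 0] `|` [set 0].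
  by apply/seteqP; split=> // x _; have [->|] := eqVneq x 0; [right|left].
have o0 : open [set x : R | x != 0].
  have -> : [set x : R | x != 0] = ~` [set 0].
    by apply/seteqP; split=> x /=; [move/eqP|move/eqP].
  by apply: closed_openC; exact: closed_eq.
apply/measurable_funU => //; first exact: open_measurable.
split; last exact: measurable_fun_set1.
apply: open_continuous_measurable_fun => // x; rewrite inE => x0.
exact: inv_continuous.
Qed.

Lemma nice_measurable (dU : measure_display) (U : measurableType dU) (W : U -> V) f :
  (forall i k, measurable_fun setT (fun x => W x i k)) -> nice f ->
  measurable_fun setT (fun x => f (W x)).
Proof.
move=> mW; elim=> [c|i k|{}f g _ mf _ mg|{}f g _ mf _ mg|{}f _ mf _|k {}f _ mf].
- exact: measurable_cst.
- exact: mW.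
- exact: measurable_funD.
- exact: measurable_funM.
- exact: (measurableT_comp measurable_inv mf).
- apply: (measurableT_comp _ mf); apply: continuous_measurable_fun => x.
  apply: differentiable_continuous; apply/derivable1_diffP.
  by case: (is_derive_flat k x).
Qed.

End NiceMeasurable.

(** * Conditional moments of the increments of the path *)

Section MartingaleProblem.
Variables (R : realType) (d : measure_display) (T : measurableType d).
Variables (P : probability T R) (n : nat).
Local Notation V := 'M[R]_(n, 4).
Variable w : R -> T -> V.
Hypothesis hw : brownian_motion_HHn P w 0.
Implicit Types (f : V -> R) (G X : T -> R).

(** The generators of [natural_filtration w s]; named separately, they give a measurable structure
    in which adaptedness is ordinary measurability. *)
Definition gens (s : R) : set (set T) := [set A | exists r (i : 'I_n) (k : 'I_4) (B : set R),
    [/\ 0 <= r <= s, measurable B & A = (fun x => w r x i k) @^-1` B] ].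

(* Measurability with respect to the natural filtration at time [s]. *)
Definition Fmeas (s : R) X : Prop :=
  @measurable_fun _ _ (g_sigma_algebraType (gens s)) R setT X.

Lemma FmeasP s X (B : set R) : Fmeas s X -> measurable B ->
  natural_filtration w s (X @^-1` B).
Proof. by move=> FX mB; have := FX measurableT B mB; rewrite setTI. Qed.

Lemma bm_measurable t i k : 0 <= t -> measurable_fun setT (fun x => w t x i k).
Proof. by case: hw => h _ _ _ _ /h. Qed.

Lemma bm_HHn t x : 0 <= t -> hnorm2 (w t x) < 1.
Proof. by case: hw => _ h _ _ _ t0; exact: h. Qed.

Lemma Fmeas_nice u s f : 0 <= u <= s -> nice f -> Fmeas s (fun x => f (w u x)).
Proof.
move=> us nf; apply: (@nice_measurable R n _ (g_sigma_algebraType (gens s)) (w u)) => // i k.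
move=> _ B mB; rewrite setTI; apply: sub_sigma_algebra.
by exists u, i, k, B.
Qed.

Lemma Fmeas_mono s t X : s <= t -> Fmeas s X -> Fmeas t X.
Proof.
move=> st FX _ B mB.
have : <<s gens s >> `<=` <<s gens t >>.
  apply: smallest_sub; first exact: smallest_sigma_algebra.
  move=> A [r [i [k [C [/andP[r0 rs] mC ->]]]]]; apply: sub_sigma_algebra.
  by exists r, i, k, C; split=> //; rewrite r0 (le_trans rs).
by apply; exact: FX.
Qed.

Lemma Fmeas_measurable s X : Fmeas s X -> measurable_fun setT X.
Proof.
move=> FX _ B mB.
have : <<s gens s >> `<=` @measurable _ T.
  apply: smallest_sub; first exact: sigma_algebra_measurable.
  move=> A [r [i [k [C [/andP[r0 rs] mC ->]]]]].
  by rewrite -[_ @^-1` _]setTI; exact: bm_measurable.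
by apply; exact: FX.
Qed.

Lemma nice_bm_measurable t f : 0 <= t -> nice f -> measurable_fun setT (fun x => f (w t x)).
Proof. by move=> t0; apply: nice_measurable => i k; exact: bm_measurable. Qed.

Lemma nice_bm_bounded f : nice f ->
  exists2 M, 0 <= M & forall t x, 0 <= t -> `|f (w t x)| <= M.
Proof.
move=> nf; have [M M0 fM] := nice_bounded 1 nf.
by exists M => // t x t0; apply: fM; exact/ltW/bm_HHn.
Qed.

Lemma nice_brv t f : 0 <= t -> nice f -> brv (fun x => f (w t x)).
Proof.
move=> t0 nf; split; first exact: nice_bm_measurable.
by have [M _ fM] := nice_bm_bounded nf; exists M => x; exact: fM.
Qed.

Lemma bm_path_continuous f x (t : R) : nice f ->
  {within `[0, t], continuous (fun s => f (w s x))}.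
Proof.
move=> nf; case: hw => _ _ cw _ _.
have c0 : {within `[0, t], continuous (fun s => w s x)}.
  apply: continuous_subspaceW (cw x) => s /=.
  by rewrite !in_itv/= andbT => /andP[].
move=> s; apply: continuous_comp (c0 s) _.
exact: nice_continuous.
Qed.

Definition gen f (y : V) : R := 2^-1 * lap f y.

Lemma nice_gen f : nice f -> nice (gen f).
Proof. by move=> nf; apply: nice_mul (nice_cst _) _; exact: nice_lap. Qed.

Definition igen f (t : R) x : R := \int[lebesgue_measure]_(s in `[0, t]) gen f (w s x).

Lemma path_integrable f x (t : R) : nice f ->
  lebesgue_measure.-integrable `[0, t] (EFin \o (fun s => f (w s x))).
Proof.
move=> nf; apply: continuous_compact_integrable; first exact: segment_compact.
exact: bm_path_continuous.
Qed.

Lemma igenE f t x : nice f ->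
  \int[lebesgue_measure]_(s in `[0, t]) (2^-1 * laplace_beltrami f (w s x)) = igen f t x.
Proof.
move=> nf; apply: eq_Rintegral => s; rewrite inE/= in_itv/= => /andP[s0 _].
by rewrite laplace_beltramiE//; exact: bm_HHn.
Qed.

Lemma lebesgue_oc (a b : R) : a <= b -> fine (lebesgue_measure `]a, b]%classic) = b - a.
Proof.
rewrite le_eqVlt lebesgue_measure_itv/= lte_fin => /predU1P[->|->]; last by [].
by rewrite ltxx subrr.
Qed.

Lemma Rintegral_cst_oc (a b c : R) : a <= b ->
  \int[lebesgue_measure]_(s in `]a, b]) c = c * (b - a).
Proof.
move=> ab; rewrite Rintegral_cst//; congr (_ * _); exact: lebesgue_oc.
Qed.

Lemma integrable_cst_oc (a b c : R) :
  lebesgue_measure.-integrable `]a, b] (EFin \o (fun=> c)).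
Proof.
apply: (@measurable_bounded_integrable _ _ R lebesgue_measure (fun=> c)) => //.
  rewrite [X in (X < _)%E](_ : _ = lebesgue_measure `]a, b]%classic)//.
  by rewrite lebesgue_measure_itv/=; case: ifP => _; rewrite ltry.
exists `|c|; split; first exact: num_real.
by move=> N /ltW cN x _.
Qed.

Lemma Rintegral_bound (a b M : R) (g : R -> R) : a <= b ->
  lebesgue_measure.-integrable `]a, b] (EFin \o g) ->
  (forall s, a < s <= b -> `|g s| <= M) ->
  `|\int[lebesgue_measure]_(s in `]a, b]) g s| <= M * (b - a).
Proof.
move=> ab ig gM; apply: le_trans (le_normr_Rintegral _ ig) _ => //.
rewrite -Rintegral_cst_oc//.
apply: le_Rintegral => //; first exact: integrable_norm.
  exact: integrable_cst_oc.
Qed.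

Lemma igenB f s t x : nice f -> 0 <= s <= t ->
  igen f t x - igen f s x = \int[lebesgue_measure]_(u in `]s, t]) gen f (w u x).
Proof.
move=> nf /andP[s0 st]; apply: Rintegral_itvB; first exact/path_integrable/nice_gen.
  by rewrite bnd_simp.
by rewrite bnd_simp.
Qed.

(* The error of the left-point quadrature of [int_s^t gen f (w u) du]. *)
Definition qerr f s t x : R := igen f t x - igen f s x - (t - s) * gen f (w s x).

Lemma qerr_le f s t x M : nice f -> 0 <= s <= t ->
  (forall u, s < u <= t -> `|gen f (w u x) - gen f (w s x)| <= M) ->
  `|qerr f s t x| <= M * (t - s).
Proof.
move=> nf /andP[s0 st] H; rewrite /qerr igenB ?s0//.
have i1 : lebesgue_measure.-integrable `]s, t] (EFin \o (fun u => gen f (w u x))).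
  apply: integrableS (path_integrable x t (nice_gen nf)) => //.
  by move=> u /=; rewrite !in_itv/= => /andP[su ->]; rewrite (le_trans s0 (ltW su)).
have i2 := integrable_cst_oc s t (gen f (w s x)).
rewrite mulrC -Rintegral_cst_oc// -RintegralB//; apply: Rintegral_bound => //.
exact: (@integrableB _ _ _ lebesgue_measure _ _ _ _ i1 i2).
Qed.

Variable f : V -> R.
Hypotheses (nf : nice f) (tf : test_function f).

Lemma mart_f : martingale P (natural_filtration w)
  (fun t x => f (w t x) - f (w 0 x) - igen f t x).
Proof.
case: hw => _ _ _ _ /(_ f tf).
under [X in martingale P _ X -> _]eq_fun => t do under eq_fun do rewrite igenE//.
by [].
Qed.

(** Measurability of the time integral is read off the martingale, of which it is the compensator;
    boundedness comes from the quadrature error started at time 0. *)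
Lemma brv_igen t : 0 <= t -> brv (igen f t).
Proof.
move=> t0; split.
  case: mart_f => _ /(_ t t0) /integrableP[/measurable_EFinP m _] _.
  have -> : igen f t = (fun x => (f (w t x) - f (w 0 x)) - (f (w t x) - f (w 0 x) - igen f t x)).
    by apply/funext => x; rewrite subKr.
  by apply: measurable_funB => //; apply: measurable_funB; exact: nice_bm_measurable.
have [M M0 fM] := nice_bm_bounded (nice_gen nf).
exists (M * 2 * t + t * M) => x.
have -> : igen f t x = qerr f 0 t x + t * gen f (w 0 x).
  rewrite /qerr subr0; have -> : igen f 0 x = 0; last by ring.
  by rewrite /igen set_itv1 Rintegral_set1.
apply: le_trans (ler_normD _ _) _; apply: lerD.
  rewrite -[X in _ * X]subr0; apply: qerr_le => //; first by rewrite lexx.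
  move=> u /andP[u0 _]; rewrite (le_trans (ler_normB _ _))// mulr2n mulrDr mulr1.
  by apply: lerD; apply: fM => //; exact: ltW.
by rewrite normrM ger0_norm// ler_wpM2l// fM.
Qed.

Lemma brv_qerr s t : 0 <= s <= t -> brv (qerr f s t).
Proof.
move=> /andP[s0 st]; have t0 := le_trans s0 st.
apply: brvB; first by apply: brvB; exact: brv_igen.
by apply: brvZ; apply: nice_brv => //; exact: nice_gen.
Qed.

(** The martingale property tested against [G], the time integral being split into its left-point
    value and the error [qerr]. *)
Lemma one_step s t G : 0 <= s <= t -> Fmeas s G -> brv G ->
  Ex P (fun x => G x * (f (w t x) - f (w s x))) =
  (t - s) * Ex P (fun x => G x * gen f (w s x)) + Ex P (fun x => G x * qerr f s t x).
Proof.
move=> /[dup] st0 /andP[s0 st] FG bG; have t0 := le_trans s0 st.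
have bM r : 0 <= r -> brv (fun x => f (w r x) - f (w 0 x) - igen f r x).
  by move=> r0; apply: brvB; [apply: brvB; exact: nice_brv|exact: brv_igen].
have := martingale_mul mart_f st0 (bM _ s0) (bM _ t0) bG (fun B mB => FmeasP FG mB).
have bq := brv_qerr st0.
have bg : brv (fun x => gen f (w s x)) by apply: nice_brv => //; exact: nice_gen.
have bf : brv (fun x => f (w t x) - f (w s x)) by apply: brvB; exact: nice_brv.
have -> : (fun x => G x * (f (w t x) - f (w 0 x) - igen f t x -
     (f (w s x) - f (w 0 x) - igen f s x))) =
   (fun x => G x * (f (w t x) - f (w s x)) -
     ((t - s) * (G x * gen f (w s x)) + G x * qerr f s t x)).
  by apply/funext => x; rewrite /qerr; ring.
rewrite ExB; [|exact: brvM|by apply: brvD; [apply: brvZ|]; exact: brvM].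
rewrite ExD; [|by apply: brvZ; exact: brvM|exact: brvM].
by rewrite ExZ; [move/eqP; rewrite subr_eq0 => /eqP|exact: brvM].
Qed.

Section Grid.
Variable t : R.
Hypothesis t0 : 0 < t.

(** [N.+1] equal steps, so that the mesh is defined for every [N]. *)
Definition grid (N k : nat) : R := t * k%:R / N.+1%:R.

Lemma grid_ge0 N k : 0 <= grid N k.
Proof. by rewrite divr_ge0// mulr_ge0// ltW. Qed.

Lemma gridS N k : grid N k.+1 - grid N k = t / N.+1%:R.
Proof. by rewrite /grid -mulrBl -natr1 mulrDr mulr1 addrAC subrr add0r. Qed.

Lemma grid_leS N k : grid N k <= grid N k.+1.
Proof. by rewrite -subr_ge0 gridS divr_ge0// ltW. Qed.

Lemma grid_mono N j k : (j <= k)%N -> grid N j <= grid N k.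
Proof.
by move=> jk; rewrite ler_pM2r ?invr_gt0// ler_pM2l// ler_nat.
Qed.

Lemma gridN N : grid N N.+1 = t.
Proof. by rewrite /grid mulfK. Qed.

Lemma grid0 N : grid N 0 = 0.
Proof. by rewrite /grid mulr0 mul0r. Qed.

Definition qerrs N x := \sum_(k < N.+1) `|qerr f (grid N k) (grid N k.+1) x|.

Lemma grid_step N k : 0 <= grid N k <= grid N k.+1.
Proof. by rewrite grid_ge0 grid_leS. Qed.

(** For a fixed path, s -> gen f (w s x) is uniformly continuous on [0, t]; on a fine grid each
    error is at most e/t times the length of the step. *)
Lemma cvg_qerrs x : qerrs N x @[N --> \oo] --> 0.
Proof.
have cg := @bm_path_continuous (gen f) x t (nice_gen nf).
apply/cvgr0Pnorm_le => e e0.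
have et : 0 < e / t by rewrite divr_gt0.
have [del del0 H] := compact_unif_continuous (@segment_compact R 0 t) cg et.
near=> N.
have hN : t / N.+1%:R < del.
  rewrite ltr_pdivrMr// mulrC -ltr_pdivrMr//.
  near: N; have := nbhs_infty_gtr (t / del) => -[m _ Hm]; exists m => // k mk.
  by apply: lt_trans (Hm k mk) _; rewrite ltr_nat.
rewrite ger0_norm; last by apply: sumr_ge0.
apply: (@le_trans _ _ (\sum_(k < N.+1) (e / t) * (t / N.+1%:R))); last first.
  by rewrite sumr_const card_ord -mulr_natr; apply: eq_ler; field; rewrite !gt_eqF.
apply: ler_sum => k _; rewrite -(gridS N k); apply: qerr_le => //; first exact: grid_step.
move=> u /andP[su ut].
have kt : grid N k.+1 <= t by rewrite -[leRHS](gridN N) grid_mono.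
have gt : `[0, t]%classic (grid N k).
  by rewrite /= in_itv/= grid_ge0 (le_trans (grid_leS _ _) kt).
have ut' : `[0, t]%classic u.
  by rewrite /= in_itv/= (le_trans (grid_ge0 N k) (ltW su)) (le_trans ut kt).
have gu : ball (grid N k) del u.
  rewrite -ball_normE/= distrC gtr0_norm ?subr_gt0//.
  by apply: le_lt_trans hN; rewrite -(gridS N k) lerD2r.
have := H _ _ gt ut' gu.
by rewrite -ball_normE/= => /ltW; rewrite distrC.
Unshelve. all: by end_near. Qed.

Lemma cvg_Ex_qerrs :
  \sum_(k < N.+1) Ex P (fun x => `|qerr f (grid N k) (grid N k.+1) x|) @[N --> \oo] --> 0.
Proof.
have bq N k := brv_norm (brv_qerr (grid_step N k)).
have -> : (fun N => \sum_(k < N.+1) Ex P (fun x => `|qerr f (grid N k) (grid N k.+1) x|)) =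
   (fun N => Ex P (qerrs N)).
  by apply/funext => N; rewrite Ex_sum.
have [M M0 fM] := nice_bm_bounded (nice_gen nf).
rewrite -(Ex_cst P 0); apply: (@cvg_Ex _ _ _ P _ _ (M * 2 * t)) => [N||N x|x].
- by have [] := brv_sum (index_enum 'I_N.+1) (fun k => bq N k).
- exact: measurable_cst.
- rewrite ger0_norm; last by apply: sumr_ge0.
  apply: (@le_trans _ _ (\sum_(k < N.+1) (M * 2) * (t / N.+1%:R))); last first.
    by rewrite sumr_const card_ord -mulr_natr; apply: eq_ler; field.
  apply: ler_sum => k _; rewrite -(gridS N k); apply: qerr_le => //; first exact: grid_step.
  move=> u /andP[su _]; rewrite (le_trans (ler_normB _ _))// mulr2n mulrDr mulr1.
  apply: lerD; apply: fM; last exact: grid_ge0.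
  exact: le_trans (grid_ge0 N k) (ltW su).
- exact: cvg_qerrs.
Qed.

End Grid.

End MartingaleProblem.

(** * Functions of two positions that are finite sums of products *)

Section Separable.
Variables (R : realType) (n : nat).
Local Notation V := 'M[R]_(n, 4).

Lemma lap_add (f g : V -> R) w : nice f -> nice g ->
  lap (fun z => f z + g z) w = lap f w + lap g w.
Proof.
move=> nf ng; rewrite /lap -mulrDr; congr (_ * _).
have E b z : pd b (fun z => f z + g z) z = pd b f z + pd b g z by rewrite pd_add.
have DD a b : pd a (pd b (fun z => f z + g z)) w = pd a (pd b f) w + pd a (pd b g) w.
  by rewrite -pd_add//; try (by exact: nice_pd); congr (pd a _ w); apply/funext => z.
rewrite addrACA -mulrDr -!big_split/=; congr (_ + _ * _).
  by apply: eq_bigr => a _; rewrite -big_split; apply: eq_bigr => b _; rewrite DD mulrDr.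
by apply: eq_bigr => b _; rewrite E mulrDr.
Qed.

Lemma lap_scale (c : R) (f : V -> R) w : nice f -> lap (fun z => c * f z) w = c * lap f w.
Proof.
move=> nf; rewrite lap_mul//; last exact: nice_cst.
have -> : lap (fun=> c) w = 0.
  rewrite /lap big1 => [|a _]; last first.
    apply: big1 => b _; rewrite (_ : pd b _ = fun=> 0) ?pd_cst ?mulr0//.
    by apply/funext => z; rewrite pd_cst.
  by rewrite big1 ?mulr0 ?addr0 ?mulr0// => b _; rewrite pd_cst mulr0.
rewrite /gam big1; last by move=> a _; apply: big1 => b _; rewrite pd_cst mul0r mulr0.
by rewrite !mulr0 !addr0.
Qed.

(* Given the value of [z] at the beginning of a step, the martingale problem for the
   factors in [y] controls the conditional expectation at its end. *)
Inductive sep : (V -> V -> R) -> Prop :=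
| sep0 : sep (fun _ _ => 0)
| sepS (F : V -> V -> R) (g f : V -> R) : nice g -> nice f -> sep F -> sep (fun z y => g z * f y + F z y).

Lemma sep_eq F G : sep F -> (forall z y, F z y = G z y) -> sep G.
Proof.
move=> sF FG; have -> // : G = F.
by apply/funext => z; apply/funext => y.
Qed.

Lemma sepD F G : sep F -> sep G -> sep (fun z y => F z y + G z y).
Proof.
move=> sF sG; elim: sF => [|{}F g f ng nf _ ih].
  by apply: sep_eq sG _ => z y; rewrite add0r.
by apply: sep_eq (sepS ng nf ih) _ => z y; rewrite addrA.
Qed.

Lemma sep1 g f : nice g -> nice f -> sep (fun z y => g z * f y).
Proof. by move=> ng nf; apply: sep_eq (sepS ng nf sep0) _ => z y; rewrite addr0. Qed.

Lemma sepM F G : sep F -> sep G -> sep (fun z y => F z y * G z y).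
Proof.
move=> sF sG; elim: sF => [|{}F g f ng nf _ ih].
  by apply: sep_eq sep0 _ => z y; rewrite mul0r.
have h : sep (fun z y => g z * f y * G z y).
  elim: sG {F ih} => [|F g' f' ng' nf' _ ih]; first by apply: sep_eq sep0 _ => z y; rewrite mulr0.
  apply: sep_eq (sepS (nice_mul ng ng') (nice_mul nf nf') ih) _ => z y.
  by ring.
by apply: sep_eq (sepD h ih) _ => z y; rewrite mulrDl.
Qed.

Lemma sep_l g : nice g -> sep (fun z _ => g z).
Proof. by move=> ng; apply: sep_eq (sep1 ng (nice_cst 1)) _ => z y; rewrite mulr1. Qed.

Lemma sep_r f : nice f -> sep (fun _ y => f y).
Proof. by move=> nf; apply: sep_eq (sep1 (nice_cst 1) nf) _ => z y; rewrite mul1r. Qed.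

Lemma sepX F m : sep F -> sep (fun z y => F z y ^+ m).
Proof.
move=> sF; elim: m => [|m ih]; first exact: sep_l (nice_cst 1).
by apply: sep_eq (sepM sF ih) _ => z y; rewrite exprS.
Qed.

Lemma sep_sum (I : Type) (r : seq I) (F : I -> V -> V -> R) :
  (forall i, sep (F i)) -> sep (fun z y => \sum_(i <- r) F i z y).
Proof.
move=> sF; elim: r => [|i r ih].
  by apply: sep_eq sep0 _ => z y; rewrite big_nil.
by apply: sep_eq (sepD (sF i) ih) _ => z y; rewrite big_cons.
Qed.

Lemma sep_nice F z : sep F -> nice (F z).
Proof.
elim=> [|{}F g f ng nf _ ih]; first exact: nice_cst.
by apply: nice_add ih; apply: nice_mul nf; exact: nice_cst.
Qed.

Lemma sep_psi (a b : R) (l : R * R * R) : a < b -> b < 1 -> sep (psi a b l).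
Proof.
move=> ab b1; have nc := @nice_conf R n a b ab b1.
apply: sepM (sep_l (nice_cst _)) _; apply: sepM.
  by apply: sepD; [exact: sep_l|exact: sep_r].
apply: (@sep_eq (fun z y => \sum_j \sum_c y j c * (imul l z) j c)) => //.
apply: sep_sum => j; apply: sep_sum => c.
apply: sepM; first exact: sep_r (nice_coord j c).
have nl k := @nice_lm R n k j c.
apply: sep_l; apply: nice_eq (nice_add (nice_add (nice_mul (nice_cst l.1.1) (nl 1))
  (nice_mul (nice_cst l.1.2) (nl 2))) (nice_mul (nice_cst l.2) (nl 3))) _ => z.
by rewrite !mxE.
Qed.

End Separable.

Section Moments.
Variables (R : realType) (d : measure_display) (T : measurableType d).
Variables (P : probability T R) (n : nat).
Local Notation V := 'M[R]_(n, 4).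
Variable w : R -> T -> V.
Hypothesis hw : brownian_motion_HHn P w 0.
Variables (a b : R).
Hypotheses (ab : a < b) (b1 : b < 1).
Variable t : R.
Hypothesis t0 : 0 < t.
Local Notation chi := (@cutoff R n a b).
Local Notation tk := (grid t).

(** Plays the role of a little-o of the step length: only the sum of the errors over all steps has
    to tend to 0. *)
Definition vanishing (r : nat -> nat -> R) := (forall N k, 0 <= r N k) /\
  (\sum_(k < N.+1) r N k @[N --> \oo] --> 0).

Lemma vanishingD r s : vanishing r -> vanishing s -> vanishing (fun N k => r N k + s N k).
Proof.
move=> [r0 cr] [s0 cs]; split=> [N k|]; first exact: addr_ge0.
under eq_fun do rewrite big_split/=.
by have := cvgD cr cs; rewrite addr0; apply.
Qed.

Lemma vanishingZ (c : R) r : 0 <= c -> vanishing r -> vanishing (fun N k => c * r N k).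
Proof.
move=> c0 [r0 cr]; split=> [N k|]; first exact: mulr_ge0.
under eq_fun do rewrite -mulr_sumr.
by have := @cvgMl_tmp _ _ _ _ _ c _ cr; rewrite mulr0; apply.
Qed.

Lemma vanishing0 : vanishing (fun _ _ => 0).
Proof.
split=> //; rewrite (_ : (fun N => _) = fun=> 0); first exact: cvg_cst.
by apply/funext => N; rewrite big1.
Qed.

Lemma sep_brv F s u : sep F -> 0 <= s -> 0 <= u -> brv (fun x => F (w s x) (w u x)).
Proof.
move=> sF s0 u0; elim: sF => [|{}F g f ng nf _ ih]; first exact: brv_cst.
by apply: brvD ih; apply: brvM; [exact: (nice_brv hw s0 ng)|exact: (nice_brv hw u0 nf)].
Qed.

(** The generator acts on the end point y and is then evaluated at y = z; separability shows that
    the result depends nicely on z. *)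
Lemma sep_gen_diag F : sep F -> nice (fun z => gen (fun y => F z y * chi y) z).
Proof.
have nchi := @nice_cutoff R n a b ab.
elim=> [|{}F g f ng nf sF ih].
  apply: nice_eq (nice_cst 0) _ => z; rewrite /gen.
  have -> : (fun y : V => 0 * chi y) = (fun y => 0 * (fun=> 0) y) by apply/funext => y; rewrite !mul0r.
  by rewrite lap_scale ?mul0r ?mulr0//; exact: nice_cst.
apply: nice_eq (nice_add (nice_mul ng (nice_gen (nice_mul nf nchi))) ih) _ => z.
rewrite /gen -[X in _ = X]/(_ * _).
have -> : (fun y => (g z * f y + F z y) * chi y) =
    (fun y => g z * (f y * chi y) + F z y * chi y) by apply/funext => y; ring.
have nfc : nice (fun y => f y * chi y) by exact: nice_mul.
have nFc : nice (fun y => F z y * chi y) by apply: nice_mul nchi; exact: sep_nice.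
rewrite lap_add//; last by apply: nice_mul nfc; exact: nice_cst.
by rewrite lap_scale//; ring.
Qed.

(* The first-order expansion of conditional expectations over one step, uniformly in
   the bounded adapted weight [G]. *)
Lemma sep_moment F : sep F -> exists2 r, vanishing r &
  forall N k G, Fmeas w (tk N k) G -> (forall x, `|G x| <= 1) ->
  `| Ex P (fun x => G x * (F (w (tk N k) x) (w (tk N k.+1) x) * chi (w (tk N k.+1) x)
        - F (w (tk N k) x) (w (tk N k) x) * chi (w (tk N k) x)))
     - t / N.+1%:R * Ex P (fun x => G x * gen (fun y => F (w (tk N k) x) y * chi y) (w (tk N k) x)) |
   <= r N k.
Proof.
have nchi := @nice_cutoff R n a b ab.
have g0 N k : 0 <= tk N k by exact: grid_ge0.
elim=> [|{}F g f ng nf sF [r vr H]].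
  exists (fun _ _ => 0); first exact: vanishing0.
  move=> N k G _ _.
  have -> : (fun x => G x * (0 * chi (w (tk N k.+1) x) - 0 * chi (w (tk N k) x))) = fun=> 0.
    by apply/funext => x; rewrite !mul0r subrr mulr0.
  rewrite Ex_cst.
  have -> : (fun x => G x * gen (fun y : V => 0 * chi y) (w (tk N k) x)) = fun=> 0.
    apply/funext => x; rewrite /gen lap_scale ?mul0r ?mulr0//.
  by rewrite Ex_cst mulr0 subr0 normr0.
have nfc : nice (fun y => f y * chi y) by exact: nice_mul.
have tfc : test_function (fun y => f y * chi y) by exact: nice_test_function.
have [C C0 gC] := nice_bm_bounded hw ng.
pose q N k := Ex P (fun x => `|qerr w (fun y => f y * chi y) (tk N k) (tk N k.+1) x|).
exists (fun N k => C * q N k + r N k).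
  apply: vanishingD => //; apply: vanishingZ => //; split=> [N k|]; first exact: Ex_ge0.
  exact: cvg_Ex_qerrs.
move=> N k G FG G1.
have bG : brv G by split; [exact: (Fmeas_measurable hw FG)|by exists 1].
have gk0 := g0 N k; have gk1 := g0 N k.+1.
have bg : brv (fun x => g (w (tk N k) x)) by exact: (nice_brv hw gk0 ng).
have bGg : brv (fun x => G x * g (w (tk N k) x)) by exact: brvM.
(* The factor in the initial position is absorbed into the weight; its bound [C] accounts for the
   constant in front of [q]. *)
have FGg : Fmeas w (tk N k) (fun x => G x * g (w (tk N k) x)).
  by apply: measurable_funM FG _; apply: Fmeas_nice => //; rewrite gk0 lexx.
have st := grid_step t0 N k.
have one := one_step hw nfc tfc st FGg bGg.
rewrite gridS in one.
have bq := brv_qerr hw nfc tfc st.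
have bF1 : brv (fun x => F (w (tk N k) x) (w (tk N k.+1) x) * chi (w (tk N k.+1) x)).
  by apply: brvM; [exact: sep_brv|exact: (nice_brv hw _ nchi)].
have bF0 : brv (fun x => F (w (tk N k) x) (w (tk N k) x) * chi (w (tk N k) x)).
  by apply: brvM; [exact: sep_brv|exact: (nice_brv hw _ nchi)].
have bf1 : brv (fun x => f (w (tk N k.+1) x) * chi (w (tk N k.+1) x)).
  by apply: (nice_brv hw _ nfc).
have bf0 : brv (fun x => f (w (tk N k) x) * chi (w (tk N k) x)).
  by apply: (nice_brv hw _ nfc).
have -> : Ex P (fun x => G x * ((g (w (tk N k) x) * f (w (tk N k.+1) x)
      + F (w (tk N k) x) (w (tk N k.+1) x)) * chi (w (tk N k.+1) x)
    - (g (w (tk N k) x) * f (w (tk N k) x)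
      + F (w (tk N k) x) (w (tk N k) x)) * chi (w (tk N k) x))) =
  Ex P (fun x => G x * g (w (tk N k) x) * (f (w (tk N k.+1) x) * chi (w (tk N k.+1) x)
       - f (w (tk N k) x) * chi (w (tk N k) x))) +
  Ex P (fun x => G x * (F (w (tk N k) x) (w (tk N k.+1) x) * chi (w (tk N k.+1) x)
        - F (w (tk N k) x) (w (tk N k) x) * chi (w (tk N k) x))).
  rewrite -ExD; [|by apply: brvM => //; exact: brvB..].
  by congr (Ex P _); apply/funext => x; ring.
rewrite one.
have bgen : brv (fun x => gen (fun y => f y * chi y) (w (tk N k) x)).
  by exact: (nice_brv hw gk0 (nice_gen nfc)).
have bgenF : brv (fun x => gen (fun y => F (w (tk N k) x) y * chi y) (w (tk N k) x)).
  exact: (nice_brv hw gk0 (sep_gen_diag sF)).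
have -> : Ex P (fun x => G x * gen (fun y => (g (w (tk N k) x) * f y + F (w (tk N k) x) y) * chi y) (w (tk N k) x)) =
  Ex P (fun x => G x * g (w (tk N k) x) * gen (fun y => f y * chi y) (w (tk N k) x)) +
  Ex P (fun x => G x * gen (fun y => F (w (tk N k) x) y * chi y) (w (tk N k) x)).
  rewrite -ExD; [|exact: brvM..].
  congr (Ex P _); apply/funext => x; rewrite /gen.
  set z := w (tk N k) x.
  have -> : (fun y => (g z * f y + F z y) * chi y) =
    (fun y => g z * (f y * chi y) + F z y * chi y) by apply/funext => y; ring.
  have nFc : nice (fun y => F z y * chi y) by apply: nice_mul nchi; exact: sep_nice.
  rewrite lap_add//; last by apply: nice_mul nfc; exact: nice_cst.
  by rewrite lap_scale//; ring.
set e1 := Ex P (fun x => G x * g _ * gen _ _).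
set e2 := Ex P (fun x => G x * g _ * qerr _ _ _ _ x).
have := H N k G FG G1.
set e3 := Ex P _; set e4 := Ex P _ => H3.
have -> : t / N.+1%:R * e1 + e2 + e3 - t / N.+1%:R * (e1 + e4) = e2 + (e3 - t / N.+1%:R * e4).
  by ring.
apply: le_trans (ler_normD _ _) _; apply: lerD H3.
rewrite -ExZ; last exact: brv_norm.
apply: le_norm_Ex => [||x]; [exact: brvM|by apply: brvZ; exact: brv_norm|].
rewrite !normrM ler_wpM2r//.
by apply: le_trans (_ : 1 * C <= _); [apply: ler_pM => //; exact: gC|rewrite mul1r].
Qed.

End Moments.

(** * Elementary Taylor estimates *)

Section Taylor.
Variable R : realType.
Implicit Types x : R.

Lemma ge0_of_derive (f df : R -> R) x : 0 <= x ->
  (forall y : R, is_derive y (1 : R) f (df y)) -> (forall y, 0 <= y -> 0 <= df y) ->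
  f 0 = 0 -> 0 <= f x.
Proof.
move=> x0 Df df0 f0.
have [|c] := @MVT_segment R f df 0 x x0 (fun y _ => Df y).
  apply: derivable_within_continuous => y _.
  by case: (Df y).
rewrite in_itv/= => /andP[c0 _]; rewrite f0 !subr0 => ->.
by rewrite mulr_ge0// df0.
Qed.

(** Each inequality follows from an earlier one by integration from 0. *)
Lemma sin_ge_cubic x : 0 <= x ->
  [/\ sin x <= x, 1 - x ^+ 2 / 2 <= cos x, x - x ^+ 3 / 6 <= sin x,
      cos x <= 1 - x ^+ 2 / 2 + x ^+ 4 / 24
    & sin x <= x - x ^+ 3 / 6 + x ^+ 5 / 120].
Proof.
have s1 (y : R) : 0 <= y -> sin y <= y :> R.
  move=> y0; rewrite -subr_ge0.
  apply: (@ge0_of_derive (fun z : R => z - sin z) (fun z : R => 1 - cos z)) => //.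
  by rewrite sin0 subrr.
have c2 (y : R) : 0 <= y -> 1 - y ^+ 2 / 2 <= cos y :> R.
  move=> y0; rewrite -subr_ge0.
  apply: (@ge0_of_derive (fun z : R => cos z - (1 - z ^+ 2 / 2)) (fun z : R => z - sin z)) => //.
  - move=> z; apply: is_derive_eq; rewrite /GRing.scale/=; by field.
  - by move=> z /s1; rewrite subr_ge0.
  - by rewrite cos0; ring.
have s3 (y : R) : 0 <= y -> y - y ^+ 3 / 6 <= sin y :> R.
  move=> y0; rewrite -subr_ge0.
  apply: (@ge0_of_derive (fun z : R => sin z - (z - z ^+ 3 / 6)) (fun z : R => cos z - (1 - z ^+ 2 / 2))) => //.
  - move=> z; apply: is_derive_eq; rewrite /GRing.scale/=; by field.
  - by move=> z /c2; rewrite subr_ge0.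
  - by rewrite sin0; ring.
have c4 (y : R) : 0 <= y -> cos y <= 1 - y ^+ 2 / 2 + y ^+ 4 / 24 :> R.
  move=> y0; rewrite -subr_ge0.
  apply: (@ge0_of_derive (fun z : R => 1 - z ^+ 2 / 2 + z ^+ 4 / 24 - cos z) (fun z : R => sin z - (z - z ^+ 3 / 6))) => //.
  - move=> z; apply: is_derive_eq; rewrite /GRing.scale/=; by field.
  - by move=> z /s3; rewrite subr_ge0.
  - by rewrite cos0; ring.
move=> x0; split; [exact: s1|exact: c2|exact: s3|exact: c4|].
rewrite -subr_ge0.
apply: (@ge0_of_derive (fun z : R => z - z ^+ 3 / 6 + z ^+ 5 / 120 - sin z)
  (fun z : R => 1 - z ^+ 2 / 2 + z ^+ 4 / 24 - cos z)) => //.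
- move=> z; apply: is_derive_eq; rewrite /GRing.scale/=; by field.
- by move=> z /c4; rewrite subr_ge0.
- by rewrite sin0; ring.
Qed.

Lemma cos_taylor x : `|cos x - (1 - x ^+ 2 / 2)| <= 3 * x ^+ 4.
Proof.
wlog x0 : x / 0 <= x.
  move=> h; have [|x0] := leP 0 x; first exact: h.
  have := h (- x); rewrite cosN => H.
  have e1 : 1 - (- x) ^+ 2 / 2 = 1 - x ^+ 2 / 2 by rewrite sqrrN.
  have e2 : (- x) ^+ 4 = x ^+ 4 by ring.
  by rewrite e1 e2 in H; apply: H; rewrite oppr_ge0 ltW.
have [_ c2 _ c4 _] := sin_ge_cubic x0.
have x4 : 0 <= x ^+ 4 by exact: exprn_ge0.
by rewrite ler_norml; apply/andP; split; lra.
Qed.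

(** The remainder is given the even exponent 4, so that no absolute moment of odd order is needed;
    for x > 1 the bound on the cubic term already suffices. *)
Lemma sin_taylor x : `|sin x - (x - x ^+ 3 / 6)| <= 3 * x ^+ 4.
Proof.
wlog x0 : x / 0 <= x.
  move=> h; have [|x0] := leP 0 x; first exact: h.
  have := h (- x); rewrite sinN => H.
  have e1 : - sin x - (- x - (- x) ^+ 3 / 6) = - (sin x - (x - x ^+ 3 / 6)) by ring.
  have e2 : (- x) ^+ 4 = x ^+ 4 by ring.
  by rewrite e1 e2 normrN in H; apply: H; rewrite oppr_ge0 ltW.
have [s1 _ s3 _ s5] := sin_ge_cubic x0.
have x4 : 0 <= x ^+ 4 by exact: exprn_ge0.
rewrite ler_norml; apply/andP; split; first by lra.
have [x1|x1] := leP x 1.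
  suff : x ^+ 5 <= x ^+ 4 by lra.
  by rewrite exprSr ler_piMr.
suff : x ^+ 3 <= x ^+ 4 by lra.
by rewrite [leRHS]exprSr ler_peMr ?exprn_ge0// ltW.
Qed.

Lemma expRN_taylor x : 0 <= x -> `|expR (- x) - (1 - x)| <= x ^+ 2.
Proof.
move=> x0; have h1 := expR_ge1Dx (- x).
have h2 : expR (- x) <= (1 + x)^-1.
  by rewrite expRN lef_pV2 ?posrE ?expR_gt0 ?ltr_wpDr// expR_ge1Dx.
have h3 : (1 + x)^-1 <= 1 - x + x ^+ 2.
  rewrite -div1r ler_pdivrMr ?ltr_wpDr//.
  have : 0 <= x ^+ 3 by exact: exprn_ge0.
  rewrite (_ : (1 - x + x ^+ 2) * (1 + x) = 1 + x ^+ 3); last by ring.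
  by lra.
by rewrite ger0_norm; lra.
Qed.

End Taylor.

(** * The characteristic function along a subdivision *)

Section Chain.
Variables (R : realType) (d : measure_display) (T : measurableType d).
Variables (P : probability T R) (n : nat).
Local Notation V := 'M[R]_(n, 4).
Variable w : R -> T -> V.
Hypothesis hw : brownian_motion_HHn P w 0.
Variables (a b : R).
Hypotheses (ab : a < b) (b1 : b < 1).
Variable t : R.
Hypothesis t0 : 0 < t.
Variables (l : R * R * R) (ph : R).
Local Notation chi := (@cutoff R n a b).
Local Notation tk := (grid t).
Local Notation wk N k x := (w (grid t N k) x).

Definition below (v : R) : R := \1_[set z | z < a] v.

(* Indicator that the walk has stayed in [|w|^2 < a] up to step [k]. *)
Definition theta N k x : R := \prod_(j < k.+1) below (hnorm2 (wk N j x)).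

(** A step may start inside |z|^2 < a and end outside, so the end point needs a cutoff of its own,
    independent of [theta]. *)
Definition phi (z y : V) : R := psi a b l z y * chi y.

Let g0 N k : 0 <= tk N k. Proof. exact: grid_ge0. Qed.

Lemma belowE v : below v = ((v < a)%R : nat)%:R.
Proof.
rewrite /below indicE; congr (nat_of_bool _)%:R.
by apply/idP/idP => [/set_mem//|va]; apply: mem_set.
Qed.

Lemma thetaE N k x : theta N k x = ([forall j : 'I_k.+1, hnorm2 (wk N j x) < a] : nat)%:R.
Proof.
rewrite /theta; case: (boolP [forall j : 'I_k.+1, hnorm2 (wk N j x) < a]) => [/forallP h|].
  by rewrite big1// => j _; rewrite belowE h.
rewrite negb_forall => /existsP[j /negbTE hj].
by rewrite (bigD1 j)//= belowE hj mul0r.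
Qed.

Lemma thetaX N k x m : theta N k x ^+ m.+1 = theta N k x.
Proof. by rewrite thetaE; case: [forall j : 'I_k.+1, hnorm2 (wk N j x) < a]; rewrite ?expr1n// expr0n. Qed.

Lemma theta_ge0 N k x : 0 <= theta N k x.
Proof. by rewrite thetaE. Qed.

Lemma theta_le1 N k x : theta N k x <= 1.
Proof. by rewrite thetaE; case: [forall j : 'I_k.+1, hnorm2 (wk N j x) < a]. Qed.

Lemma theta_lt N k x : theta N k x != 0 -> hnorm2 (wk N k x) < a.
Proof.
rewrite thetaE; case: (boolP [forall j : 'I_k.+1, hnorm2 (wk N j x) < a]) => [/forallP h _|]; last by rewrite eqxx.
exact: (h ord_max).
Qed.

Lemma measurable_below : measurable_fun setT below.
Proof.
by apply: measurable_indic; rewrite (_ : [set z | z < a] = `]-oo, a[%classic).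
Qed.

Lemma Fmeas_theta N k : Fmeas w (tk N k) (theta N k).
Proof.
apply: measurable_prod => j _.
apply: (measurableT_comp measurable_below); apply: Fmeas_nice; last exact: nice_hnorm2.
by rewrite g0; apply: grid_mono => //; rewrite -ltnS.
Qed.

Lemma brv_theta N k : brv (theta N k).
Proof.
split; first exact: (Fmeas_measurable hw (@Fmeas_theta N k)).
by exists 1 => x; rewrite ger0_norm ?theta_ge0// theta_le1.
Qed.

Lemma sep_phi : sep phi.
Proof. by apply: sepM; [exact: sep_psi|apply: sep_r; exact: nice_cutoff]. Qed.

Lemma sep_Fmeas F s u r : sep F -> 0 <= s <= r -> 0 <= u <= r ->
  Fmeas w r (fun x => F (w s x) (w u x)).
Proof.
move=> sF sr ur; elim: sF => [|{}F g f ng nf _ ih]; first exact: measurable_cst.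
by apply: measurable_funD ih; apply: measurable_funM; apply: Fmeas_nice.
Qed.

Lemma brv_phi N k : brv (fun x => phi (wk N k x) (wk N k.+1 x)).
Proof. exact: (sep_brv hw sep_phi). Qed.

Lemma phi_moment m : (0 < m)%N -> exists2 r, vanishing r &
  forall N k G, Fmeas w (tk N k) G -> (forall x, `|G x| <= 1) ->
  `| Ex P (fun x => G x * (theta N k x * phi (wk N k x) (wk N k.+1 x) ^+ m))
     - (m == 2)%:R * (t / N.+1%:R * (nsq l *
         Ex P (fun x => G x * (theta N k x * hnorm2 (wk N k x))))) | <= r N k.
Proof.
move=> m0.
have nchi := @nice_cutoff R n a b ab.
(* One power of the cutoff is left out because [sep_moment] supplies it. *)
have sF : sep (fun z y => psi a b l z y ^+ m * chi y ^+ m.-1).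
  by apply: sepM; [apply: sepX; exact: sep_psi|apply: sep_r; exact: nice_exp].
have [r vr H] := sep_moment hw ab b1 t0 sF; exists r => // N k G FG G1.
have FGt : Fmeas w (tk N k) (fun x => G x * theta N k x).
  by apply: measurable_funM FG _; exact: Fmeas_theta.
have E0 z y : psi a b l z y ^+ m * chi y ^+ m.-1 * chi y = phi z y ^+ m.
  by rewrite -mulrA -exprSr prednK// -exprMn.
have := H N k (fun x => G x * theta N k x) FGt.
have -> : (fun x => G x * theta N k x *
   (psi a b l (wk N k x) (wk N k.+1 x) ^+ m * chi (wk N k.+1 x) ^+ m.-1 * chi (wk N k.+1 x) -
    psi a b l (wk N k x) (wk N k x) ^+ m * chi (wk N k x) ^+ m.-1 * chi (wk N k x))) =
   (fun x => G x * (theta N k x * phi (wk N k x) (wk N k.+1 x) ^+ m)).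
  apply/funext => x; rewrite !E0 [X in _ - X](_ : _ = 0) ?subr0 ?mulrA//.
  by rewrite /phi psi_diag mul0r expr0n gtn_eqF.
have -> : (fun x => G x * theta N k x * gen (fun y => psi a b l (wk N k x) y ^+ m *
    chi y ^+ m.-1 * chi y) (wk N k x)) =
   (fun x => ((m == 2)%:R * nsq l) * (G x * (theta N k x * hnorm2 (wk N k x)))).
  apply/funext => x; have [->|th] := eqVneq (theta N k x) 0; first by rewrite !(mul0r,mulr0).
  rewrite /gen; under eq_fun do rewrite E0.
  by rewrite lap_psi_exp_cutoff ?theta_lt//; field.
have bq : brv (fun x => G x * (theta N k x * hnorm2 (wk N k x))).
  apply: brvM; first by split; [exact: (Fmeas_measurable hw FG)|by exists 1].
  apply: brvM; first exact: brv_theta.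
  by exact: (nice_brv hw (g0 N k) nice_hnorm2).
rewrite ExZ// => H1.
have -> : (m == 2)%:R * (t / N.+1%:R * (nsq l * Ex P (fun x => G x * (theta N k x * hnorm2 (wk N k x))))) =
  t / N.+1%:R * ((m == 2)%:R * nsq l * Ex P (fun x => G x * (theta N k x * hnorm2 (wk N k x)))).
  by ring.
apply: H1 => x; rewrite normrM -[leRHS]mulr1 ler_pM//.
by rewrite ger0_norm ?theta_ge0// theta_le1.
Qed.

Definition incr N k x : R := (Num.sqrt t)^-1 * (theta N k x * phi (wk N k x) (wk N k.+1 x)).

Definition walk N k x : R := ph + \sum_(j < k) incr N j x.

Lemma walkS N k x : walk N k.+1 x = walk N k x + incr N k x.
Proof. by rewrite /walk big_ord_recr/= addrA. Qed.

Lemma brv_incr N k : brv (incr N k).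
Proof. by apply: brvZ; apply: brvM; [exact: brv_theta|exact: brv_phi]. Qed.

Lemma Fmeas_walk N k : Fmeas w (tk N k) (walk N k).
Proof.
apply: measurable_funD; first exact: measurable_cst.
apply: measurable_sum => j; apply: measurable_funM; first exact: measurable_cst.
have jk : tk N j.+1 <= tk N k by exact: grid_mono.
apply: measurable_funM.
  by apply: Fmeas_mono (@Fmeas_theta N j); rewrite (le_trans _ jk)// grid_leS.
apply: sep_Fmeas; [exact: sep_phi| |by rewrite g0].
by rewrite g0 (le_trans _ jk)// grid_leS.
Qed.

Lemma measurable_walk N k : measurable_fun setT (walk N k).
Proof. exact: (Fmeas_measurable hw (@Fmeas_walk N k)). Qed.

Lemma Fmeas_cont (g : R -> R) s X : continuous g -> Fmeas w s X -> Fmeas w s (g \o X).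
Proof. by move=> cg; apply: measurableT_comp; exact: continuous_measurable_fun. Qed.

(** Half the limiting variance rate of the walk: by [phi_moment], a step of length h before the exit
    has conditional second moment close to 2 kap h |w|^2. Over all steps kap t = |l|^2 / 2. *)
Definition kap : R := nsq l / (2 * t).

Lemma nsq_ge0 : 0 <= nsq l.
Proof. by rewrite !addr_ge0// sqr_ge0. Qed.

Lemma kap_ge0 : 0 <= kap.
Proof. by rewrite divr_ge0 ?nsq_ge0// mulr_ge0// ltW. Qed.

Lemma cos_step N k x :
  `|cos (walk N k.+1 x) - (cos (walk N k x) * (1 - incr N k x ^+ 2 / 2)
      - sin (walk N k x) * (incr N k x - incr N k x ^+ 3 / 6))| <= 6 * incr N k x ^+ 4.
Proof.
rewrite walkS cosD; set s := walk N k x; set y := incr N k x.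
have -> : cos s * cos y - sin s * sin y - (cos s * (1 - y ^+ 2 / 2) - sin s * (y - y ^+ 3 / 6)) =
   cos s * (cos y - (1 - y ^+ 2 / 2)) - sin s * (sin y - (y - y ^+ 3 / 6)) by ring.
rewrite (le_trans (ler_normB _ _))// !normrM.
have -> : 6 * y ^+ 4 = 1 * (3 * y ^+ 4) + 1 * (3 * y ^+ 4) by ring.
apply: lerD; apply: ler_pM => //.
- exact: cos_max.
- exact: cos_taylor.
- exact: sin_max.
- exact: sin_taylor.
Qed.

(** In the expansion of [cos_step] the second moment gives the main term, the first and third
    moments are errors, and the fourth bounds the remainder. *)
Lemma Ex_cos_step : exists2 rho, vanishing rho & forall N k,
  `|Ex P (fun x => cos (walk N k.+1 x)) - (Ex P (fun x => cos (walk N k x)) -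
     kap * (t / N.+1%:R) * Ex P (fun x => cos (walk N k x) * (theta N k x * hnorm2 (wk N k x))))|
  <= rho N k.
Proof.
have [r1 v1 H1] := @phi_moment 1 isT; have [r2 v2 H2] := @phi_moment 2 isT.
have [r3 v3 H3] := @phi_moment 3 isT; have [r4 v4 H4] := @phi_moment 4 isT.
pose c := (Num.sqrt t)^-1.
have c0 : 0 <= c by rewrite invr_ge0 sqrtr_ge0.
have c2 : c ^+ 2 = t^-1 by rewrite exprVn sqr_sqrtr// ltW.
exists (fun N k => c ^+ 2 / 2 * r2 N k + (c * r1 N k + (c ^+ 3 / 6 * r3 N k + 6 * c ^+ 4 * r4 N k))).
  have h (z : R) : 0 <= z -> 0 <= z / 2 /\ 0 <= z / 6 by move=> z0; rewrite !divr_ge0.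
  apply: vanishingD; first by apply: vanishingZ => //; apply h; exact: exprn_ge0.
  apply: vanishingD; first exact: vanishingZ.
  apply: vanishingD; first by apply: vanishingZ => //; apply h; exact: exprn_ge0.
  by apply: vanishingZ => //; rewrite mulr_ge0// exprn_ge0.
move=> N k.
have bi := brv_incr N k.
have mw := @measurable_walk N k.
have bc := brv_cos mw; have bs := brv_sin mw.
have bt := brv_theta N k.
have bp m : brv (fun x => theta N k x * phi (wk N k x) (wk N k.+1 x) ^+ m).
  by apply: brvM => //; apply: brvX; exact: brv_phi.
have iX m x : incr N k x ^+ m.+1 =
    c ^+ m.+1 * (theta N k x * phi (wk N k x) (wk N k.+1 x) ^+ m.+1).
  by rewrite /incr !exprMn thetaX.
have i1 x : incr N k x = c * (theta N k x * phi (wk N k x) (wk N k.+1 x) ^+ 1).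
  by rewrite expr1.
have Fc : Fmeas w (tk N k) (fun x => cos (walk N k x)).
  by apply: Fmeas_cont (@Fmeas_walk N k); exact: continuous_cos.
have Fs : Fmeas w (tk N k) (fun x => sin (walk N k x)).
  by apply: Fmeas_cont (@Fmeas_walk N k); exact: continuous_sin.
have F1 : Fmeas w (tk N k) (fun=> 1) by exact: measurable_cst.
have G1 := H1 N k _ Fs (fun x => sin_max _).
have G2 := H2 N k _ Fc (fun x => cos_max _).
have G3 := H3 N k _ Fs (fun x => sin_max _).
have G4 := H4 N k (fun=> 1) F1 (fun x => eq_ler (normr1 R)).
rewrite /= mul0r subr0 in G1; rewrite /= mul1r in G2.
rewrite /= mul0r subr0 in G3; rewrite /= mul0r subr0 in G4.
set e1 := Ex P _ in G1; set e2 := Ex P _ in G2; set q2 := Ex P _ in G2.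
set e3 := Ex P _ in G3; set e4 := Ex P _ in G4.
have main : `|Ex P (fun x => cos (walk N k.+1 x)) - (Ex P (fun x => cos (walk N k x))
    - c ^+ 2 / 2 * e2 - c * e1 + c ^+ 3 / 6 * e3)| <= 6 * c ^+ 4 * e4.
  have -> : 6 * c ^+ 4 * e4 = Ex P (fun x => 6 * incr N k x ^+ 4).
    rewrite /e4 -ExZ; last by apply: brvM; [exact: brv_cst|exact: bp].
    by congr (Ex P _); apply/funext => x; rewrite iX; ring.
  have b1' : brv (fun x => sin (walk N k x) * (theta N k x * phi (wk N k x) (wk N k.+1 x) ^+ 1)).
    by apply: brvM.
  have b2' : brv (fun x => cos (walk N k x) * (theta N k x * phi (wk N k x) (wk N k.+1 x) ^+ 2)).
    by apply: brvM.
  have b3' : brv (fun x => sin (walk N k x) * (theta N k x * phi (wk N k x) (wk N k.+1 x) ^+ 3)).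
    by apply: brvM.
  have bw1 := brv_cos (@measurable_walk N k.+1).
  have -> : Ex P (fun x => cos (walk N k.+1 x)) - (Ex P (fun x => cos (walk N k x))
    - c ^+ 2 / 2 * e2 - c * e1 + c ^+ 3 / 6 * e3) =
    Ex P (fun x => cos (walk N k.+1 x) - (cos (walk N k x) * (1 - incr N k x ^+ 2 / 2)
      - sin (walk N k x) * (incr N k x - incr N k x ^+ 3 / 6))).
    rewrite /e1 /e2 /e3 -!ExZ// -!ExB//; try (by apply: brvZ); last by apply: brvB => //; apply: brvZ.
    rewrite -ExD//; [|by do 2 (apply: brvB; last exact: brvZ)|exact: brvZ].
    rewrite -ExB//; last by apply: brvD; [do 2 (apply: brvB; last exact: brvZ)|exact: brvZ].
    by congr (Ex P _); apply/funext => x; rewrite !iX (i1 x); ring.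
  have bi2 := brvX 2 bi; have bi3 := brvX 3 bi; have bi4 := brvX 4 bi.
  apply: le_norm_Ex => [||x]; [|exact: brvZ|exact: cos_step].
  apply: brvB => //; apply: brvB; apply: brvM => //; apply: brvB => //; try exact: brv_cst.
    by apply: brvM => //; exact: brv_cst.
  by apply: brvM => //; exact: brv_cst.
set u' := Ex P _ in main *; set u := Ex P (fun x => cos (walk N k x)) in main *.
have kE : kap * (t / N.+1%:R) * q2 = c ^+ 2 / 2 * (t / N.+1%:R * (nsq l * q2)).
  by rewrite c2 /kap; field; rewrite !gt_eqF.
rewrite kE.
have -> : u' - (u - c ^+ 2 / 2 * (t / N.+1%:R * (nsq l * q2))) =
  (u' - (u - c ^+ 2 / 2 * e2 - c * e1 + c ^+ 3 / 6 * e3)) +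
  (- (c ^+ 2 / 2 * (e2 - t / N.+1%:R * (nsq l * q2))) + (- (c * e1) + c ^+ 3 / 6 * e3)) by ring.
have D (x y p q : R) : `|x| <= p -> `|y| <= q -> `|x + y| <= p + q.
  by move=> xp yq; rewrite (le_trans (ler_normD _ _))// lerD.
have Z (z x p : R) : 0 <= z -> `|x| <= p -> `|z * x| <= z * p.
  by move=> z0 xp; rewrite normrM (ger0_norm z0) ler_wpM2l.
have c3 : 0 <= c ^+ 3 by exact: exprn_ge0.
have c4 : 0 <= c ^+ 4 by exact: exprn_ge0.
rewrite [leRHS](_ : _ = 6 * c ^+ 4 * r4 N k + (c ^+ 2 / 2 * r2 N k + (c * r1 N k + c ^+ 3 / 6 * r3 N k))); last by ring.
apply: (D).
  apply: le_trans main _; rewrite ler_wpM2l ?mulr_ge0//.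
  exact: le_trans (ler_norm _) G4.
apply: (D); first by rewrite normrN; apply: (Z) => //; rewrite divr_ge0// sqr_ge0.
by apply: (D); [rewrite normrN; apply: (Z)|apply: (Z) => //; rewrite divr_ge0].
Qed.

(** Measures how far step [k] is from having the full limiting variance, either because the path has
    left the ball or because |w|^2 < 1. *)
Definition defect N k : R := Ex P (fun x => 1 - theta N k x * hnorm2 (wk N k x)).

Lemma brv_theta_hnorm2 N k : brv (fun x => theta N k x * hnorm2 (wk N k x)).
Proof.
by apply: brvM; [exact: brv_theta|exact: (nice_brv hw (g0 N k) nice_hnorm2)].
Qed.

Lemma theta_hnorm2_le1 N k x : 0 <= theta N k x * hnorm2 (wk N k x) <= 1.
Proof.
rewrite mulr_ge0 ?theta_ge0 ?hnorm2_ge0//= -[leRHS]mulr1 ler_pM ?theta_ge0 ?hnorm2_ge0 ?theta_le1//.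
exact: ltW (bm_HHn hw x (g0 N k)).
Qed.

(** Induction on the steps, comparing with exp (- y m) cos ph where y = kap h. As exp (- y) <= 1,
    errors of earlier steps are not amplified and simply add up. *)
Lemma chain_bound : exists2 rho, vanishing rho & forall N,
  `|Ex P (fun x => cos (walk N N.+1 x)) - expR (- (nsq l / 2)) * cos ph| <=
  \sum_(k < N.+1) (kap * (t / N.+1%:R) * defect N k + (kap * (t / N.+1%:R)) ^+ 2 + rho N k).
Proof.
have [rho vr H] := Ex_cos_step; exists rho => // N.
set y := kap * (t / N.+1%:R).
have y0 : 0 <= y by rewrite mulr_ge0 ?kap_ge0// divr_ge0// ltW.
have -> : - (nsq l / 2) = - (y * N.+1%:R).
  by rewrite /y /kap; field; rewrite !gt_eqF.
elim: N.+1 => [|m ih].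
  rewrite big_ord0 mulr0 oppr0 expR0 mul1r.
  have -> : (fun x => cos (walk N 0 x)) = fun=> cos ph.
    by apply/funext => x; rewrite /walk big_ord0 addr0.
  by rewrite Ex_cst subrr normr0.
rewrite big_ord_recr/=.
have bc := brv_cos (@measurable_walk N m).
have bth := brv_theta_hnorm2 N m.
set u := Ex P (fun x => cos (walk N m x)) in ih *.
set u' := Ex P (fun x => cos (walk N m.+1 x)).
set C := Ex P (fun x => cos (walk N m x) * (theta N m x * hnorm2 (wk N m x))).
have Hm : `|u' - (u - y * C)| <= rho N m by exact: H.
have uC : `|u - C| <= defect N m.
  rewrite /u /C -ExB//; last exact: brvM.
  have b1' : brv (fun x => 1 - theta N m x * hnorm2 (wk N m x)).
    by apply: brvB => //; exact: brv_cst.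
  apply: le_norm_Ex => // [|x]; first by apply: brvB => //; exact: brvM.
  rewrite -{1}[cos _]mulr1 -mulrBr normrM -[leRHS]mul1r.
  have /andP[h0 h1] := theta_hnorm2_le1 N m x.
  rewrite ler_pM ?cos_max//.
  by rewrite ger0_norm ?lexx ?subr_ge0.
have u1 : `|u| <= 1 by apply: norm_Ex_le => // x; exact: cos_max.
have -> : - (y * m.+1%:R) = - y + - (y * m%:R) by rewrite -natr1; ring.
rewrite expRD.
(* Respectively: the inherited error, the replacement of [theta] |w|^2 by 1, that of 1 - y by exp (-
   y), and the error of the step. *)
have -> : u' - expR (- y) * expR (- (y * m%:R)) * cos ph =
  (expR (- y) * (u - expR (- (y * m%:R)) * cos ph)) +
  (y * (u - C) + - ((expR (- y) - (1 - y)) * u) + (u' - (u - y * C))) by ring.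
have ey1 : `|expR (- y)| <= 1 by rewrite ger0_norm ?expR_ge0// expR_le1 oppr_le0.
apply: le_trans (ler_normD _ _) _; apply: lerD.
  by rewrite normrM -[leRHS]mul1r ler_pM.
apply: le_trans (ler_normD _ _) _; apply: lerD => //.
apply: le_trans (ler_normD _ _) _; apply: lerD.
  by rewrite normrM (ger0_norm y0) ler_wpM2l.
by rewrite normrN normrM -[leRHS]mulr1 ler_pM// expRN_taylor.
Qed.

(** The switch [th] can only go from 1 to 0, so the sum is the increment of [f] up to the stopping
    index. *)
Lemma stopped_telescope (th f : nat -> R) (m : nat) :
  (forall k, th k = 0 \/ th k = 1) -> (forall k, th k.+1 = 1 -> th k = 1) ->
  (forall k, 0 <= f k <= 1) -> \sum_(k < m) th k * (f k.+1 - f k) <= 1.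
Proof.
move=> th01 thS f01.
have f1 k : f k <= 1 by case/andP: (f01 k).
have f0 k : 0 <= f k by case/andP: (f01 k).
case: m => [|m]; first by rewrite big_ord0.
(* Invariant for the induction: while the switch is on, the sum is bounded by the current value of
   [f]. *)
suff [] : \sum_(k < m.+1) th k * (f k.+1 - f k) <= 1 /\
   (th m = 1 -> \sum_(k < m.+1) th k * (f k.+1 - f k) <= f m.+1) by [].
elim: m => [|m [ih1 ih2]].
  rewrite big_ord1; case: (th01 0%N) => -> /=; rewrite ?mul0r ?mul1r.
    by split=> // /eqP; rewrite eq_sym oner_eq0.
  by have := f1 1%N; have := f0 0%N; split=> [|_]; lra.
rewrite big_ord_recr/=; case: (th01 m.+1) => h; rewrite h ?mul0r ?mul1r ?addr0.
  by split=> // /eqP; rewrite eq_sym oner_eq0.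
have := ih2 (thS _ h); have := f1 m.+2.
by split=> [|_]; lra.
Qed.

Hypothesis n1 : (0 < n)%N.

(** A discrete Dynkin formula for |w|^2 up to the exit: its generator is 4n (1 - |w|^2), while the
    stopped increments of a function with values in [0, 1] sum to at most 1. *)
Lemma escape_bound : exists2 r, vanishing r & forall N,
  \sum_(k < N.+1) t / N.+1%:R * Ex P (fun x => theta N k x * (1 - hnorm2 (wk N k x)))
  <= (1 + \sum_(k < N.+1) r N k) / (4 * n%:R).
Proof.
have nchi := @nice_cutoff R n a b ab.
have [r vr H] := sep_moment hw ab b1 t0 (sep_r (@nice_hnorm2 R n)).
exists r => // N.
have n0 : (0 : R) < 4 * n%:R by rewrite mulr_gt0 ?ltr0n.
pose f k x := hnorm2 (wk N k x) * chi (wk N k x).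
have bf k : brv (f k).
  by apply: brvM; [exact: (nice_brv hw (g0 N k) nice_hnorm2)|exact: (nice_brv hw (g0 N k) nchi)].
have bt k : brv (fun x => theta N k x * (1 - hnorm2 (wk N k x))).
  apply: brvM; first exact: brv_theta.
  by apply: brvB; [exact: brv_cst|exact: (nice_brv hw (g0 N k) nice_hnorm2)].
have bd k : brv (fun x => theta N k x * (f k.+1 x - f k x)).
  by apply: brvM; [exact: brv_theta|exact: brvB].
rewrite ler_pdivlMr// mulr_suml.
apply: (@le_trans _ _ (\sum_(k < N.+1) (Ex P (fun x => theta N k x * (f k.+1 x - f k x)) + r N k))).
  apply: ler_sum => k _.
  have := H N k (theta N k) (@Fmeas_theta N k).
  have -> : (fun x => theta N k x * gen (fun y => hnorm2 y * chi y) (wk N k x)) =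
     (fun x => (4 * n%:R) * (theta N k x * (1 - hnorm2 (wk N k x)))).
    apply/funext => x; have [->|th] := eqVneq (theta N k x) 0; first by rewrite !(mul0r,mulr0).
    by rewrite /gen lap_hnorm2_cutoff ?theta_lt//; field.
  rewrite ExZ// => /(_ _)/wrap[] => [x|].
    by rewrite ger0_norm ?theta_ge0// theta_le1.
  set e2 := Ex P (fun x => theta N k x * (1 - _)).
  rewrite ler_norml => /andP[h1 _].
  have h2 : t / N.+1%:R * e2 * (4 * n%:R) = t / N.+1%:R * (4 * n%:R * e2) by ring.
  rewrite h2; move: h1; rewrite lerNl opprB lerBlDr addrC; exact.
rewrite big_split lerD2r -Ex_sum// -(Ex_cst P 1).
apply: le_Ex => [||x]; [exact: brv_sum|exact: brv_cst|].
apply: (@stopped_telescope (fun k => theta N k x) (fun k => f k x)) => k.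
- by rewrite thetaE; case: [forall j : 'I_k.+1, hnorm2 (wk N j x) < a]; [right|left].
- rewrite {1}/theta big_ord_recr/= -/(theta N k x) => h.
  move: h; rewrite thetaE; case: [forall j : 'I_k.+1, hnorm2 (wk N j x) < a] => //.
  by rewrite mul0r => /eqP; rewrite eq_sym oner_eq0.
- have q0 := hnorm2_ge0 (wk N k x); have q1 := ltW (bm_HHn hw x (g0 N k)).
  have c0 := cutoff_ge0 ab (wk N k x); have c1 := cutoff_le1 ab (wk N k x).
  by rewrite mulr_ge0//= -[leRHS]mulr1 ler_pM.
Qed.

(* Outside of this event the path stays in [|w|^2 < a] at all rational multiples of [t]. *)
Definition exits : set T :=
  \bigcup_N \bigcup_(k in [set k | (k <= N.+1)%N]) [set x | a <= hnorm2 (wk N k x)].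

Lemma measurable_exits : measurable exits.
Proof.
apply: bigcupT_measurable => N; apply: bigcup_measurable => k _.
have := nice_bm_measurable hw (g0 N k) (@nice_hnorm2 R n).
move=> /(_ measurableT `[a, +oo[%classic (measurable_itv _)); rewrite setTI.
by congr (measurable _); apply/seteqP; split=> x /=; rewrite in_itv/= andbT.
Qed.

Lemma not_exits N k x : ~ exits x -> (k <= N.+1)%N -> hnorm2 (wk N k x) < a.
Proof.
by move=> nx kN; rewrite ltNge; apply/negP => h; apply: nx; exists N => //; exists k.
Qed.

Lemma theta_not_exits N k x : ~ exits x -> (k <= N.+1)%N -> theta N k x = 1.
Proof.
move=> nx kN; rewrite thetaE (_ : [forall j, _] = true)//.
apply/forallP => j; apply: not_exits => //.
by rewrite (leq_trans _ kN)// -ltnS.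
Qed.

Definition pexit : R := Ex P (\1_exits : T -> R).

(** Pointwise, 1 - theta |w|^2 is at most the indicator of the exit event plus theta (1 - |w|^2),
    since theta = 1 off that event. *)
Lemma sum_defect_le : exists2 r, vanishing r & forall N,
  \sum_(k < N.+1) t / N.+1%:R * defect N k <= t * pexit + (1 + \sum_(k < N.+1) r N k) / (4 * n%:R).
Proof.
have [r vr H] := escape_bound; exists r => // N.
have bind := brv_indic R measurable_exits.
have hN : 0 <= t / N.+1%:R by rewrite divr_ge0// ltW.
apply: le_trans (_ : \sum_(k < N.+1) (t / N.+1%:R * pexit + t / N.+1%:R *
   Ex P (fun x => theta N k x * (1 - hnorm2 (wk N k x)))) <= _).
  apply: ler_sum => k _; rewrite -mulrDr ler_wpM2l//.
  have bt : brv (fun x => theta N k x * (1 - hnorm2 (wk N k x))).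
    apply: brvM; first exact: brv_theta.
    by apply: brvB; [exact: brv_cst|exact: (nice_brv hw (g0 N k) nice_hnorm2)].
  rewrite /pexit -ExD//; apply: le_Ex => [||x]; last 1 first.
  - rewrite indicE; case: (boolP (x \in exits)) => [_|/negP nx].
      have := theta_le1 N k x; rewrite /= mulrBr mulr1.
      by have := theta_ge0 N k x; lra.
    rewrite theta_not_exits ?(ltnW (ltn_ord k))//; last by move=> h; apply: nx; exact: mem_set.
    by rewrite /= !mul1r add0r.
  - by apply: brvB; [exact: brv_cst|exact: brv_theta_hnorm2].
  - exact: brvD.
rewrite big_split/= sumr_const card_ord; apply: lerD; last exact: H.
by rewrite -mulr_natr; apply: eq_ler; field.
Qed.

Lemma walk_cos_near (e : R) : 0 < e -> \forall N \near \oo,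
  `|Ex P (fun x => cos (walk N N.+1 x)) - expR (- (nsq l / 2)) * cos ph| <=
  kap * (t * pexit + (4 * n%:R)^-1) + e.
Proof.
move=> e0; have [rho [rho0 vrho] H] := chain_bound.
have [r [r0 vr] Hr] := sum_defect_le.
have n0 : (0 : R) < 4 * n%:R by rewrite mulr_gt0 ?ltr0n.
(* All errors that disappear with the mesh; the middle one is the sum of the squares (kap h)^2. *)
pose E N := kap / (4 * n%:R) * \sum_(k < N.+1) r N k + (kap * t) ^+ 2 * N.+1%:R^-1 + \sum_(k < N.+1) rho N k.
have cE : E N @[N --> \oo] --> 0.
  have h1 := @cvgMl_tmp _ _ _ _ _ (kap / (4 * n%:R)) _ vr.
  have h2 := @cvgMl_tmp _ _ _ _ _ ((kap * t) ^+ 2) _ (@cvg_harmonic R).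
  have := cvgD (cvgD (h1 _) (h2 _)) vrho.
  by rewrite !mulr0 !addr0; apply.
near=> N.
have EN : E N <= e.
  apply: le_trans (ler_norm _) _; near: N; move/cvgr0Pnorm_le : cE; exact.
apply: le_trans (H N) _; rewrite !big_split/= sumr_const card_ord.
have -> : \sum_(k < N.+1) kap * (t / N.+1%:R) * defect N k =
    kap * \sum_(k < N.+1) t / N.+1%:R * defect N k.
  by rewrite mulr_sumr; apply: eq_bigr => k _; rewrite -!mulrA.
have h := ler_wpM2l kap_ge0 (Hr N).
have -> : (kap * (t / N.+1%:R)) ^+ 2 *+ N.+1 = (kap * t) ^+ 2 * N.+1%:R^-1.
  by rewrite -mulr_natr; field.
apply: le_trans (_ : kap * (t * pexit + (4 * n%:R)^-1) + E N <= _); last by rewrite lerD2l.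
rewrite /E; move: h.
set A := \sum_(k < N.+1) t / _ * _; set B := \sum_(k < N.+1) r _ _; set C := \sum_(k < N.+1) rho _ _.
rewrite mulrDl mul1r => h.
by rewrite !addrA !lerD2r; apply: le_trans h _; apply: eq_ler; ring.
Unshelve. all: by end_near. Qed.

End Chain.

Lemma cos_lipschitz (R : realType) (x y : R) : `|cos x - cos y| <= `|x - y|.
Proof.
wlog xy : x y / y <= x.
  by move=> h; case: (leP y x) => [|/ltW] /h//; rewrite distrC (distrC y).
have [|c _ ->] := @MVT_segment R cos (fun z => - sin z) y x xy (fun z _ => is_derive_cos z).
  by apply: continuous_subspaceT; exact: continuous_cos.
by rewrite normrM normrN ler_piMl// sin_max.
Qed.

(** * The exit probability vanishes as the radius tends to 1 *)

Section Exits.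
Variables (R : realType) (d : measure_display) (T : measurableType d).
Variables (P : probability T R) (n : nat).
Local Notation V := 'M[R]_(n, 4).
Variable w : R -> T -> V.
Hypothesis hw : brownian_motion_HHn P w 0.
Variable t : R.
Hypothesis t0 : 0 < t.

Definition level (m : nat) : R := 1 - m.+2%:R^-1.

Lemma level_lt1 m : level m < 1.
Proof. by rewrite ltrBlDr ltrDl invr_gt0. Qed.

(** On [0, t] the continuous function |w|^2 attains a maximum below 1, so each path avoids the exit
    event once the level exceeds it; bounded convergence concludes. *)
Lemma cvg_pexit : pexit P w (level m) t @[m --> \oo] --> 0.
Proof.
rewrite -(Ex_cst P 0); apply: (@cvg_Ex _ _ _ P _ _ 1) => [m||m x|x].
- by apply: measurable_indic; exact: (measurable_exits hw).
- exact: measurable_cst.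
- by rewrite indicE; case: (x \in _); rewrite ?normr0 ?normr1.
have cq := @bm_path_continuous _ _ _ P n w hw (@hnorm2 R n) x t nice_hnorm2.
have [s st H] := @EVT_max R (fun s => hnorm2 (w s x)) 0 t (ltW t0) cq.
have q1 : hnorm2 (w s x) < 1.
  by apply: (bm_HHn hw); move: st; rewrite in_itv/= => /andP[].
have c : level m @[m --> \oo] --> (1 : R).
  have h := @cvg_harmonic R.
  have : (fun m => 1 - harmonic m.+1) @ \oo --> (1 - 0 : R).
    by apply: cvgB; [exact: cvg_cst|rewrite cvg_shiftS].
  by rewrite subr0.
apply/cvgrPdist_le => e e0; near=> m.
rewrite indicE memNset ?subr0 ?normr0 ?(ltW e0)//.
case=> N _ [k /= kN]; apply/negP; rewrite -ltNge.
apply: le_lt_trans (H _ _) _.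
  by rewrite in_itv/= grid_ge0//= -[leRHS](gridN t N) grid_mono.
near: m; exact: (cvgr_gt 1 c).
Unshelve. all: by end_near. Qed.

End Exits.

(** * Passage to the stochastic area *)

Section QuatMeasurable.
Variables (R : realType) (d : measure_display) (T : measurableType d).

Definition mmx (m p : nat) (X : T -> 'M[R]_(m, p)) := forall i k, measurable_fun setT (fun x => X x i k).

Lemma mmx_row m p (X : T -> 'M[R]_(m, p)) i : mmx X -> mmx (fun x => row i (X x)).
Proof. by move=> mX ? k; under eq_fun do rewrite mxE; exact: mX. Qed.

Lemma mmx_add m p (X Y : T -> 'M[R]_(m, p)) : mmx X -> mmx Y -> mmx (fun x => X x + Y x).
Proof. by move=> mX mY i k; under eq_fun do rewrite mxE; exact: measurable_funD. Qed.

Lemma mmx_opp m p (X : T -> 'M[R]_(m, p)) : mmx X -> mmx (fun x => - X x).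
Proof.
move=> mX i k; under eq_fun do rewrite mxE; exact: measurableT_comp (mX i k).
Qed.

Lemma mmx_scale m p (c : T -> R) (X : T -> 'M[R]_(m, p)) :
  measurable_fun setT c -> mmx X -> mmx (fun x => c x *: X x).
Proof. by move=> mc mX i k; under eq_fun do rewrite mxE; exact: measurable_funM. Qed.

Lemma mmx_sum (I : Type) (r : seq I) m p (X : I -> T -> 'M[R]_(m, p)) :
  (forall i, mmx (X i)) -> mmx (fun x => \sum_(i <- r) X i x).
Proof.
move=> mX i k; under eq_fun do rewrite summxE.
by apply: measurable_sum => j; exact: mX.
Qed.

Lemma mmx_qmk (f0 f1 f2 f3 : T -> R) :
  measurable_fun setT f0 -> measurable_fun setT f1 ->
  measurable_fun setT f2 -> measurable_fun setT f3 ->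
  mmx (fun x => qmk (f0 x) (f1 x) (f2 x) (f3 x)).
Proof.
move=> m0 m1 m2 m3 i k; under eq_fun do rewrite mxE.
by case: (ordE4 k) => -> /=.
Qed.

Lemma mmx_qconj (X : T -> quat R) : mmx X -> mmx (fun x => qconj (X x)).
Proof.
by move=> mX; apply: mmx_qmk => //; exact: measurableT_comp (mX _ _).
Qed.

Lemma mmx_qmul (X Y : T -> quat R) : mmx X -> mmx Y -> mmx (fun x => qmul (X x) (Y x)).
Proof.
move=> mX mY; apply: mmx_qmk;
  repeat first [apply: measurable_funB | apply: measurable_funD | apply: measurable_funM];
  by [exact: mX|exact: mY].
Qed.

Lemma measurable_mx_norm (X : T -> quat R) : mmx X -> measurable_fun setT (fun x => `|X x|).
Proof.
move=> mX.
have -> : (fun x => `|X x|) = (fun x =>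
    Num.max (Num.max `|X x 0 0| `|X x 0 1|) (Num.max `|X x 0 2| `|X x 0 3|)).
  apply/funext => x; apply/eqP; rewrite eq_le; apply/andP; split.
    apply: mx_norm_le_entry => [|i k]; first by rewrite !le_max normr_ge0.
    rewrite ord1 !le_max.
    by case: (ordE4 k) => ->; rewrite lexx ?orbT.
  by rewrite !ge_max !mx_entry_le_norm.
have mn k : measurable_fun setT (fun x => `|X x 0 k|) by exact: measurableT_comp (mX _ _).
by apply: measurable_maxr; apply: measurable_maxr.
Qed.

End QuatMeasurable.

Section Area.
Variables (R : realType) (d : measure_display) (T : measurableType d).
Variables (P : probability T R) (n : nat).
Local Notation V := 'M[R]_(n, 4).
Variable w : R -> T -> V.
Hypothesis hw : brownian_motion_HHn P w 0.
Variable t : R.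
Hypothesis t0 : 0 < t.
Variable l : R * R * R.

Definition dot3 (v : R * R * R) : R := l.1.1 * v.1.1 + l.1.2 * v.1.2 + l.2 * v.2.

Definition dotq (q : quat R) : R := l.1.1 * q 0 1 + l.1.2 * q 0 2 + l.2 * q 0 3.

Lemma dotq_qim v : dotq (qim v) = dot3 v.
Proof. by rewrite /dotq /qim !mxE. Qed.

Lemma dotq_linear : linear (dotq : quat R -> R^o).
Proof. by move=> c p q; rewrite /dotq !mxE /GRing.scale/=; ring. Qed.

HB.instance Definition _ := GRing.isLinear.Build R (quat R) R^o *:%R dotq dotq_linear.

Definition sizel : R := `|l.1.1| + `|l.1.2| + `|l.2|.

Lemma dotq_le q : `|dotq q| <= sizel * `|q|.
Proof.
have h c k : `|c * q 0 k| <= `|c| * `|q|.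
  by rewrite normrM ler_wpM2l// mx_entry_le_norm.
rewrite /dotq /sizel !mulrDl.
by do 2 (apply: le_trans (ler_normD _ _) _; apply: lerD; last by apply: (h)); apply: (h).
Qed.

Local Notation tk := (grid t).
(** The initial time 0 is omitted, as in the convention for subdivisions. *)
Definition mesh_points (N : nat) : seq R := [seq tk N k.+1 | k <- iota 0 N.+1].

Lemma size_mesh_points N : size (mesh_points N) = N.+1.
Proof. by rewrite size_map size_iota. Qed.

Lemma partition_pointE N k : (k <= N.+1)%N -> partition_point (mesh_points N) k = tk N k.
Proof.
rewrite /partition_point; case: k => [|k] kN /=; first by rewrite grid0.
by rewrite (nth_map 0%N) ?size_iota// nth_iota.
Qed.

Lemma itv_mesh_points N : itv_partition 0 t (mesh_points N).
Proof.
split; last first.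
  rewrite (last_nth 0) size_mesh_points.
  by have := @partition_pointE N N.+1 (leqnn _); rewrite /partition_point => ->; rewrite gridN.
apply/(pathP 0) => i; rewrite size_mesh_points => iN.
have := @partition_pointE N i (ltnW iN); rewrite /partition_point => ->.
have := @partition_pointE N i.+1 iN; rewrite /partition_point/= => ->.
by rewrite -subr_gt0 gridS divr_gt0.
Qed.

Lemma mesh_mesh_points (del : R) : 0 < del -> \forall N \near \oo, mesh_lt (mesh_points N) del.
Proof.
move=> del0; near=> N => i; rewrite size_mesh_points => iN.
rewrite !partition_pointE// ?(ltnW iN)// gridS.
rewrite ltr_pdivrMr// mulrC -ltr_pdivrMr//.
near: N; have := nbhs_infty_gtr (t / del) => -[m _ Hm]; exists m => // k mk.
by apply: lt_trans (Hm k mk) _; rewrite ltr_nat.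
Unshelve. all: by end_near. Qed.

Local Notation cf y := ((1 - hnorm2 y)^-1).

Definition strA (j : 'I_n) N := stratonovich_sum (@qmul R) (fun s x => row j (w s x))
  (fun s x => cf (w s x) *: qconj (row j (w s x))) (mesh_points N).

Definition strB (j : 'I_n) N := stratonovich_sum (fun dx y => @qmul R y dx)
  (fun s x => qconj (row j (w s x))) (fun s x => cf (w s x) *: row j (w s x)) (mesh_points N).

(** The second product is the conjugate of the first, so half the difference is an imaginary part.
    As z -> l z is skew-symmetric, both <y - z, l z> and <y - z, l y> equal <y, l z>. *)
Lemma dotq_trapezoid (z y : V) (cz cy : R) :
  dotq (2^-1 *: \sum_j (qmul (row j y - row j z)
          (2^-1 *: (cz *: qconj (row j z) + cy *: qconj (row j y)))
     - qmul (2^-1 *: (cz *: row j z + cy *: row j y)) (qconj (row j y) - qconj (row j z)))) =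
  2^-1 * ((cz + cy) * ip y (imul l z)).
Proof.
rewrite linearZ linear_sum /ip/= scaler_sumr [RHS]mulrA mulr_sumr; apply: eq_bigr => j _.
rewrite big4 /dotq /imul /qmul /qconj /qmk !mxE/= /GRing.scale/=.
by field.
Qed.

Lemma strAB_walk N x :
  dotq (2^-1 *: \sum_j (strA j N x - strB j N x)) =
  \sum_(k < N.+1) 2^-1 * ((cf (w (tk N k) x) + cf (w (tk N k.+1) x)) *
     ip (w (tk N k.+1) x) (imul l (w (tk N k) x))).
Proof.
under [RHS]eq_bigr do rewrite -dotq_trapezoid.
rewrite -linear_sum -scaler_sumr; congr (dotq (_ *: _)).
rewrite exchange_big/=; apply: eq_bigr => j _.
rewrite /strA /strB /stratonovich_sum size_mesh_points sumrB.
congr (_ - _); apply: eq_bigr => k _; rewrite !partition_pointE//; exact: ltnW.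
Qed.

Lemma mmx_w s : 0 <= s -> mmx (w s).
Proof. by move=> s0 i k; exact: (bm_measurable hw). Qed.

Lemma measurable_cf s : 0 <= s -> measurable_fun setT (fun x => cf (w s x)).
Proof.
move=> s0; apply: (measurableT_comp (@measurable_inv R)).
have nq : nice (fun y : V => 1 - hnorm2 y) by exact: nice_sub (nice_cst _) nice_hnorm2.
exact: (nice_bm_measurable hw s0 nq).
Qed.

Lemma mesh_points_ge0 N i : 0 <= partition_point (mesh_points N) i.
Proof.
have [iN|iN] := leqP i N.+1; first by rewrite partition_pointE// grid_ge0.
by rewrite /partition_point nth_default// -[size _]/(size (mesh_points N)).+1 size_mesh_points.
Qed.

Lemma mmx_strA j N : mmx (strA j N).
Proof.
rewrite /strA /stratonovich_sum; apply: mmx_sum => i /=.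
have p0 := mesh_points_ge0 N i; have p1 := mesh_points_ge0 N i.+1.
have mr k : mmx (fun x => row j (w (partition_point (mesh_points N) k) x)).
  by apply: mmx_row; apply: mmx_w; exact: mesh_points_ge0.
apply: mmx_qmul; first by apply: mmx_add; [exact: mr|exact: mmx_opp].
apply: mmx_scale; first exact: measurable_cst.
by apply: mmx_add; (apply: mmx_scale; [exact: measurable_cf|exact: mmx_qconj]).
Qed.

Lemma mmx_strB j N : mmx (strB j N).
Proof.
rewrite /strB /stratonovich_sum; apply: mmx_sum => i /=.
have p0 := mesh_points_ge0 N i; have p1 := mesh_points_ge0 N i.+1.
have mr k : mmx (fun x => row j (w (partition_point (mesh_points N) k) x)).
  by apply: mmx_row; apply: mmx_w; exact: mesh_points_ge0.
apply: mmx_qmul; last by apply: mmx_add; [|apply: mmx_opp]; exact: mmx_qconj.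
apply: mmx_scale; first exact: measurable_cst.
by apply: mmx_add; (apply: mmx_scale; [exact: measurable_cf|exact: mr]).
Qed.

Variables (a b : R).
Hypotheses (ab : a < b) (b1 : b < 1).

Lemma walk_not_exits (ph : R) N x : ~ exits w a t x ->
  walk w a b t l ph N N.+1 x =
  ph + (Num.sqrt t)^-1 * dotq (2^-1 *: \sum_j (strA j N x - strB j N x)).
Proof.
move=> nx; rewrite /walk strAB_walk mulr_sumr; congr (_ + _).
apply: eq_bigr => k _; rewrite /incr (theta_not_exits nx); last exact/ltnW/ltn_ord.
have q0 := not_exits nx (ltnW (ltn_ord k) : (k <= N.+1)%N).
have q1 := not_exits nx (ltn_ord k : (k.+1 <= N.+1)%N).
by rewrite mul1r /phi cutoff1 ?(ltW q1)// mulr1 /psi !confE ?(ltW q0) ?(ltW q1).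
Qed.

Variables (A B : 'I_n -> T -> quat R).
Hypothesis hA : forall j, stratonovich_integral P (@qmul R) (fun s x => row j (w s x))
  (fun s x => cf (w s x) *: qconj (row j (w s x))) t (A j).
Hypothesis hB : forall j, stratonovich_integral P (fun dx y => qmul y dx)
  (fun s x => qconj (row j (w s x))) (fun s x => cf (w s x) *: row j (w s x)) t (B j).

Definition area_form x : R := dotq (2^-1 *: \sum_j (A j x - B j x)).

Lemma mmx_A j : mmx (A j).
Proof. by move=> i k; rewrite ord1; case: (hA j). Qed.

Lemma mmx_B j : mmx (B j).
Proof. by move=> i k; rewrite ord1; case: (hB j). Qed.

Lemma measurable_area_form : measurable_fun setT area_form.
Proof.
have m k : measurable_fun setT (fun x => (2^-1 *: \sum_j (A j x - B j x)) 0 k).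
  apply: mmx_scale; first exact: measurable_cst.
  by apply: mmx_sum => j; apply: mmx_add; [exact: mmx_A|apply: mmx_opp; exact: mmx_B].
by apply: measurable_funD; [apply: measurable_funD|]; apply: measurable_funM.
Qed.

Definition farA e N j : set T := [set x | e < `|strA j N x - A j x|].
Definition farB e N j : set T := [set x | e < `|strB j N x - B j x|].

Lemma measurable_gt (f : T -> R) e : measurable_fun setT f -> measurable [set x | e < f x].
Proof.
move=> /(_ measurableT `]e, +oo[%classic (measurable_itv _)); rewrite setTI.
by congr (measurable _); apply/seteqP; split=> x /=; rewrite in_itv/= andbT.
Qed.

Lemma measurable_farA e N j : measurable (farA e N j).
Proof.
apply: measurable_gt; apply: measurable_mx_norm.
by apply: mmx_add; [exact: mmx_strA|apply: mmx_opp; exact: mmx_A].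
Qed.

Lemma measurable_farB e N j : measurable (farB e N j).
Proof.
apply: measurable_gt; apply: measurable_mx_norm.
by apply: mmx_add; [exact: mmx_strB|apply: mmx_opp; exact: mmx_B].
Qed.

(** Off the exit event the walk is the trapezoidal sum itself; if moreover all sums are within [e]
    of the integrals, the Lipschitz bound of the cosine applies. *)
Lemma cos_walk_area (ph e : R) N x : 0 <= e ->
  `|cos (walk w a b t l ph N N.+1 x) - cos (ph + (Num.sqrt t)^-1 * area_form x)| <=
  (Num.sqrt t)^-1 * (sizel * (n%:R * e)) + 2 * (\1_(exits w a t) x +
     \sum_j (\1_(farA e N j) x + \1_(farB e N j) x)).
Proof.
move=> e0.
have s0 : 0 <= (Num.sqrt t)^-1 by rewrite invr_ge0 sqrtr_ge0.
have l0 : 0 <= sizel by rewrite !addr_ge0.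
have i0 (S : set T) : 0 <= \1_S x :> R by rewrite indicE.
have sum0 : 0 <= \sum_j (\1_(farA e N j) x + \1_(farB e N j) x) :> R.
  by apply: sumr_ge0 => j _; rewrite addr_ge0.
have m0 : 0 <= (Num.sqrt t)^-1 * (sizel * (n%:R * e)) by rewrite !mulr_ge0.
have c2 (u v : R) : `|cos u - cos v| <= 2.
  rewrite (le_trans (ler_normB _ _))// -[leRHS]/(1 + 1) lerD ?cos_max//.
(* On any of the bad events the right-hand side is at least 2, the largest distance between two
   cosines. *)
have big : 1 <= \1_(exits w a t) x + \sum_j (\1_(farA e N j) x + \1_(farB e N j) x) :> R ->
   `|cos (walk w a b t l ph N N.+1 x) - cos (ph + (Num.sqrt t)^-1 * area_form x)| <=
  (Num.sqrt t)^-1 * (sizel * (n%:R * e)) + 2 * (\1_(exits w a t) x +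
     \sum_j (\1_(farA e N j) x + \1_(farB e N j) x)).
  move=> h; apply: le_trans (c2 _ _) _; rewrite -[leLHS]addr0 addrC lerD//.
  by rewrite -[leLHS]mulr1 ler_wpM2l.
have [ex|nex] := pselect (exits w a t x).
  by apply: big; rewrite indicE mem_set// lerDl.
have [/existsP[j /orP[/asboolP fj|/asboolP fj]]|] :=
    boolP [exists j, `[< farA e N j x >] || `[< farB e N j x >]].
- apply: big; rewrite (bigD1 j)//= [\1_(farA e N j) x]indicE mem_set//.
  rewrite addrCA -addrA lerDl !addr_ge0//.
  by apply: sumr_ge0 => k _; rewrite addr_ge0.
- apply: big; rewrite (bigD1 j)//= [\1_(farB e N j) x]indicE mem_set//.
  rewrite addrCA (addrC _ 1) -!addrA lerDl !addr_ge0//.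
  by apply: sumr_ge0 => k _; rewrite addr_ge0.
rewrite negb_exists => /forallP near_.
have nA j : `|strA j N x - A j x| <= e.
  have := near_ j; rewrite negb_or => /andP[/asboolPn h _].
  by rewrite leNgt; apply/negP.
have nB j : `|strB j N x - B j x| <= e.
  have := near_ j; rewrite negb_or => /andP[_ /asboolPn h].
  by rewrite leNgt; apply/negP.
apply: le_trans (cos_lipschitz _ _) _.
rewrite (walk_not_exits _ _ nex) /area_form.
rewrite [X in `|X|](_ : _ = (Num.sqrt t)^-1 *
   dotq (2^-1 *: \sum_j ((strA j N x - A j x) - (strB j N x - B j x)))); last first.
  rewrite opprD addrACA subrr add0r -mulrBr -linearB -scalerBr -sumrB.
  congr (_ * dotq (_ *: _)); apply: eq_bigr => j _.
  by rewrite !opprD addrACA.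
rewrite normrM (ger0_norm s0) ler_wpDr ?mulr_ge0 ?addr_ge0//.
rewrite ler_wpM2l// (le_trans (dotq_le _))// ler_wpM2l//.
rewrite normrZ gtr0_norm ?invr_gt0// ler_pdivrMl//.
apply: le_trans (ler_norm_sum _ _ _) _.
apply: (@le_trans _ _ (\sum_(j < n) 2 * e)).
  apply: ler_sum => j _; rewrite (le_trans (ler_normB _ _))//.
  by rewrite mulr2n mulrDl mul1r lerD.
by rewrite sumr_const card_ord -mulr_natr; apply: eq_ler; ring.
Qed.

Lemma far_small (e eta : R) : 0 < e -> 0 < eta -> \forall N \near \oo,
  forall j, Ex P (\1_(farA e N j) : T -> R) <= eta /\ Ex P (\1_(farB e N j) : T -> R) <= eta.
Proof.
move=> e0 eta0; apply: filter_forall => j.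
have [_ /(_ e eta e0 eta0)[dA dA0 HA]] := hA j.
have [_ /(_ e eta e0 eta0)[dB dB0 HB]] := hB j.
near=> N; split; rewrite -lee_fin Ex_indic.
- by apply: HA; [exact: itv_mesh_points|near: N; exact: mesh_mesh_points].
- exact: measurable_farA.
- by apply: HB; [exact: itv_mesh_points|near: N; exact: mesh_mesh_points].
- exact: measurable_farB.
Unshelve. all: by end_near. Qed.

Hypothesis n1 : (0 < n)%N.

Lemma area_form_cos_le (ph e : R) : 0 < e ->
  `|Ex P (fun x => cos (ph + (Num.sqrt t)^-1 * area_form x)) - expR (- (nsq l / 2)) * cos ph| <=
  kap t l * (t * pexit P w a t + (4 * n%:R)^-1) + 2 * pexit P w a t + e.
Proof.
move=> e0.
have s0 : 0 <= (Num.sqrt t)^-1 by rewrite invr_ge0 sqrtr_ge0.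
have l0 : 0 <= sizel by rewrite !addr_ge0.
(* The total coefficient of [e'] in the errors: the Lipschitz term, and 2n bad events weighted by 2.
   The final 1 ensures positivity. *)
pose C := (Num.sqrt t)^-1 * (sizel * n%:R) + 4 * n%:R + 1.
have C0 : 0 < C by rewrite ltr_wpDl// addr_ge0// !mulr_ge0.
pose e' := e / 2 / C.
have e'0 : 0 < e' by rewrite !divr_gt0.
have e20 : 0 < e / 2 by rewrite divr_gt0.
near \oo => N.
have H1 : `|Ex P (fun x => cos (walk w a b t l ph N N.+1 x)) - expR (- (nsq l / 2)) * cos ph| <=
    kap t l * (t * pexit P w a t + (4 * n%:R)^-1) + e / 2.
  by near: N; exact: (walk_cos_near hw ab b1 t0 l ph n1 e20).
have H2 : forall j, Ex P (\1_(farA e' N j) : T -> R) <= e' /\ Ex P (\1_(farB e' N j) : T -> R) <= e'.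
  by near: N; exact: far_small.
have bcw : brv (fun x => cos (walk w a b t l ph N N.+1 x)).
  by apply: brv_cos; exact: (measurable_walk hw ab b1 t0).
have bca : brv (fun x => cos (ph + (Num.sqrt t)^-1 * area_form x)).
  apply: brv_cos; apply: measurable_funD; first exact: measurable_cst.
  by apply: measurable_funM; [exact: measurable_cst|exact: measurable_area_form].
have bE : brv (\1_(exits w a t) : T -> R) by apply: brv_indic; exact: (measurable_exits hw).
have bA j : brv (\1_(farA e' N j) : T -> R) by apply: brv_indic; exact: measurable_farA.
have bB j : brv (\1_(farB e' N j) : T -> R) by apply: brv_indic; exact: measurable_farB.
have bAB : brv (fun x => \sum_j (\1_(farA e' N j) x + \1_(farB e' N j) x) : R).
  by apply: brv_sum => j; exact: brvD.
have H3 : `|Ex P (fun x => cos (walk w a b t l ph N N.+1 x)) -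
     Ex P (fun x => cos (ph + (Num.sqrt t)^-1 * area_form x))| <=
     2 * pexit P w a t + e / 2.
  rewrite -ExB//.
  apply: (@le_trans _ _ (Ex P (fun x => (Num.sqrt t)^-1 * (sizel * (n%:R * e')) + 2 * (\1_(exits w a t) x +
     \sum_j (\1_(farA e' N j) x + \1_(farB e' N j) x))))).
    apply: le_norm_Ex => [||x]; [exact: brvB| |by apply: cos_walk_area; exact: ltW].
    by apply: brvD; [exact: brv_cst|apply: brvZ; exact: brvD].
  rewrite ExD; [|exact: brv_cst|by apply: brvZ; exact: brvD].
  rewrite Ex_cst ExZ; last exact: brvD.
  rewrite ExD// Ex_sum => [|j]; last exact: brvD.
  have : \sum_j Ex P (fun x => \1_(farA e' N j) x + \1_(farB e' N j) x : R) <= n%:R * (2 * e').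
    rewrite -[n in n%:R]card_ord -sum1_card natr_sum mulr_suml.
    apply: ler_sum => j _; rewrite ExD// mul1r.
    have -> : 2 * e' = e' + e' by ring.
    by have [h1 h2] := H2 j; exact: lerD h1 h2.
  have : (Num.sqrt t)^-1 * (sizel * (n%:R * e')) + 2 * (n%:R * (2 * e')) <= e / 2.
    have -> : e / 2 = C * e' by rewrite /e' [RHS]mulrC divfK// gt_eqF.
    by rewrite /C; move: (ltW e'0); nra.
  by rewrite -/(pexit P w a t); lra.
have := ler_normD (Ex P (fun x => cos (ph + (Num.sqrt t)^-1 * area_form x)) -
   Ex P (fun x => cos (walk w a b t l ph N N.+1 x)))
   (Ex P (fun x => cos (walk w a b t l ph N N.+1 x)) - expR (- (nsq l / 2)) * cos ph).
rewrite addrA subrK => /le_trans; apply; rewrite distrC.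
by lra.
Unshelve. all: by end_near. Qed.

End Area.

(** At fixed t the level tends to 1 and the exit probability drops out. What remains, kap / (4n) =
    |l|^2 / (8 n t), is bounded crudely by |l|^2 / t. *)
Lemma area_char (R : realType) (d : measure_display) (T : measurableType d)
    (P : probability T R) (n : nat) (w : R -> T -> 'M[R]_(n, 4)) (a : R -> T -> R * R * R) :
  (0 < n)%N -> brownian_motion_HHn P w 0 -> stochastic_area P w a ->
  forall (l : R * R * R) (ph t : R), 0 < t ->
  `|Ex P (fun x => cos (ph + dot3 l ((Num.sqrt t)^-1 *: a t x))) - expR (- (nsq l / 2)) * cos ph|
  <= nsq l / t.
Proof.
move=> n1 hw ha l ph t t0.
have [ma [A [B [hA hB AB]]]] := ha t (ltW t0).
pose F := area_form l A B.
have mF : measurable_fun setT F by exact: (measurable_area_form l hA hB).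
have mc : measurable_fun setT (fun x => cos (ph + dot3 l ((Num.sqrt t)^-1 *: a t x))).
  suff : brv (fun x => cos (ph + dot3 l ((Num.sqrt t)^-1 *: a t x))) by case.
  apply: brv_cos; apply: measurable_funD; first exact: measurable_cst.
  have m1 := measurableT_comp (@measurable_fst _ _ _ _) ma.
  have m11 := measurableT_comp (@measurable_fst _ _ _ _) m1.
  have m12 := measurableT_comp (@measurable_snd _ _ _ _) m1.
  have m2 := measurableT_comp (@measurable_snd _ _ _ _) ma.
  by apply: measurable_funD; [apply: measurable_funD|]; do 2 (apply: measurable_funM => //).
have mcF : measurable_fun setT (fun x => cos (ph + (Num.sqrt t)^-1 * F x)).
  suff : brv (fun x => cos (ph + (Num.sqrt t)^-1 * F x)) by case.
  apply: brv_cos; apply: measurable_funD; first exact: measurable_cst.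
  by apply: measurable_funM; first exact: measurable_cst.
have -> : Ex P (fun x => cos (ph + dot3 l ((Num.sqrt t)^-1 *: a t x))) =
  Ex P (fun x => cos (ph + (Num.sqrt t)^-1 * F x)).
  congr fine; apply: ae_eq_integral => //; [exact/measurable_EFinP|exact/measurable_EFinP|].
  apply: filterS AB => x ABx _ /=; congr (cos (_ + _))%:E.
  rewrite /F /area_form -ABx dotq_qim /dot3/= /GRing.scale/=; ring.
have kap0 : 0 <= kap t l by exact: kap_ge0.
have nsq0 : 0 <= nsq l by exact: nsq_ge0.
apply/ler_addgt0Pr => e e0.
(* The coefficient of the exit probability in [area_form_cos_le]. *)
pose c := kap t l * t + 2.
have c0 : 0 < c by rewrite ltr_wpDl// mulr_ge0// ltW.
have e2 : 0 < e / 2 by rewrite divr_gt0.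
near \oo => m.
have pm : pexit P w (level R m) t <= e / 2 / c.
  apply: le_trans (ler_norm _) _; near: m.
  by move/cvgr0Pnorm_le : (cvg_pexit hw t0); apply; rewrite divr_gt0.
pose b := (1 + level R m) / 2.
have m1 := @level_lt1 R m.
have ab : level R m < b by rewrite /b; lra.
have b1 : b < 1 by rewrite /b; lra.
have H := area_form_cos_le hw t0 l ab b1 hA hB n1 ph e2.
apply: le_trans H _.
set p := pexit P w (level R m) t in pm *.
have -> : kap t l * (t * p + (4 * n%:R)^-1) + 2 * p + e / 2 =
   c * p + kap t l * (4 * n%:R)^-1 + e / 2 by rewrite /c; ring.
rewrite ler_pdivlMr// mulrC in pm.
have : kap t l * (4 * n%:R)^-1 <= nsq l / t.
  have -> : nsq l / t = kap t l * 2 by rewrite /kap; field; rewrite gt_eqF.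
  rewrite ler_wpM2l//.
  have n1' : (1 : R) <= n%:R by rewrite ler1n.
  by rewrite invf_ple ?posrE ?mulr_gt0//; lra.
by lra.
Unshelve. all: by end_near. Qed.

(** * The Gaussian characteristic function *)

Section GaussianCharacteristic.
Variable R : realType.
Local Notation N01 := (@normal_prob R 0 1).
Local Notation mu := (@lebesgue_measure R).
Local Notation g := (@normal_pdf R 0 1).

Lemma g_gaussE x : g x = normal_peak (1 : R) * expR (- x ^+ 2 / 2).
Proof.
rewrite normal_pdfE ?oner_neq0// /normal_fun subr0 expr1n mulr2n.
by rewrite -[1 + 1]/(2 : R).
Qed.

Lemma integral_normal01 (f : R -> R) : brv f ->
  (\int[N01]_x (f x)%:E = \int[mu]_x (f x * g x)%:E)%E.
Proof.
move=> bf; have mf : measurable_fun setT (EFin \o f) by apply/measurable_EFinP; case: bf.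
have iF : N01.-integrable setT (EFin \o f) by exact: (@brv_integrable _ _ _ N01).
have dom := normal_prob_dominates (0 : R) (1 : R).
rewrite -(Radon_Nikodym_change_of_variables dom measurableT iF).
apply: ae_eq_integral => //.
- exact: emeasurable_funM.
- apply/measurable_EFinP; apply: measurable_funM; first by case: bf.
  exact: measurable_normal_pdf.
(* Both functions have the same integral over every measurable set. *)
have RN : ae_eq mu setT (Radon_Nikodym (charge_of_finite_measure N01) mu) (EFin \o g).
  apply: integral_ae_eq => //.
  - by apply: Radon_Nikodym_integrable.
  - by apply/measurable_EFinP; exact: measurable_normal_pdf.
  - by move=> A _ mA; rewrite -Radon_Nikodym_integral.
apply: filterS RN => x RNx _ /=.
by rewrite RNx// EFinM.
Qed.

Lemma is_derive_gauss (x : R) : is_derive x (1 : R) g (- x * g x).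
Proof.
have -> : g = (fun y => normal_peak (1 : R) * expR (- y ^+ 2 / 2)).
  by apply/funext => y; rewrite g_gaussE.
have d1 : is_derive x (1 : R) (fun y : R => - y ^+ 2 / 2) (- x).
  by apply: is_derive_eq; rewrite /GRing.scale/=; field.
have d2 := @is_derive1_comp _ (@expR R) (fun y => - y ^+ 2 / 2) x _ _ (is_derive_expR _) d1.
have := @is_deriveZ _ _ _ _ (normal_peak (1 : R)) x 1 _ d2.
by move=> h; apply: is_derive_eq h _; rewrite /GRing.scale/=; ring.
Qed.

Lemma continuous_gauss : continuous g.
Proof. by apply: continuous_normal_pdf; exact: oner_neq0. Qed.

(** Domination by a multiple of the centred Gaussian density of variance 2, using |x| <= 1 + x^2 / 4
    <= exp (x^2 / 4). *)
Lemma integrable_absx_gauss : mu.-integrable setT (EFin \o (fun x : R => `|x| * g x)).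
Proof.
pose s := Num.sqrt (2 : R).
have s0 : 0 < s by rewrite sqrtr_gt0.
have s2 : s ^+ 2 = 2 by rewrite sqr_sqrtr.
have sn0 : s != 0 by rewrite gt_eqF.
have p0 := normal_peak_gt0 sn0.
pose c := normal_peak (1 : R) / normal_peak s.
have iC : mu.-integrable setT (fun x => (c%:E * (normal_pdf 0 s x)%:E)%E).
  by apply: integrableZl => //; exact: integrable_normal_pdf.
apply: (le_integrable _ _ _ iC) => //.
  apply/measurable_EFinP; apply: measurable_funM => //; exact: measurable_normal_pdf.
move=> x _ /=; rewrite lee_fin.
have g0 : 0 <= g x by exact: normal_pdf_ge0.
rewrite ger0_norm ?mulr_ge0// (@ger0_norm _ (c * _)); last first.
  by rewrite mulr_ge0 ?normal_pdf_ge0// divr_ge0 ?normal_peak_ge0.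
rewrite g_gaussE (normal_pdfE _ sn0) /c mulrA divfK ?gt_eqF//.
rewrite mulrCA ler_wpM2l ?normal_peak_ge0// /normal_fun subr0 s2.
have -> : - x ^+ 2 / 2 = - x ^+ 2 / (2 *+ 2) + - (x ^+ 2 / 4) by field.
rewrite expRD mulrCA ler_piMr ?expR_ge0// expRN.
rewrite ler_pdivrMr ?expR_gt0// mul1r; apply: le_trans (expR_ge1Dx _).
have -> : x ^+ 2 / 4 = (`|x| / 2) ^+ 2 by rewrite exprMn real_normK ?num_real//; field.
by have := sqr_ge0 (`|x| / 2 - 1); lra.
Qed.

Variable ph : R.
Local Notation f := (fun lam x : R => cos (lam * x + ph) * g x).

Lemma is_derive_linear_arg (lam x : R) : is_derive x (1 : R) (fun y : R => lam * y + ph) lam.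
Proof. by apply: is_derive_eq; rewrite /GRing.scale/=; ring. Qed.

Lemma integrable_bounded_gauss (h : R -> R) : measurable_fun setT h -> (forall x, `|h x| <= 1) ->
  mu.-integrable setT (EFin \o (fun x => h x * g x)).
Proof.
move=> mh h1; apply: (le_integrable _ _ _ (@integrable_normal_pdf R 0 1)) => //.
  apply/measurable_EFinP; apply: measurable_funM => //; exact: measurable_normal_pdf.
move=> x _ /=; rewrite lee_fin normrM ler_piMl//.
Qed.

Lemma measurable_linear_arg (lam : R) : measurable_fun setT (fun y : R => lam * y + ph).
Proof.
apply: continuous_measurable_fun => x; apply: differentiable_continuous.
by apply/derivable1_diffP; case: (is_derive_linear_arg lam x).
Qed.

Lemma integrable_cos_gauss (lam : R) : mu.-integrable setT (EFin \o f lam).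
Proof.
apply: integrable_bounded_gauss => [|x]; last exact: cos_max.
by have [] := brv_cos (measurable_linear_arg lam).
Qed.

Lemma integrable_xsin_gauss (lam : R) :
  mu.-integrable setT (EFin \o (fun x : R => x * sin (lam * x + ph) * g x)).
Proof.
apply: (le_integrable _ _ _ integrable_absx_gauss) => //.
  apply/measurable_EFinP; apply: measurable_funM; last exact: measurable_normal_pdf.
  by apply: measurable_funM => //; have [] := brv_sin (measurable_linear_arg lam).
move=> x _ /=; rewrite lee_fin !normrM normr_id ler_wpM2r// -[leRHS]mulr1.
by rewrite ler_wpM2l// sin_max.
Qed.

Lemma gauss_cvg0 : (g m.+1%:R @[m --> \oo] --> 0) /\ (g (- m.+1%:R) @[m --> \oo] --> 0).
Proof.
have e m : g (- m.+1%:R) = g m.+1%:R by rewrite !g_gaussE sqrrN.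
suff h : g m.+1%:R @[m --> \oo] --> 0 by split=> //; under eq_fun do rewrite e.
apply: (@squeeze_cvgr _ _ _ _ (fun=> 0) (fun m => normal_peak (1 : R) * 2 * harmonic m)).
- near=> m; rewrite normal_pdf_ge0/= g_gaussE -mulrA ler_wpM2l ?normal_peak_ge0//.
  rewrite mulNr expRN /harmonic/= -div1r ler_pdivrMr ?expR_gt0// mulrAC ler_pdivlMr ?ltr0n// mul1r.
  apply: le_trans (_ : 2 * (1 + m.+1%:R ^+ 2 / 2) <= _); last by rewrite ler_wpM2l// expR_ge1Dx.
  have m1 : (1 : R) <= m.+1%:R by rewrite ler1n.
  by nra.
- exact: cvg_cst.
- have := @cvgMl_tmp _ _ _ _ _ (normal_peak (1 : R) * 2) _ (@cvg_harmonic R).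
  by rewrite mulr0; apply.
Unshelve. all: by end_near. Qed.

(* Gaussian integration by parts. *)
Lemma stein_cos (lam : R) :
  \int[mu]_x (x * sin (lam * x + ph) * g x) = lam * \int[mu]_x (f lam x).
Proof.
have ic := integrable_cos_gauss lam; have is_ := integrable_xsin_gauss lam.
(* The difference of the two sides is the integral of h'. It is computed on growing intervals, where
   h tends to 0 at both ends. *)
pose h x := sin (lam * x + ph) * g x.
pose h' x := lam * f lam x - x * sin (lam * x + ph) * g x.
have dh x : is_derive x (1 : R) h (h' x).
  have ds := @is_derive1_comp _ (@sin R) _ x _ _ (is_derive_sin _) (is_derive_linear_arg lam x).
  have := is_deriveM ds (is_derive_gauss x) => H.
  by apply: is_derive_eq H _; rewrite /h' /GRing.scale/=; ring.
have ilc : mu.-integrable setT (EFin \o (fun x => lam * f lam x)).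
  have := integrableZl (mu := mu) measurableT lam ic; apply: eq_integrable => // x _.
have ih' : mu.-integrable setT (EFin \o h') by exact: (integrableB measurableT ilc is_).
apply/eqP; rewrite eq_sym -subr_eq0 -RintegralZl// -RintegralB//; apply/eqP.
rewrite -[LHS]/(\int[mu]_x h' x).
have mh' : measurable_fun setT h' by apply/measurable_EFinP; exact: (measurable_int mu).
have ch' : continuous h'.
  move=> x.
  have cl : {for x, continuous (fun y : R => lam * y + ph)}.
    apply: differentiable_continuous; apply/derivable1_diffP.
    by case: (is_derive_linear_arg lam x).
  have cc : {for x, continuous (fun y : R => cos (lam * y + ph))}.
    by apply: (@continuous_comp _ _ _ (fun y : R => lam * y + ph) cos) => //; exact: continuous_cos.
  have cs : {for x, continuous (fun y : R => sin (lam * y + ph))}.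
    by apply: (@continuous_comp _ _ _ (fun y : R => lam * y + ph) sin) => //; exact: continuous_sin.
  have cg := @continuous_gauss x.
  apply: cvgB; first by apply: cvgM; [exact: cvg_cst|exact: cvgM].
  by apply: cvgM => //; apply: cvgM => //; exact: cvg_id.
pose F m : R -> \bar R := EFin \o (h' \_ `[- m.+1%:R, m.+1%:R]).
have IF m : (\int[mu]_x F m x = (h m.+1%:R - h (- m.+1%:R))%:E)%E.
  have mm : - m.+1%:R < m.+1%:R :> R by rewrite gtrN// ltr0n.
  have -> : (\int[mu]_x F m x = \int[mu]_(x in `[(- m.+1%:R)%R, m.+1%:R]) (h' x)%:E)%E.
    rewrite [RHS]integral_mkcond; apply: eq_integral => x _.
    by rewrite /F/= restrict_EFin.
  have ch x : {for x, continuous h}.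
    by apply: differentiable_continuous; apply/derivable1_diffP; case: (dh x).
  rewrite (@continuous_FTC2 _ h' h _ _ mm)//.
  - exact: continuous_subspaceT.
  - split; first by move=> x _; case: (dh x).
      by apply: cvg_at_right_filter; exact: ch.
    by apply: cvg_at_left_filter; exact: ch.
  - by move=> x _; rewrite derive1E derive_val.
have [|||||_ _ C] := @dominated_convergence _ _ R mu setT measurableT F (EFin \o h')
   (fun x => `|(h' x)%:E|%E).
- move=> m; apply/measurable_EFinP; apply/measurable_restrict => //.
  by rewrite setTI; apply: measurable_funTS.
- exact/measurable_EFinP.
- apply: aeW => x _; apply: cvg_near_cst; near=> m.
  rewrite /F/= patchE mem_set// /= in_itv/=.
  rewrite -ler_norml; apply: ltW; near: m.
  have := nbhs_infty_gtr `|x| => -[k _ Hk]; exists k => // j kj.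
  by apply: lt_trans (Hk j kj) _; rewrite ltr_nat.
- exact: integrable_abse.
- apply: aeW => x m _ /=; rewrite lee_fin /F/= patchE.
  by case: ifP => // _; rewrite normr0.
have C0 : (h m.+1%:R - h (- m.+1%:R)) @[m --> \oo] --> (0 : R).
  have [g1 g2] := gauss_cvg0.
  have B (u : nat -> R) : g (u m) @[m --> \oo] --> 0 -> h (u m) @[m --> \oo] --> 0.
    move=> gu; apply/cvgr0Pnorm_le => e e0; near=> m.
    rewrite /h normrM; apply: le_trans (_ : `|g (u m)| <= _).
      by rewrite ler_piMl// sin_max.
    by near: m; move/cvgr0Pnorm_le : gu; apply.
  by have := cvgB (B _ g1) (B _ g2); rewrite subr0; apply.
rewrite /Rintegral.
have -> : (\int[mu]_x (h' x)%:E = 0)%E; last by [].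
have C1 : (h m.+1%:R - h (- m.+1%:R))%:E @[m --> \oo] --> 0%:E by apply: cvg_EFin => //; exact: nearW.
have C2 : (h m.+1%:R - h (- m.+1%:R))%:E @[m --> \oo] --> (\int[mu]_x (h' x)%:E)%E.
  by move: C; under eq_fun do rewrite IF.
exact: (cvg_unique _ C2 C1).
Unshelve. all: by end_near. Qed.

Definition gchar (lam : R) : R := \int[mu]_x f lam x.

(** Differentiation under the integral, dominated by |x| g x, followed by the integration by parts
    [stein_cos]. *)
Lemma is_derive_gchar (lam : R) : is_derive lam (1 : R) gchar (- lam * gchar lam).
Proof.
have d1 l x : is_derive l (1 : R) (f ^~ x) (- (x * sin (l * x + ph) * g x)).
  have dl : is_derive l (1 : R) (fun y : R => y * x + ph) x.
    by apply: is_derive_eq; rewrite /GRing.scale/=; ring.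
  have dc := @is_derive1_comp _ (@cos R) _ l _ _ (is_derive_cos _) dl.
  have := @is_deriveZ _ _ _ _ (g x) l 1 _ dc.
  rewrite (_ : _ \*: _ = f ^~ x); last by apply/funext => y; exact: mulrC.
  by move=> H; apply: is_derive_eq H _; rewrite /GRing.scale/=; ring.
have p1 l x : partial1of2 f l x = - (x * sin (l * x + ph) * g x).
  by rewrite partial1of2E; case: (d1 l x).
have Il : [set` `]lam - 1, lam + 1[] lam.
  by rewrite /= in_itv/= ltrBlDr ltrDl ltr01.
have G0 (x : R) : 0 <= `|x| * g x by rewrite mulr_ge0// normal_pdf_ge0.
have Gub l x : [set` `]lam - 1, lam + 1[] l -> [set: R] x -> `|partial1of2 f l x| <= `|x| * g x.
  move=> _ _; rewrite p1 normrN !normrM (ger0_norm (normal_pdf_ge0 _ _ _)) ler_wpM2r ?normal_pdf_ge0//.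
  by rewrite -[leRHS]mulr1 ler_wpM2l// sin_max.
have dl l x (_ : [set` `]lam - 1, lam + 1[] l) (_ : [set: R] x) : derivable (f ^~ x) l 1.
  by case: (d1 l x).
have il l (_ : [set` `]lam - 1, lam + 1[] l) := integrable_cos_gauss l.
have H := @derivable_under_integral R _ _ mu f setT measurableT lam _ _ Il il dl _ G0
   integrable_absx_gauss Gub.
have E := @differentiation_under_integral R _ _ mu f setT measurableT lam _ _ Il il dl _ G0
   integrable_absx_gauss Gub.
apply: DeriveDef; first exact: H.
rewrite -derive1E E.
have -> : (fun y => partial1of2 f lam y) = (fun x => (-1) * (x * sin (lam * x + ph) * g x)).
  by apply/funext => x; rewrite p1 mulN1r.
rewrite RintegralZl//; last exact: integrable_xsin_gauss.
by rewrite stein_cos mulN1r mulNr.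
Qed.

(** The differential equation of [is_derive_gchar] is solved with the integrating factor exp (lam^2
    / 2). *)
Lemma gcharE (lam : R) : gchar lam = expR (- (lam ^+ 2 / 2)) * cos ph.
Proof.
pose F (l : R) := gchar l * expR (l ^+ 2 / 2).
have dF l : is_derive l (1 : R) F 0.
  have de : is_derive l (1 : R) (fun y : R => y ^+ 2 / 2) l.
    by apply: is_derive_eq; rewrite /GRing.scale/=; field.
  have dx := @is_derive1_comp _ (@expR R) _ l _ _ (is_derive_expR _) de.
  have := is_deriveM (is_derive_gchar l) dx => H.
  by apply: is_derive_eq H _; rewrite /GRing.scale/=; ring.
have F0 : F 0 = cos ph.
  rewrite /F expr0n mul0r expR0 mulr1 /gchar.
  under eq_Rintegral do rewrite mul0r add0r.
  rewrite RintegralZl//; last exact: integrable_normal_pdf.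
  by rewrite /Rintegral integral_normal_pdf mulr1.
have := is_derive_0_is_cst lam 0 dF; rewrite F0 /F => <-.
by rewrite mulrCA -expRD addrC subrr expR0 mulr1.
Qed.

Lemma Ex_cos_normal01 (lam : R) :
  Ex N01 (fun x => cos (lam * x + ph)) = expR (- (lam ^+ 2 / 2)) * cos ph.
Proof.
rewrite -gcharE /Ex /Rintegral integral_normal01//.
exact: brv_cos (measurable_linear_arg lam).
Qed.

End GaussianCharacteristic.

(** * Weak convergence from characteristic functions *)

Section Bernstein.
Variable R : realType.
Implicit Types (p : R) (u v : nat -> R).

(* Expectation of [u k] for a binomial variable [k] of parameters [m] and [p]. *)
Fixpoint bern p (m : nat) u : R :=
  if m is m'.+1 then p * bern p m' (fun k => u k.+1) + (1 - p) * bern p m' u else u 0%N.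

Lemma bern_affine p m (c e : R) u : bern p m (fun k => c + e * u k) = c + e * bern p m u.
Proof. by elim: m u => [|m ih] u //=; rewrite !ih; ring. Qed.

(** Variance plus squared bias of the binomial law. The centre [c] stays general because the
    recursion shifts it. *)
Lemma bern_sqr p m (c : R) :
  bern p m (fun k => (k%:R - c) ^+ 2) = m%:R * p * (1 - p) + (m%:R * p - c) ^+ 2.
Proof.
elim: m c => [|m ih] c /=; first by ring.
have -> : (fun k : nat => (k.+1%:R - c) ^+ 2) = (fun k => (k%:R - (c - 1)) ^+ 2).
  by apply/funext => k; rewrite -natr1; ring.
by rewrite !ih -natr1; ring.
Qed.

Lemma bern_le p m u v : 0 <= p <= 1 -> (forall k, (k <= m)%N -> u k <= v k) ->
  bern p m u <= bern p m v.
Proof.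
move=> /andP[p0 p1]; elim: m u v => [|m ih] u v uv /=; first exact: uv.
apply: lerD; apply: ler_wpM2l; rewrite ?subr_ge0//; apply: ih => k km; apply: uv.
  exact: km.
exact: leqW.
Qed.

Lemma bern_norm_le p m u v : 0 <= p <= 1 -> (forall k, (k <= m)%N -> `|u k| <= v k) ->
  `|bern p m u| <= bern p m v.
Proof.
move=> p01 uv; rewrite ler_norml; apply/andP; split.
  have -> : - bern p m v = bern p m (fun k => 0 + (-1) * v k) by rewrite bern_affine; ring.
  apply: bern_le => // k /uv; rewrite ler_norml => /andP[h _].
  by rewrite add0r mulN1r.
by apply: bern_le => // k /uv; rewrite ler_norml => /andP[].
Qed.

End Bernstein.

(** * Trigonometric polynomials and approximation by them *)

Section Trig.
Variable R : realType.
Local Notation E3 := (R * R * R)%type.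
Implicit Types (l : E3) (f g : E3 -> R).

Inductive trig : (E3 -> R) -> Prop :=
| trig_cos ph l : trig (fun y => cos (ph + dot3 l y))
| trig_add f g : trig f -> trig g -> trig (fun y => f y + g y)
| trig_scale c f : trig f -> trig (fun y => c * f y).

Lemma trig_eq f g : trig f -> f =1 g -> trig g.
Proof. by move=> tf /funext <-. Qed.

Lemma dot3D l l' y : dot3 (l + l') y = dot3 l y + dot3 l' y.
Proof. by rewrite /dot3/=; ring. Qed.

Lemma dot3N l y : dot3 (- l) y = - dot3 l y.
Proof. by rewrite /dot3/=; ring. Qed.

Lemma trig_cst c : trig (fun=> c).
Proof.
apply: trig_eq (trig_scale c (trig_cos 0 0)) _ => y.
have -> : dot3 0 y = 0 by rewrite /dot3/=; ring.
by rewrite addr0 cos0 mulr1.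
Qed.

(** The product formula for two cosines makes the linear span an algebra. *)
Lemma trig_mul f g : trig f -> trig g -> trig (fun y => f y * g y).
Proof.
move=> + tg; elim=> [ph l|{}f f' _ ih _ ih'|c {}f _ ih]; last 2 first.
- by apply: trig_eq (trig_add ih ih') _ => y; rewrite mulrDl.
- by apply: trig_eq (trig_scale c ih) _ => y; rewrite mulrA.
elim: tg => [ph' l'|{}g g' _ ih _ ih'|c {}g _ ih]; last 2 first.
- by apply: trig_eq (trig_add ih ih') _ => y; rewrite mulrDr.
- by apply: trig_eq (trig_scale c ih) _ => y; rewrite mulrCA.
apply: trig_eq (trig_scale 2^-1 (trig_add (trig_cos (ph + ph') (l + l'))
  (trig_cos (ph - ph') (l - l')))) _ => y.
rewrite !dot3D dot3N.
have -> : ph + ph' + (dot3 l y + dot3 l' y) = (ph + dot3 l y) + (ph' + dot3 l' y) by ring.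
have -> : ph - ph' + (dot3 l y - dot3 l' y) = (ph + dot3 l y) - (ph' + dot3 l' y) by ring.
by rewrite cosD cosB; field.
Qed.

Lemma trig_bern (p : E3 -> R) m (F : nat -> E3 -> R) : trig p -> (forall k, trig (F k)) ->
  trig (fun y => bern (p y) m (fun k => F k y)).
Proof.
move=> tp; elim: m F => [|m ih] F tF /=; first exact: tF.
apply: trig_add; first by apply: trig_mul => //; apply: ih => k; exact: tF.
apply: trig_mul; last exact: ih.
by apply: trig_eq (trig_add (trig_cst 1) (trig_scale (-1) tp)) _ => y; rewrite mulN1r.
Qed.

Lemma trig_sin l : trig (fun y => sin (dot3 l y)).
Proof.
apply: trig_eq (trig_cos (- (pi / 2)) l) _ => y.
by rewrite addrC cosBpihalf.
Qed.

Section Approx.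
Variable f : E3 -> R.
Hypothesis cf : continuous f.
Variable M : R.
Hypothesis M0 : 0 < M.

(** Maps the whole space into the cube of half-side M and is close to the identity on bounded sets
    for large M, so polynomial approximation on a cube yields a uniform approximation on the
    space. *)
Definition squash y : E3 := (M * sin (y.1.1 / M), M * sin (y.1.2 / M), M * sin (y.2 / M)).

Definition cube : set E3 := (`[- M, M] `*` `[- M, M]) `*` `[- M, M].

Lemma cube_compact : compact cube.
Proof.
by apply: compact_setX; [apply: compact_setX|]; exact: segment_compact.
Qed.

(** Close points use uniform continuity; for distant ones the quadratic term exceeds the total
    oscillation. The square is what a binomial average turns into a variance. *)
Lemma cube_quadratic_modulus (e : R) : 0 < e -> exists2 D, 0 <= D & forall x y, cube x -> cube y ->
  `|f x - f y| <= e + D * ((x.1.1 - y.1.1) ^+ 2 + (x.1.2 - y.1.2) ^+ 2 + (x.2 - y.2) ^+ 2).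
Proof.
move=> e0.
have cf' : {within cube, continuous f} by exact: continuous_subspaceT.
have [del del0 H] := compact_unif_continuous cube_compact cf' e0.
have /compact_bounded[C [_ HC]] : compact (f @` cube).
  exact: continuous_compact cube_compact.
pose B := `|C| + 1.
have fB x : cube x -> `|f x| <= B.
  move=> cx; apply: (HC B); last by exists x.
  by rewrite (le_lt_trans (ler_norm _))// ltrDl.
have B0 : 0 <= B by rewrite addr_ge0.
have B2 : 0 <= 2 * B by rewrite mulr_ge0.
have D0 := divr_ge0 B2 (sqr_ge0 del).
exists (2 * B / del ^+ 2) => //.
move=> x y cx cy.
set s := _ + _ + _.
have s0 : 0 <= s by rewrite !addr_ge0 ?sqr_ge0.
have [sd|sd] := ltP s (del ^+ 2).
  have bxy : ball x del y.
    have aux (u v : R) : (u - v) ^+ 2 <= s -> ball u del v.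
      move=> uv; rewrite -ball_normE/= -(@ltr_pXn2r _ 2)// ?nnegrE ?(ltW del0)//.
      by rewrite real_normK ?num_real// (le_lt_trans uv).
    have sq (u v : R) := sqr_ge0 (u - v).
    have a1 := sq x.1.1 y.1.1; have a2 := sq x.1.2 y.1.2; have a3 := sq x.2 y.2.
    by split; [split|]; apply: aux; rewrite /s; lra.
  have := H _ _ cx cy bxy; rewrite -ball_normE/= => /ltW h.
  by apply: le_trans h _; rewrite lerDl mulr_ge0.
apply: le_trans (_ : 2 * B <= _).
  by rewrite (le_trans (ler_normB _ _))// mulr2n mulrDl mul1r lerD// fB.
apply: ler_wpDl; first exact: ltW.
by rewrite -[leRHS]mulrA ler_peMr// ler_pdivlMl ?exprn_gt0// mulr1.
Qed.

Definition prb (u : R) : R := (1 + sin (u / M)) / 2.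

Lemma prb01 u : 0 <= prb u <= 1.
Proof.
have := sin_max (u / M); rewrite ler_norml => /andP[h1 h2].
by rewrite /prb; apply/andP; split; lra.
Qed.

Lemma prbE u : M * (2 * prb u - 1) = M * sin (u / M).
Proof. by rewrite /prb; field. Qed.

Definition node (m k : nat) : R := M * (2 * (k%:R / m.+1%:R) - 1).

Lemma node_in m k : (k <= m.+1)%N -> `[- M, M]%classic (node m k).
Proof.
move=> km; rewrite /= in_itv/= /node.
have k0 : 0 <= k%:R / m.+1%:R :> R by rewrite divr_ge0.
have k1 : k%:R / m.+1%:R <= 1 :> R by rewrite ler_pdivrMr ?ltr0n// mul1r ler_nat.
set u := k%:R / _ in k0 k1 *.
have h0 : 0 <= M * u by rewrite mulr_ge0// ltW.
have h1 : M * u <= M by rewrite ler_piMr// ltW.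
have -> : M * (2 * u - 1) = 2 * (M * u) - M by ring.
by apply/andP; split; lra.
Qed.

Lemma squash_in y : cube (squash y).
Proof.
have h u : `[- M, M]%classic (M * sin (u / M)).
  have := sin_max (u / M); rewrite ler_norml => /andP[h1 h2].
  by rewrite /= in_itv/=; rewrite -ler_norml normrM gtr0_norm// ler_piMr ?sin_max// ltW.
by split; [split|]; exact: h.
Qed.

(** Under the binomial law the nodes have mean M sin (u / M) and variance 4 M^2 p (1 - p) / (m + 1),
    at most M^2 / (m + 1). *)
Lemma bern_node m u (c e : R) :
  bern (prb u) m.+1 (fun k => c + e * (node m k - M * sin (u / M)) ^+ 2) <= c + `|e| * (M ^+ 2 / m.+1%:R).
Proof.
have -> : (fun k : nat => c + e * (node m k - M * sin (u / M)) ^+ 2) =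
   (fun k => c + (e * (4 * M ^+ 2 / m.+1%:R ^+ 2)) * (k%:R - m.+1%:R * prb u) ^+ 2).
  by apply/funext => k; rewrite -prbE /node; field.
rewrite bern_affine bern_sqr subrr expr0n addr0 lerD2l.
have pq : prb u * (1 - prb u) <= 4^-1.
  by have := sqr_ge0 (prb u - 2^-1); lra.
have pq0 : 0 <= prb u * (1 - prb u).
  by have /andP[h1 h2] := prb01 u; rewrite mulr_ge0// subr_ge0.
have -> : e * (4 * M ^+ 2 / m.+1%:R ^+ 2) * (m.+1%:R * prb u * (1 - prb u)) =
   e * ((4 * (prb u * (1 - prb u))) * (M ^+ 2 / m.+1%:R)) by field.
have h : 0 <= M ^+ 2 / m.+1%:R by rewrite divr_ge0 ?sqr_ge0.
apply: le_trans (_ : `|e| * ((4 * (prb u * (1 - prb u))) * (M ^+ 2 / m.+1%:R)) <= _).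
  by apply: ler_wpM2r; [apply: mulr_ge0 => //; apply: mulr_ge0|exact: ler_norm].
rewrite ler_wpM2l// ler_piMl//; lra.
Qed.

Definition tapprox m y : R :=
  bern (prb y.1.1) m.+1 (fun i => bern (prb y.1.2) m.+1 (fun j =>
    bern (prb y.2) m.+1 (fun k => f (node m i, node m j, node m k)))).

Lemma trig_tapprox m : trig (tapprox m).
Proof.
have ts (pr : E3 -> R) l : (forall y, pr y / M = dot3 l y) -> trig (fun y => prb (pr y)).
  move=> h; apply: trig_eq (trig_add (trig_cst 2^-1) (trig_scale 2^-1 (trig_sin l))) _ => y.
  by rewrite /prb -h; field.
apply: trig_bern => [|i]; first by apply: (ts _ (M^-1, 0, 0)) => y; rewrite /dot3/=; ring.
apply: trig_bern => [|j]; first by apply: (ts _ (0, M^-1, 0)) => y; rewrite /dot3/=; ring.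
apply: trig_bern => [|k]; first by apply: (ts _ (0, 0, M^-1)) => y; rewrite /dot3/=; ring.
exact: trig_cst.
Qed.

Lemma trig_dense (e : R) : 0 < e -> exists2 g, trig g & forall y, `|f (squash y) - g y| <= e.
Proof.
move=> e0; have e2 : 0 < e / 2 by rewrite divr_gt0.
have [D D0 H] := cube_quadratic_modulus e2.
(* Large enough for the three coordinate variances, times D, to total at most e / 2. *)
pose m := Num.truncn (3 * D * M ^+ 2 / (e / 2)).
exists (tapprox m); first exact: trig_tapprox.
move=> y.
set a := squash y; have ca : cube a by exact: squash_in.
have -> : f a - tapprox m y = - (tapprox m y - f a) by ring.
rewrite normrN.
have bsub p k (c : R) (u : nat -> R) : bern p k u - c = bern p k (fun i => u i - c).
  have -> : (fun i => u i - c) = (fun i => - c + 1 * u i) by apply/funext => i; ring.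
  by rewrite bern_affine; ring.
have p1 := prb01 y.1.1; have p2 := prb01 y.1.2; have p3 := prb01 y.2.
pose V := D * (M ^+ 2 / m.+1%:R).
have Vle : 3 * V <= e / 2.
  rewrite /V mulrA mulrA ler_pdivrMr ?ltr0n// -ler_pdivrMl// mulrC.
  by apply: ltW; exact: truncnS_gt.
apply: (@le_trans _ _ (e / 2 + 3 * V)); last by lra.
pose q (u : R) (k : nat) := (node m k - M * sin (u / M)) ^+ 2.
(* The coordinates are averaged from the innermost outwards, each replacing its quadratic term by
   the variance bound [V]. *)
have b3 i j : (i <= m.+1)%N -> (j <= m.+1)%N ->
  `|bern (prb y.2) m.+1 (fun k => f (node m i, node m j, node m k)) - f a| <=
  e / 2 + D * q y.1.1 i + D * q y.1.2 j + V.
  move=> im jm; rewrite bsub.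
  apply: le_trans (@bern_norm_le _ _ _ _ (fun k => (e / 2 + D * q y.1.1 i + D * q y.1.2 j) + D * q y.2 k) p3 _) _.
    move=> k km; apply: le_trans (H _ _ _ ca) _.
      by split; [split|]; exact: node_in.
    by rewrite /a /squash /q/=; apply: eq_ler; ring.
  by apply: le_trans (bern_node _ _ _ _) _; rewrite ger0_norm.
have b2 i : (i <= m.+1)%N ->
  `|bern (prb y.1.2) m.+1 (fun j => bern (prb y.2) m.+1 (fun k => f (node m i, node m j, node m k))) - f a| <=
  e / 2 + D * q y.1.1 i + V + V.
  move=> im; rewrite bsub.
  apply: le_trans (@bern_norm_le _ _ _ _ (fun j => (e / 2 + D * q y.1.1 i + V) + D * q y.1.2 j) p2 _) _.
    by move=> j jm; apply: le_trans (b3 _ _ im jm) _; apply: eq_ler; ring.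
  by apply: le_trans (bern_node _ _ _ _) _; rewrite ger0_norm.
rewrite /tapprox bsub.
apply: le_trans (@bern_norm_le _ _ _ _ (fun i => (e / 2 + V + V) + D * q y.1.1 i) p1 _) _.
  by move=> i im; apply: le_trans (b2 _ im) _; apply: eq_ler; ring.
apply: le_trans (bern_node _ _ _ _) _; rewrite ger0_norm// -/V.
by apply: eq_ler; ring.
Qed.

End Approx.
End Trig.

(** * The characteristic function of the normal law in dimension 3 *)

Section ProductGaussian.
Variables (R : realType) (d : measure_display) (U : measurableType d).
Variable Q : probability U R.
Local Notation N01 := (@normal_prob R 0 1).

(** Fubini, with X u acting as the phase of the one-dimensional formula. *)
Lemma Ex_cos_prod (X : U -> R) (lam : R) : measurable_fun setT X ->
  Ex (Q \x N01)%E (fun z => cos (X z.1 + lam * z.2)) =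
  expR (- (lam ^+ 2 / 2)) * Ex Q (fun u => cos (X u)).
Proof.
move=> mX.
have mXz : measurable_fun setT (fun z : U * R => X z.1 + lam * z.2).
  apply: measurable_funD; first exact: (measurableT_comp mX measurable_fst).
  by apply: measurable_funM; [exact: measurable_cst|exact: measurable_snd].
have iF := brv_integrable (Q \x N01)%E (brv_cos mXz).
have bc := brv_cos mX.
rewrite -ExZ// /Ex /Rintegral -(integral12_prod_meas1 iF); congr fine.
apply: eq_integral => u _; rewrite /fubini_F/=.
have -> : (\int[N01]_y (cos (X u + lam * y))%:E)%E =
    (Ex N01 (fun y => cos (lam * y + X u)))%:E.
  rewrite /Ex /Rintegral fineK.
    by apply: eq_integral => y _; rewrite addrC.
  apply: integrable_fin_num => //.
  exact: (@brv_integrable _ _ _ N01 _ (brv_cos (measurable_linear_arg (X u) lam))).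
by rewrite Ex_cos_normal01.
Qed.

End ProductGaussian.

Section Normal3.
Variable R : realType.
Local Notation N01 := (@normal_prob R 0 1).
Local Notation N2 := (N01 \x N01)%E.
Local Notation N3 := (N2 \x N01)%E.

Lemma Ex_cos_normal3 (ph : R) l :
  Ex N3 (fun y => cos (ph + dot3 l y)) = expR (- (nsq l / 2)) * cos ph.
Proof.
have m1 : measurable_fun setT (fun u : R => ph + l.1.1 * u).
  apply: measurable_funD; first exact: measurable_cst.
  by apply: measurable_funM; first exact: measurable_cst.
have m2 : measurable_fun setT (fun u : R * R => (ph + l.1.1 * u.1) + l.1.2 * u.2).
  apply: measurable_funD; first exact: (measurableT_comp m1 measurable_fst).
  by apply: measurable_funM; [exact: measurable_cst|exact: measurable_snd].
have -> : (fun y : R * R * R => cos (ph + dot3 l y)) =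
    (fun z => cos (((ph + l.1.1 * z.1.1) + l.1.2 * z.1.2) + l.2 * z.2)).
  by apply/funext => y; rewrite /dot3 !addrA.
rewrite (Ex_cos_prod N2 _ m2) (Ex_cos_prod N01 _ m1).
under eq_fun do rewrite addrC.
rewrite Ex_cos_normal01 !mulrA -!expRD; congr (expR _ * _).
by rewrite /nsq; field.
Qed.

End Normal3.

(** * Tail bounds from the characteristic function near 0 *)

Section Tails.
Variables (R : realType) (d : measure_display) (U : measurableType d).
Variable Q : probability U R.
Variable Y : U -> R.
Hypothesis mY : measurable_fun setT Y.
Hypothesis HY : forall lam : R, `|Ex Q (fun u => cos (lam * Y u)) - expR (- (lam ^+ 2 / 2))| <= lam ^+ 2.

Lemma measurable_absY (r : R) : measurable [set u | r < `|Y u|].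
Proof. by apply: measurable_gt; exact: measurableT_comp. Qed.

(** By [HY], E (1 - cos (lam Y)) <= 2 lam^2, while the variable is at least lam^2 r^2 / 4 when r <
    |Y| <= 1 / lam. The factors lam^2 cancel, and lam tends to 0. *)
Lemma tail_bound (r : R) : 0 < r -> Ex Q (\1_[set u | r < `|Y u|] : U -> R) <= 8 / r ^+ 2.
Proof.
move=> r0.
pose A (m : nat) := [set u | r < `|Y u|] `&` ~` [set u | m.+1%:R < `|Y u|].
have mA m : measurable (A m).
  by apply: measurableI; [|apply: measurableC]; exact: measurable_absY.
have bA m : Ex Q (\1_(A m) : U -> R) <= 8 / r ^+ 2.
  set lam : R := m.+1%:R^-1.
  have lam0 : 0 < lam by rewrite invr_gt0.
  have bi := brv_indic R (mA m).
  have ml : measurable_fun setT (fun u => lam * Y u).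
    by apply: measurable_funM; first exact: measurable_cst.
  have bc := brv_cos ml.
  have b1 : brv (fun u => 1 - cos (lam * Y u)) by apply: brvB => //; exact: brv_cst.
  have h1 : Ex Q (fun u => 1 - cos (lam * Y u)) <= 2 * lam ^+ 2.
    rewrite ExB//; last exact: brv_cst.
    rewrite Ex_cst.
    have := HY lam; rewrite ler_norml => /andP[h _].
    have := expR_ge1Dx (- (lam ^+ 2 / 2)); have := sqr_ge0 lam.
    by lra.
  have h2 : lam ^+ 2 * (r ^+ 2 / 4) * Ex Q (\1_(A m) : U -> R) <= Ex Q (fun u => 1 - cos (lam * Y u)).
    rewrite -ExZ//; apply: le_Ex => [||u]; [exact: brvZ|exact: b1|].
    rewrite indicE; case: (boolP (u \in A m)) => [/set_mem[/= ru /negP uM]|_]; last first.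
      by rewrite mulr0 subr_ge0 cos_le1.
    rewrite -leNgt in uM; rewrite mulr1.
    set v := lam * Y u.
    have v1 : v ^+ 2 <= 1.
      rewrite -real_normK ?num_real// expr_le1// /v normrM gtr0_norm//.
      by rewrite /lam ler_pdivrMl// mulr1.
    have vr : lam ^+ 2 * r ^+ 2 <= v ^+ 2.
      rewrite /v exprMn ler_wpM2l ?sqr_ge0// -[leRHS]real_normK ?num_real//.
      by rewrite ler_pXn2r ?nnegrE ?(ltW r0)// ltW.
    (* As v^2 <= 1, 1 - cos v >= v^2 / 2 - v^4 / 24 >= v^2 / 4. *)
    have [_ _ _ c4 _] := sin_ge_cubic (normr_ge0 v).
    have e2 : `|v| ^+ 2 = v ^+ 2 by rewrite real_normK ?num_real.
    have e4 : `|v| ^+ 4 = v ^+ 2 * v ^+ 2 by rewrite -e2 -exprD.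
    have ca : cos `|v| = cos v by case: (ler0P v) => // _; rewrite cosN.
    rewrite e2 e4 ca in c4.
    have v0 := sqr_ge0 v.
    have : v ^+ 2 * v ^+ 2 <= v ^+ 2 by rewrite ler_piMr.
    by lra.
  have h3 := le_trans h2 h1.
  rewrite ler_pdivlMr ?exprn_gt0//.
  have l2 : 0 < lam ^+ 2 by rewrite exprn_gt0.
  rewrite -(ler_pM2l l2).
  have -> : lam ^+ 2 * (Ex Q (\1_(A m) : U -> R) * r ^+ 2) =
     4 * (lam ^+ 2 * (r ^+ 2 / 4) * Ex Q (\1_(A m) : U -> R)) by field.
  by lra.
have C : Ex Q (\1_(A m) : U -> R) @[m --> \oo] --> Ex Q (\1_[set u | r < `|Y u|] : U -> R).
  apply: (@cvg_Ex _ _ _ Q _ _ 1) => [m||m u|u].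
  - exact: measurable_indic.
  - by apply: measurable_indic; exact: measurable_absY.
  - by rewrite indicE; case: (u \in _); rewrite ?normr0 ?normr1.
  apply: cvg_near_cst; near=> m.
  rewrite !indicE; congr (nat_of_bool _)%:R.
  have um : `|Y u| < m.+1%:R.
    near: m; have := nbhs_infty_gtr `|Y u| => -[k _ Hk]; exists k => // j kj.
    by apply: lt_trans (Hk j kj) _; rewrite ltr_nat.
  apply/idP/idP => /set_mem h; apply: mem_set; first by case: h.
  by split=> //=; apply/negP; rewrite -leNgt ltW.
rewrite -(cvg_lim _ C)//; apply: limr_le; first by apply/cvg_ex; eexists; exact: C.
by near=> m; exact: bA.
Unshelve. all: by end_near. Qed.

End Tails.

(** * From trigonometric to bounded continuous functions *)

Section WeakConvergence.
Variables (R : realType) (d : measure_display) (T : measurableType d).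
Variable P : probability T R.
Local Notation E3 := (R * R * R)%type.
Local Notation N01 := (@normal_prob R 0 1).
Local Notation N3 := (N01 \x N01 \x N01)%E.
Variable X : R -> T -> E3.
Hypothesis mX : forall t : R, 0 < t -> measurable_fun setT (X t).
Hypothesis HX : forall l (ph t : R), 0 < t ->
  `|Ex P (fun x => cos (ph + dot3 l (X t x))) - expR (- (nsq l / 2)) * cos ph| <= nsq l / t.

Lemma measurable_dot3 (l : E3) : measurable_fun setT (fun y : E3 => dot3 l y).
Proof.
have m1 : measurable_fun setT (fun y : E3 => y.1.1).
  exact: (measurableT_comp measurable_fst measurable_fst).
have m2 : measurable_fun setT (fun y : E3 => y.1.2).
  exact: (measurableT_comp measurable_snd measurable_fst).
by apply: measurable_funD; [apply: measurable_funD|]; apply: measurable_funM => //;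
  exact: measurable_cst.
Qed.

Lemma trig_brv (g : E3 -> R) : trig g -> brv g.
Proof.
elim=> [ph l|{}g g' _ bg _ bg'|c {}g _ bg]; [|exact: brvD|exact: brvZ].
by apply: brv_cos; apply: measurable_funD; [exact: measurable_cst|exact: measurable_dot3].
Qed.

Lemma brv_comp (g : E3 -> R) (t : R) : brv g -> 0 < t -> brv (fun x => g (X t x)).
Proof.
move=> [mg [M gM]] t0; split; first exact: (measurableT_comp mg (mX t0)).
by exists M => x.
Qed.

Lemma cvg_Ex_trig (g : E3 -> R) : trig g -> Ex P (fun x => g (X t x)) @[t --> +oo] --> Ex N3 g.
Proof.
elim=> [ph l|{}g g' tg cg tg' cg'|c {}g tg cg].
- rewrite Ex_cos_normal3; apply/cvgrPdist_le => e e0.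
  near=> t.
  have t0 : 0 < t by near: t; exact: nbhs_pinfty_gt.
  rewrite distrC; apply: le_trans (HX l ph t0) _.
  by rewrite ler_pdivrMr// -ler_pdivrMl// mulrC; near: t.
- rewrite ExD; [|exact: trig_brv..].
  apply: cvg_trans (cvgD cg cg'); apply: near_eq_cvg; near=> t.
  have t0 : 0 < t by near: t; exact: nbhs_pinfty_gt.
  by rewrite [RHS]ExD//; apply: brv_comp => //; exact: trig_brv.
- rewrite ExZ; last exact: trig_brv.
  apply: cvg_trans (@cvgMl_tmp _ _ _ _ _ c _ cg); apply: near_eq_cvg; near=> t.
  have t0 : 0 < t by near: t; exact: nbhs_pinfty_gt.
  by rewrite [RHS]ExZ//; apply: brv_comp => //; exact: trig_brv.
Unshelve. all: by end_near. Qed.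

Variable f : E3 -> R.
Hypothesis cf : continuous f.
Variable C : R.
Hypothesis fC : forall y, `|f y| <= C.

Lemma sin_close (v : R) : `|sin v| <= `|v| /\ `|v - sin v| <= `|v| ^+ 3.
Proof.
wlog v0 : v / 0 <= v.
  move=> h; case: (leP 0 v) => [|v0]; first exact: h.
  have := h (- v); rewrite oppr_ge0 => /(_ (ltW v0)).
  by rewrite sinN !normrN -opprD normrN.
have [s1 _ s3 _ _] := sin_ge_cubic v0.
have v3 : 0 <= v ^+ 3 by exact: exprn_ge0.
rewrite (ger0_norm v0); split; last by rewrite ger0_norm; lra.
have [v1|v1] := leP v 1.
  have h : v ^+ 3 <= v by rewrite exprS ler_piMr// expr_le1.
  by rewrite ler_norml; apply/andP; split; lra.
by apply: le_trans (sin_max _) (ltW v1).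
Qed.

Lemma squash_close (r e : R) : 0 < r -> 0 < e -> exists2 M0, 0 < M0 &
  forall M y, M0 <= M -> cube r y -> `|f y - f (squash M y)| <= e.
Proof.
move=> r0 e0.
have cf' : {within @cube R r, continuous f} by exact: continuous_subspaceT.
have [del del0 H] := compact_unif_continuous (@cube_compact R r) cf' e0.
(* On the cube the displacement of each coordinate is at most r^3 / M^2, hence at most r^3 / M
   because M >= 1. *)
exists (r ^+ 3 / del + 1); first by rewrite ltr_wpDl// divr_ge0 ?exprn_ge0// ltW.
move=> M y M0 cy.
have rd0 : 0 <= r ^+ 3 / del by rewrite divr_ge0 ?exprn_ge0// ltW.
have M1 : 1 <= M by lra.
have Mgt0 : 0 < M by lra.
have aux u : `[- r, r]%classic u -> `[- r, r]%classic (M * sin (u / M)) /\ ball u del (M * sin (u / M)).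
  rewrite /= !in_itv/= -!ler_norml => ur.
  have [h1 h2] := sin_close (u / M).
  have uM : `|u / M| = `|u| / M by rewrite normrM normfV (gtr0_norm Mgt0).
  split.
    apply: le_trans ur; rewrite normrM (gtr0_norm Mgt0).
    by apply: le_trans (_ : M * (`|u| / M) <= _); [rewrite ler_pM2l// -uM|rewrite mulrC divfK ?gt_eqF].
  rewrite -ball_normE/=.
  have -> : u - M * sin (u / M) = M * (u / M - sin (u / M)) by field; rewrite gt_eqF.
  rewrite normrM (gtr0_norm Mgt0).
  apply: le_lt_trans (_ : M * (`|u| / M) ^+ 3 < del); first by rewrite ler_pM2l// -uM.
  have -> : M * (`|u| / M) ^+ 3 = `|u| ^+ 3 / M / M by field; rewrite gt_eqF.
  apply: le_lt_trans (_ : r ^+ 3 / M < del).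
    apply: le_trans (_ : `|u| ^+ 3 / M <= _).
      by rewrite ler_pdivrMr// ler_peMr// divr_ge0 ?exprn_ge0// ltW.
    by rewrite ler_pM2r ?invr_gt0// ler_pXn2r ?nnegrE// ltW.
  rewrite ltr_pdivrMr// mulrC -ltr_pdivrMr//; lra.
have [[c1 c2] c3] := cy.
have [a1 b1] := aux _ c1; have [a2 b2] := aux _ c2; have [a3 b3] := aux _ c3.
have h : ball (f y) e (f (squash M y)) by apply: H => //; split=> //; split.
by move: h; rewrite -ball_normE/= => /ltW.
Qed.

(** For the product sigma-algebra, measurability follows from [f] being a pointwise limit of
    trigonometric polynomials. *)
Lemma measurable_continuous3 : measurable_fun setT f.
Proof.
have inv0 (m : nat) : (0 : R) < m.+1%:R^-1 by rewrite invr_gt0.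
have M0 (m : nat) : (0 : R) < m.+1%:R by [].
have [g gP] : {g : nat -> E3 -> R & forall m, trig (g m) /\
    forall y, `|f (squash m.+1%:R y) - g m y| <= m.+1%:R^-1}.
  apply: (@choice _ _ (fun m (h : E3 -> R) => trig h /\
    forall y, `|f (squash m.+1%:R y) - h y| <= m.+1%:R^-1)) => m.
  by have [h th hh] := trig_dense cf (M0 m) (inv0 m); exists h.
apply: (@measurable_fun_cvg _ _ _ _ g) => [m|y _].
  by have [tg _] := gP m; case: (trig_brv tg).
apply/cvgrPdist_le => e e0.
have e2 : 0 < e / 2 by rewrite divr_gt0.
pose r := `|y.1.1| + `|y.1.2| + `|y.2| + 1.
have r0 : 0 < r by rewrite ltr_wpDl// !addr_ge0.
have cy : cube r y.
  have n1 := normr_ge0 y.1.1; have n2 := normr_ge0 y.1.2; have n3 := normr_ge0 y.2.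
  by split; [split|]; rewrite /= in_itv/= -ler_norml /r; lra.
have [K K0 HK] := squash_close r0 e2.
have h := @cvg_harmonic R.
near=> m.
have mK : K <= m.+1%:R.
  near: m; have := nbhs_infty_ger K => -[k _ Hk]; exists k => // j kj.
  by apply: le_trans (Hk j kj) _; rewrite ler_nat.
have me : (m.+1%:R^-1 : R) <= e / 2.
  apply: le_trans (ler_norm _) _; near: m; move/cvgr0Pnorm_le : h; apply; exact: e2.
have [_ gm] := gP m.
have -> : f y - g m y = (f y - f (squash m.+1%:R y)) + (f (squash m.+1%:R y) - g m y) by ring.
apply: le_trans (ler_normD _ _) _; rewrite (splitr e); apply: lerD; first exact: HK.
exact: le_trans (gm y) me.
Unshelve. all: by end_near. Qed.

Definition out (r : R) (y : E3) : R :=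
  \1_[set z : E3 | r < `|z.1.1|] y + \1_[set z : E3 | r < `|z.1.2|] y + \1_[set z : E3 | r < `|z.2|] y.

(** [tail_bound] for [l] along each coordinate axis; 24 is three times 8. *)
Lemma Ex_out_le (dU : measure_display) (U : measurableType dU) (Q : probability U R)
    (Y : U -> E3) (r : R) : 0 < r -> measurable_fun setT Y ->
  (forall l, `|Ex Q (fun u => cos (dot3 l (Y u))) - expR (- (nsq l / 2))| <= nsq l) ->
  brv (fun u => out r (Y u)) /\ Ex Q (fun u => out r (Y u)) <= 24 / r ^+ 2.
Proof.
move=> r0 mY H.
have m1 := measurableT_comp (@measurable_fst _ _ _ _) mY.
have m11 := measurableT_comp (@measurable_fst _ _ _ _) m1.
have m12 := measurableT_comp (@measurable_snd _ _ _ _) m1.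
have m2 := measurableT_comp (@measurable_snd _ _ _ _) mY.
have ind (Z : U -> R) : measurable_fun setT Z -> brv (\1_[set u | r < `|Z u|] : U -> R).
  by move=> mZ; apply: brv_indic; exact: measurable_absY.
have t1 : Ex Q (\1_[set u | r < `|(Y u).1.1|] : U -> R) <= 8 / r ^+ 2.
  apply: (tail_bound m11) => // lam; have := H (lam, 0, 0).
  have -> : (fun u => cos (dot3 (lam, 0, 0) (Y u))) = (fun u => cos (lam * (Y u).1.1)).
    by apply/funext => u; rewrite /dot3/= !mul0r !addr0.
  by have -> : nsq (lam, 0, 0) = lam ^+ 2 by rewrite /nsq/=; ring.
have t2 : Ex Q (\1_[set u | r < `|(Y u).1.2|] : U -> R) <= 8 / r ^+ 2.
  apply: (tail_bound m12) => // lam; have := H (0, lam, 0).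
  have -> : (fun u => cos (dot3 (0, lam, 0) (Y u))) = (fun u => cos (lam * (Y u).1.2)).
    by apply/funext => u; rewrite /dot3/= !mul0r add0r addr0.
  by have -> : nsq (0, lam, 0) = lam ^+ 2 by rewrite /nsq/=; ring.
have t3 : Ex Q (\1_[set u | r < `|(Y u).2|] : U -> R) <= 8 / r ^+ 2.
  apply: (tail_bound m2) => // lam; have := H (0, 0, lam).
  have -> : (fun u => cos (dot3 (0, 0, lam) (Y u))) = (fun u => cos (lam * (Y u).2)).
    by apply/funext => u; rewrite /dot3/= !mul0r !add0r.
  by have -> : nsq (0, 0, lam) = lam ^+ 2 by rewrite /nsq/=; ring.
have b1 := ind _ m11; have b2 := ind _ m12; have b3 := ind _ m2.
have E : (fun u => out r (Y u)) = (fun u => \1_[set u | r < `|(Y u).1.1|] u +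
   \1_[set u | r < `|(Y u).1.2|] u + \1_[set u | r < `|(Y u).2|] u) by [].
rewrite E; split; first by apply: brvD => //; exact: brvD.
rewrite ExD//; last exact: brvD.
by rewrite ExD//; lra.
Qed.

Lemma cvg_Ex_continuous : Ex P (fun x => f (X t x)) @[t --> +oo] --> Ex N3 f.
Proof.
have bf : brv f by split; [exact: measurable_continuous3|exists C].
have C0 : 0 <= C by exact: le_trans (normr_ge0 _) (fC 0).
apply/cvgrPdist_le => e e0.
(* The final estimate uses 3 e' + e' + 3 e'. *)
pose e' := e / 10.
have e'0 : 0 < e' by rewrite divr_gt0.
pose r := 48 * C / e' + 1.
have h48 : 0 <= 48 * C / e' by rewrite divr_ge0 ?(ltW e'0)// mulr_ge0.
have r0 : 0 < r by rewrite ltr_wpDl.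
have r1 : 1 <= r by rewrite lerDr.
have Cr : 2 * C * (24 / r ^+ 2) <= e'.
  have -> : 2 * C * (24 / r ^+ 2) = 48 * C / r ^+ 2 by field; rewrite gt_eqF.
  rewrite ler_pdivrMr ?exprn_gt0// [e' * _]mulrC -ler_pdivrMr//.
  apply: le_trans (_ : r <= _); first by rewrite /r lerDl.
  by rewrite expr2 ler_peMr// ltW.
have [M M0 HM] := squash_close r0 e'0.
have [g tg Hg] := trig_dense cf M0 e'0.
have bg := trig_brv tg.
have fg y : `|f y - g y| <= 2 * e' + 2 * C * out r y.
  have -> : f y - g y = (f y - f (squash M y)) + (f (squash M y) - g y) by ring.
  apply: le_trans (ler_normD _ _) _.
  have i0 (A : set E3) : 0 <= \1_A y :> R by rewrite indicE.
  have := i0 [set z : E3 | r < `|z.1.1|]; have := i0 [set z : E3 | r < `|z.1.2|].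
  have := i0 [set z : E3 | r < `|z.2|] => j3 j2 j1.
  have o0 : 0 <= out r y by rewrite /out; lra.
  have := Hg y.
  have [cy|ncy] := pselect (cube r y).
    have := HM M y (lexx _) cy.
    have : 0 <= 2 * C * out r y by rewrite !mulr_ge0.
    by lra.
  have o1 : 1 <= out r y.
    rewrite leNgt; apply/negP => o1; apply: ncy.
    have k (A : set E3) : \1_A y < 1 :> R -> ~ A y.
      by rewrite indicE => h Ay; rewrite mem_set// ltxx in h.
    have k1 : ~ (r < `|y.1.1|) by apply: (k [set z : E3 | r < `|z.1.1|]); move: o1; rewrite /out; lra.
    have k2 : ~ (r < `|y.1.2|) by apply: (k [set z : E3 | r < `|z.1.2|]); move: o1; rewrite /out; lra.
    have k3 : ~ (r < `|y.2|) by apply: (k [set z : E3 | r < `|z.2|]); move: o1; rewrite /out; lra.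
    by split; [split|]; rewrite /= in_itv/= -ler_norml leNgt; apply/negP.
  have : `|f y - f (squash M y)| <= 2 * C.
    rewrite (le_trans (ler_normB _ _))//.
    have := fC y; have := fC (squash M y); lra.
  have : 2 * C <= 2 * C * out r y by rewrite ler_peMr// mulr_ge0.
  by lra.
(* Stated for an arbitrary probability space, as it serves both for the Gaussian law and for the law
   of X t. *)
have gap (dU : measure_display) (U : measurableType dU) (Q : probability U R) (Y : U -> E3) :
    measurable_fun setT Y -> brv (fun u => out r (Y u)) /\ Ex Q (fun u => out r (Y u)) <= 24 / r ^+ 2 ->
    `|Ex Q (fun u => f (Y u)) - Ex Q (fun u => g (Y u))| <= 3 * e'.
  move=> mY [bo Eo].
  have bfY : brv (fun u => f (Y u)).
    by case: bf => mf _; split; [exact: (measurableT_comp mf mY)|exists C].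
  have bgY : brv (fun u => g (Y u)).
    by case: bg => mg [K gK]; split; [exact: (measurableT_comp mg mY)|exists K].
  rewrite -ExB//.
  apply: le_trans (_ : Ex Q (fun u => 2 * e' + 2 * C * out r (Y u)) <= _).
    apply: le_norm_Ex => [||u]; [exact: brvB| |exact: fg].
    by apply: brvD; [exact: brv_cst|exact: brvZ].
  rewrite ExD; [|exact: brv_cst|exact: brvZ].
  rewrite Ex_cst ExZ//.
  have : 2 * C * Ex Q (fun u => out r (Y u)) <= 2 * C * (24 / r ^+ 2).
    by rewrite ler_wpM2l// mulr_ge0.
  by lra.
have gapN : `|Ex N3 f - Ex N3 g| <= 3 * e'.
  apply: (gap _ _ N3 id) => //; apply: Ex_out_le => // l.
  have := Ex_cos_normal3 0 l; under eq_fun do rewrite add0r.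
  by move=> ->; rewrite cos0 mulr1 subrr normr0 nsq_ge0.
have cg := cvg_Ex_trig tg.
near=> t.
(* From time 1 on the error |l|^2 / t is at most |l|^2, which makes the tail bound uniform in t. *)
have t1 : 1 <= t by near: t; exact: nbhs_pinfty_ge.
have t0 : 0 < t by lra.
have gapt : `|Ex P (fun x => f (X t x)) - Ex P (fun x => g (X t x))| <= 3 * e'.
  apply: (gap _ _ P (X t)) => //; first exact: mX.
  apply: Ex_out_le => //; first exact: mX.
  move=> l; have := HX l 0 t0.
  have -> : (fun x => cos (0 + dot3 l (X t x))) = (fun x => cos (dot3 l (X t x))).
    by apply/funext => x; rewrite add0r.
  rewrite cos0 mulr1 => h; apply: le_trans h _.
  by rewrite ler_pdivrMr// ler_peMr// nsq_ge0.
have gt : `|Ex N3 g - Ex P (fun x => g (X t x))| <= e'.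
  near: t; move/cvgrPdist_le : cg; apply; exact: e'0.
move: gapN gapt gt; rewrite !ler_norml => /andP[h1 h2] /andP[h3 h4] /andP[h5 h6].
by rewrite /e' in h1 h2 h3 h4 h5 h6; apply/andP; split; lra.
Unshelve. all: by end_near. Qed.

End WeakConvergence.

Section Normal3Integral.
Variable R : realType.
Local Notation E3 := (R * R * R)%type.
Local Notation N01 := (@normal_prob R 0 1).
Local Notation N3 := (N01 \x N01 \x N01)%E.

Lemma integral_normal3 (f : E3 -> R) : brv f ->
  (\int[@normal3 R]_y (f y)%:E)%E = (Ex N3 f)%:E.
Proof.
move=> bf.
have fi := @brv_integrable _ _ _ N3 f bf.
rewrite /Ex fineK; last by apply: integrable_fin_num.
(* [normal3] lives on the generated sigma-algebra of [normal_prob]; the one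
   inferred from the type of [f] has the same sets but another display. *)
match goal with |- @integral ?d ?Y _ _ _ _ = @integral ?dX ?X _ _ _ _ =>
  have H := fun m1 mf => @integral_pushforward dX d X Y R (fun y => y) m1 N3 setT (EFin \o f) mf fi end.
by apply: H => //; apply/measurable_EFinP; case: bf.
Qed.

End Normal3Integral.

Unset Implicit Arguments.

Theorem theorem3p9 (R : realType) (d : measure_display) (T : measurableType d)
    (P : probability T R) (n : nat) (hn : (1 <= n)%N)
    (w : R -> T -> 'M[R]_(n, 4)) (a : R -> T -> R * R * R)
    (hw : brownian_motion_HHn P w 0) (ha : stochastic_area P w a) :
  converges_in_distribution P
    (fun t x => (Num.sqrt t)^-1 *: a t x) (@normal3 R).
Proof.
move=> f cf [C fC].
pose X t x := (Num.sqrt t)^-1 *: a t x.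
have mX t : 0 < t -> measurable_fun setT (X t).
  move=> t0; have [ma _] := ha t (ltW t0).
  have m1 := measurableT_comp (@measurable_fst _ _ _ _) ma.
  have m11 := measurableT_comp (@measurable_fst _ _ _ _) m1.
  have m12 := measurableT_comp (@measurable_snd _ _ _ _) m1.
  have m2 := measurableT_comp (@measurable_snd _ _ _ _) ma.
  have k (g : T -> R) : measurable_fun setT g ->
      measurable_fun setT (fun x => (Num.sqrt t)^-1 * g x).
    by move=> mg; apply: measurable_funM => //; exact: measurable_cst.
  apply: measurable_fun_pair; last exact: k.
  by apply: measurable_fun_pair; exact: k.
have HX l (ph t : R) : 0 < t ->
  `|Ex P (fun x => cos (ph + dot3 l (X t x))) - expR (- (nsq l / 2)) * cos ph| <= nsq l / t.
  by move=> t0; have := area_char hn hw ha l ph t0.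
have bf : brv f by split; [exact: measurable_continuous3 cf|exists C].
have fin (dU : measure_display) (U : measurableType dU) (Q : probability U R) (g : U -> R) :
    brv g -> (\int[Q]_x (g x)%:E)%E = (Ex Q g)%:E.
  by move=> bg; rewrite /Ex fineK//; apply: integrable_fin_num => //; exact: brv_integrable.
rewrite integral_normal3//.
apply: cvg_trans (_ : (Ex P (fun x => f (X t x)))%:E @[t --> +oo] `=>` _).
  apply: near_eq_cvg; near=> t.
  have t0 : 0 < t by near: t; exact: nbhs_pinfty_gt.
  rewrite -fin//; case: bf => mf _; split; last by exists C => x; exact: fC.
  exact: (measurableT_comp mf (mX t t0)).
apply: cvg_EFin; first by near=> t.
exact: (cvg_Ex_continuous mX HX cf fC).
Unshelve. all: by end_near. Qed.
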